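(* Assume that the initial-boundary value problem $$\frac{\partial^2u}{\partial t^2}-\left(\alpha(t)+\beta(t)\iint_\Omega|\nabla u|^2\,dx\,dy\right)\Delta u=f,\qquad u(0)=u_0,\quad \partial_tu(0)=v_0,\quad u(t)|_{\partial\Omega}=0\ \ (t\in[0,T]),$$ is well posed, with exact solution $u$, and suppose that: (i) $u_0\in D(\mathcal L_0)$; $v_0,w_0\in C^1(\overline\Omega)$; $u_x$ and $u_y$ have continuous second temporal derivatives; for every $t\in[0,T]$, $f(t)\in C^1(\overline\Omega)$ with $f(t)|_{\partial\Omega}=0$, the spatial derivatives of $f(t)$ being bounded uniformly in $t$; and moreover $u_0\in D(\mathcal L^2)$, $v_0\in D(\mathcal L)$, $f\in C([0,T];D(\mathcal L^{1/2}))$ with $f(0)\in D(\mathcal L)$. (ii) $u(t)$ is three times continuously differentiable with respect to $t$, and $u_{ttt}(t)$ is Lipschitz continuous in $t$ as a map into $L^2(\Omega)$. (iii) The second-order spatial derivatives $u_{xx}(t)$ and $u_{yy}(t)$ are continuously differentiable with respect to $t$, and the mixed derivatives $u_{xxt}(t)$ and $u_{yyt}(t)$ are Lipschitz continuous in $t$ as maps into $L^2(\Omega)$. Then there exist $\overline T\in(0,T]$ and constants $C_1,C_2>0$ independent of $\tau$ such that, for every integer $n>1$, with $\tau=T/n$, and every solution sequence $\{u_k\}_{k=0}^n$ of the nonlinear scheme, the error $z_k=u(t_k)-u_k$ satisfies $$\max_{1\le k\le m}\|\nabla z_k\|\le C_1\tau^2\qquad\text{and}\qquad\max_{1\le k\le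 m}\left\|\frac{z_k-z_{k-1}}{\tau}\right\|\le C_2\tau^2,\qquad m=\left[\frac{\overline T}{\tau}\right],$$ where $[\cdot]$ denotes the integer part.
   Context: $\Omega\subset\mathbb R^2$ is a bounded convex domain; $\|\cdot\|$ is the norm of $L^2(\Omega)$. Functions $u$ and $f$ are regarded as functions of $t$ with values in a space of functions on $\Omega$; subscripts $x,y,t$ on $u$ denote partial derivatives. $\mathcal L_0=-\Delta$ with $D(\mathcal L_0)=\{u\in C^2(\overline\Omega):u|_{\partial\Omega}=0\}$; $\mathcal L$ is its Friedrichs extension, i.e. the unique self-adjoint positive definite operator in $L^2(\Omega)$ associated with the form $a(u,v)=(\nabla u,\nabla v)$ on $H^1_0(\Omega)$; $D(\mathcal L^{1/2})=H_0^1(\Omega)$, $\|\mathcal L^{1/2}u\|=\|\nabla u\|$, and powers $\mathcal L^a$, $a>0$, with their domains are defined by the spectral calculus. $T>0$; $\alpha,\beta\in C^1([0,T])$ are real-valued with $\min_{[0,T]}\alpha>0$ and $\min_{[0,T]}\beta>0$; $f\in C([0,T];L^2(\Omega))$. For an integer $n>1$, $\tau=T/n$, $t_k=k\tau$, $\alpha_k=\alpha(t_k)$, $\beta_k=\beta(t_k)$, $f_k=f(t_k)$. Further, $$w_0=f_0+q_0\Delta u_0,\qquad q_0=\alpha_0+\beta_0\iint_\Omega|\nabla u_0|^2\,dx\,dy .$$ A solution sequence of the nonlinear scheme is a sequence $u_0,\dots,u_n\in D(\mathcal L)$ with the given $u_0$, with $u_1=u_0+\tau v_0+\frac{\tau^2}{2}w_0$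 and, for $k=1,\dots,n-1$, $$\frac{u_{k+1}-2u_k+u_{k-1}}{\tau^2}+\frac12\left(\alpha_k+\frac{\beta_k}{2}\left(\|\mathcal L^{1/2}u_{k+1}\|^2+\|\mathcal L^{1/2}u_{k-1}\|^2\right)\right)\left(\mathcal L u_{k+1}+\mathcal L u_{k-1}\right)=f_k .$$ *)

(* Defs.v *)
(* A function on a plane domain [Om] is represented by a total function
   [R * R -> R].  Apart from the test functions [C1_compact], which live on the
   whole plane, only its values on [Om] matter, and for the L2 notions only
   its class modulo almost everywhere equality on [Om].
   A function of time with values in a space of functions on [Om] is a
   function [R -> R * R -> R], of which only the times in [0, T] matter. *)
From mathcomp Require Import all_boot all_order all_algebra.
From mathcomp Require Import all_classical all_reals all_analysis.

Set Implicit Arguments.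
Unset Strict Implicit.
Unset Printing Implicit Defensive.

Import Order.TTheory GRing.Theory Num.Theory.
Import numFieldNormedType.Exports.

Local Open Scope classical_set_scope.
Local Open Scope ring_scope.

Section PlaneDomain.
Variable R : realType.
Local Notation plane := (R * R)%type.
Implicit Types (Om : set plane) (f g h u v w : plane -> R).
Implicit Types (F G : R -> plane -> R).

Definition lebesgue2 :
  {measure set (measurableTypeR R * measurableTypeR R)%type -> \bar R} :=
  (@lebesgue_measure R \x @lebesgue_measure R)%E.

Definition bounded_convex_domain Om : Prop :=
  [/\ open Om, Om !=set0, bounded_set Om &
      convex_set (Om : set (convex_lmodType plane))].

(** ** The Hilbert space L2(Om) *)

Definition ae_eq_on Om f g : Prop :=
  {ae lebesgue2, forall p, Om p -> f p = g p}.

Definition L2 Om f : Prop := (f \_ Om) \in Lfun lebesgue2 2%:E.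

Definition L2norm Om f : R := fine ('N[lebesgue2]_2%:E[EFin \o (f \_ Om)])%E.

Definition L2ip Om f g : R := \int[lebesgue2]_(p in Om) (f p * g p).

(** ** Classical derivatives and the spaces C^k of the closed domain *)

Definition dx f : plane -> R := fun p => 'D_((1, 0) : plane) f p.
Definition dy f : plane -> R := fun p => 'D_((0, 1) : plane) f p.

Definition laplacian f : plane -> R := dx (dx f) \+ dy (dy f).

(* For classically differentiable [f]. *)
Definition dirichlet_integral Om f : R :=
  \int[lebesgue2]_(p in Om) (dx f p ^+ 2 + dy f p ^+ 2).

Definition C0_closure Om f : Prop :=
  exists2 h, {within closure Om, continuous h} &
             forall p, Om p -> h p = f p.

Fixpoint Ck_closure (k : nat) Om f : Prop :=
  C0_closure Om f /\
  if k is k'.+1 then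
    [/\ forall p, Om p -> derivable f p ((1, 0) : plane) /\
                          derivable f p ((0, 1) : plane),
        Ck_closure k' Om (dx f) & Ck_closure k' Om (dy f)]
  else True.

(* The boundary values are those of the continuous extension to the closure;
   [Om] being open, its boundary is the set difference below. *)
Definition zero_on_boundary Om f : Prop :=
  exists h, [/\ {within closure Om, continuous h},
                forall p, Om p -> h p = f p &
                forall p, (closure Om `\` Om) p -> h p = 0].

(* D(L_0), for L_0 = - Laplacian. *)
Definition dom_L0 Om f : Prop := Ck_closure 2 Om f /\ zero_on_boundary Om f.

(** ** Weak derivatives and H^1_0(Om) *)

(* As in Gilbarg-Trudinger, first-order weak derivatives are tested against,
   and H^1_0 is the closure of, the functions of class C^1 with compact
   support in [Om]. *)
Definition C1_compact Om f : Prop :=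
  [/\ forall p, derivable f p ((1, 0) : plane) /\
                derivable f p ((0, 1) : plane),
      continuous f, continuous (dx f), continuous (dy f) &
      exists K : set plane,
        [/\ compact K, K `<=` Om & forall p, ~ K p -> f p = 0]].

Definition is_weak_dx Om u g : Prop :=
  L2 Om g /\
  forall phi, C1_compact Om phi -> L2ip Om u (dx phi) = - L2ip Om g phi.

Definition is_weak_dy Om u g : Prop :=
  L2 Om g /\
  forall phi, C1_compact Om phi -> L2ip Om u (dy phi) = - L2ip Om g phi.

(* Representatives of the weak derivatives; meaningful only on H^1(Om). *)
Definition weak_dx Om u : plane -> R := xget (cst 0) [set g | is_weak_dx Om u g].
Definition weak_dy Om u : plane -> R := xget (cst 0) [set g | is_weak_dy Om u g].

Definition H1 Om u : Prop :=
  [/\ L2 Om u, exists g, is_weak_dx Om u g & exists g, is_weak_dy Om u g].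

(* a(u, v) = (grad u, grad v). *)
Definition grad_ip Om u v : R :=
  L2ip Om (weak_dx Om u) (weak_dx Om v) + L2ip Om (weak_dy Om u) (weak_dy Om v).

Definition grad_norm Om u : R := Num.sqrt (grad_ip Om u u).

Definition H10 Om u : Prop :=
  H1 Om u /\
  exists phi : nat -> plane -> R,
    [/\ forall j, C1_compact Om (phi j),
        L2norm Om (phi j \- u) @[j --> \oo] --> (0 : R) &
        grad_norm Om (phi j \- u) @[j --> \oo] --> (0 : R)].

(** ** The operator L and its powers *)

(* The graph of L, the self-adjoint operator associated with the form
   [grad_ip] on H^1_0: [friedrichs Om u g] reads "u is in D(L) and L u = g". *)
Definition friedrichs Om u g : Prop :=
  [/\ H10 Om u, L2 Om g & forall v, H10 Om v -> grad_ip Om u v = L2ip Om g v].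

Definition dom_L Om u : Prop := exists g, friedrichs Om u g.

(* A Hilbert basis of L2(Om) made of eigenfunctions of L. *)
Definition eigenbasis Om (lam : nat -> R) (phi : nat -> plane -> R) : Prop :=
  [/\ forall j, 0 < lam j,
      forall j, friedrichs Om (phi j) (fun p => lam j * phi j p),
      forall i j, L2ip Om (phi i) (phi j) = (i == j)%:R &
      forall u, L2 Om u ->
        L2norm Om (fun p => u p - \sum_(0 <= j < N) L2ip Om u (phi j) * phi j p)
          @[N --> \oo] --> (0 : R)].

(* Spectral calculus: "u is in D(L^a) and L^a u = w", that is,
   L^a u = sum_j lam_j^a (u, phi_j) phi_j, the series converging in L2(Om).
   L has a discrete spectrum because Om is bounded; the graph does not depend
   on the chosen eigenbasis. *)
Definition L_pow Om (a : R) u w : Prop :=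
  [/\ L2 Om u, L2 Om w &
      exists lam phi, eigenbasis Om lam phi /\
        forall j, L2ip Om w (phi j) = lam j `^ a * L2ip Om u (phi j)].

Definition dom_L_pow Om (a : R) u : Prop := exists w, L_pow Om a u w.

(** ** Functions of time on [0, T]; derivatives are one-sided at 0 and T *)

Definition C1_time (T : R) (a : R -> R) : Prop :=
  exists a' : R -> R, {within `[0, T], continuous a'} /\
    forall t, 0 <= t <= T ->
      (s - t)^-1 * (a s - a t) @[s --> within `[0, T] t^'] --> a' t.

Definition L2_continuous Om (T : R) F : Prop :=
  forall t, 0 <= t <= T -> L2 Om (F t) /\
    L2norm Om (F s \- F t) @[s --> within `[0, T] (nbhs t)] --> (0 : R).

(* F is in C^1([0, T]; L2(Om)) with derivative G. *)
Definition L2_C1 Om (T : R) F G : Prop :=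
  [/\ L2_continuous Om T F, L2_continuous Om T G &
      forall t, 0 <= t <= T ->
        L2norm Om (fun p => (s - t)^-1 * (F s p - F t p) - G t p)
          @[s --> within `[0, T] t^'] --> (0 : R)].

Definition L2_lipschitz Om (T : R) F : Prop :=
  exists M : R, forall s t, 0 <= s <= T -> 0 <= t <= T ->
    L2norm Om (F s \- F t) <= M * `|s - t|.

(* F is in C([0, T]; D(L^a)), for the graph norm. *)
Definition dom_L_pow_continuous Om (T a : R) F : Prop :=
  L2_continuous Om T F /\
  exists G, (forall t, 0 <= t <= T -> L_pow Om a (F t) (G t)) /\
            L2_continuous Om T G.

(** ** The Kirchhoff equation *)

Definition kirchhoff_solution Om (T : R) (al be : R -> R) F u0 v0
    (u : R -> plane -> R) : Prop :=
  (forall t, 0 <= t <= T -> dom_L0 Om (u t)) /\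
  exists ut utt, [/\ L2_C1 Om T u ut, L2_C1 Om T ut utt,
    forall t, 0 <= t <= T ->
      ae_eq_on Om
        (fun p => utt t p - (al t + be t * dirichlet_integral Om (u t)) *
                            laplacian (u t) p)
        (F t),
    forall p, Om p -> u 0 p = u0 p &
    ae_eq_on Om (ut 0) v0].

(* The problem has exactly one solution, namely [u]. *)
Definition well_posed_with_solution Om (T : R) (al be : R -> R) F u0 v0
    (u : R -> plane -> R) : Prop :=
  kirchhoff_solution Om T al be F u0 v0 u /\
  forall u' : R -> plane -> R, kirchhoff_solution Om T al be F u0 v0 u' ->
    forall t p, 0 <= t <= T -> Om p -> u' t p = u t p.

Definition w_init Om (al be : R -> R) F u0 : plane -> R :=
  fun p => F 0 p + (al 0 + be 0 * dirichlet_integral Om u0) * laplacian u0 p.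

(** ** The nonlinear three-layer scheme *)

(* [LU k] and [SU k] are L u_k and L^(1/2) u_k. *)
Definition scheme_solution Om (T : R) (al be : R -> R) F u0 v0 (n : nat)
    (U : nat -> plane -> R) : Prop :=
  let tau := T / n%:R in
  let t k := k%:R * tau in
  [/\ ae_eq_on Om (U 0%N) u0,
      ae_eq_on Om (U 1%N)
        (fun p => u0 p + tau * v0 p + tau ^+ 2 / 2 * w_init Om al be F u0 p) &
      exists LU SU : nat -> plane -> R,
        (forall k, (k <= n)%N ->
           friedrichs Om (U k) (LU k) /\ L_pow Om 2^-1 (U k) (SU k)) /\
        (forall k, (1 <= k < n)%N ->
           ae_eq_on Om
             (fun p =>
                (U k.+1 p - 2 * U k p + U k.-1 p) / tau ^+ 2 +
                2^-1 * (al (t k) + be (t k) / 2 *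
                          (L2norm Om (SU k.+1) ^+ 2 + L2norm Om (SU k.-1) ^+ 2)) *
                (LU k.+1 p + LU k.-1 p))
             (F (t k)))].

End PlaneDomain.

(* Main.v *)
Require Import Defs.
From mathcomp Require Import all_boot all_order all_algebra.
From mathcomp Require Import all_classical all_reals all_analysis.
From mathcomp Require Import measurable_realfun.
From mathcomp Require Import ring lra.
Import Order.TTheory GRing.Theory Num.Theory.
Import numFieldNormedType.Exports.
Local Open Scope classical_set_scope.
Local Open Scope ring_scope.

(** The proof is an energy estimate closed by a bootstrap.

    Let z_k be the error, e_k the L2 norm of its gradient and d_k the L2 norm of
    (z_k - z_(k-1)) / tau.  Subtracting the scheme from the equation satisfied by
    the exact values gives
      (z_(k+1) - 2 z_k + z_(k-1)) / tau^2 + Q/2 L (z_(k+1) + z_(k-1))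
        = r_k - (Q' - Q)/2 L (u(t_(k+1)) + u(t_(k-1))),
    where Q and Q' are the averaged coefficients built on the discrete and on the
    exact gradients.  By Taylor's formula r_k = O(tau^2)
    ([residual_bound_exists]), and e_1, d_1 = O(tau^2) ([initial_error]).  Taking the
    scalar product with z_(k+1) - z_(k-1) turns both terms on the left into
    differences of squares ([energy_inequality], [scheme_energy]):
      d_(k+1)^2 + Q/2 e_(k+1)^2 <= d_k^2 + Q/2 e_(k-1)^2
        + tau (|r_k| + C |Q' - Q|) (d_(k+1) + d_k).

    From then on only real sequences matter ([scheme_run]).  Since
    |Q' - Q| is bounded by e_(k+1), e_(k-1) and their squares, Gronwall's
    inequality gives e_k, d_k = O(tau^2) as long as the errors are already known to
    be small ([energy_step], [gronwall_step]).  No bound on the discrete solution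
    is known in advance, and the scheme is implicit, so smallness of e_(k+1) has to
    come from the inequality itself.  It does, because the nonlinearity is
    coercive: Q >= c (1 + e_(k+1)^2), so the left-hand side contains a quartic term
    in e_(k+1) that absorbs the one produced by |Q' - Q|^2 ([coefficient_coercive],
    [one_step]).  The induction of [bootstrap] alternates the two arguments.  It
    works for tau <= tau0 only, and Tbar = min (T, tau0, 1) makes this harmless: if
    tau > Tbar then m = 0 and both maxima are empty.

    The remaining work links the classical hypotheses to the operator L, which is
    defined by a form on H^1_0.  The fundamental lemma of the calculus of
    variations ([fundamental_lemma]) makes weak derivatives unique.  A classical
    function vanishing on the boundary is a limit in H^1 of its truncations, which
    have compact support ([zero_boundary_H10]); hence L u = - Laplacian u
    ([dom_L0_friedrichs]).  Parseval's identity on an eigenbasis identifies the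
    norm of L^(1/2) u_k occurring in the scheme with the gradient norm
    ([half_power_norm]).  Derivatives of L2-valued functions of time are handled
    through their scalar products with fixed vectors, which reduces the mean value
    inequality and Taylor's formula to the real case ([vec_mean_value]). *)

Set Implicit Arguments.
Unset Strict Implicit.
Unset Printing Implicit Defensive.

(** * Semi-inner products and the space L2 *)
Section PreHilbert.
Variables (R : realType) (V : lmodType R).
Implicit Types (S : V -> Prop) (ip : V -> V -> R).

(** A semi-inner product on the subspace [S] of [V]. Being relative to a subspace
   and possibly degenerate, it covers both L2, without quotienting by almost
   everywhere equality, and the gradient form on H^1. *)
Record pre_hilbert S ip : Prop := PreHilbert {
  ph0 : S 0;
  phD : forall x y, S x -> S y -> S (x + y);
  phZ : forall a x, S x -> S (a *: x);
  phC : forall x y, ip x y = ip y x;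
  phDl : forall x y z, S x -> S y -> S z -> ip (x + y) z = ip x z + ip y z;
  phZl : forall a x z, S x -> S z -> ip (a *: x) z = a * ip x z;
  ph_ge0 : forall x, S x -> 0 <= ip x x }.

Variables (S : V -> Prop) (ip : V -> V -> R) (H : pre_hilbert S ip).

Definition pnorm x := Num.sqrt (ip x x).

Lemma phN x : S x -> S (- x).
Proof. by move=> Sx; rewrite -scaleN1r; exact: (phZ H). Qed.

Lemma phB x y : S x -> S y -> S (x - y).
Proof. by move=> Sx Sy; apply: (phD H) => //; exact: phN. Qed.

Lemma phNl x z : S x -> S z -> ip (- x) z = - ip x z.
Proof. by move=> Sx Sz; rewrite -scaleN1r (phZl H)// mulN1r. Qed.

Lemma phBl x y z : S x -> S y -> S z -> ip (x - y) z = ip x z - ip y z.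
Proof. by move=> Sx Sy Sz; rewrite (phDl H) ?phNl//; exact: phN. Qed.

Lemma phDr x y z : S x -> S y -> S z -> ip z (x + y) = ip z x + ip z y.
Proof. by move=> Sx Sy Sz; rewrite !(phC H z) (phDl H). Qed.

Lemma phBr x y z : S x -> S y -> S z -> ip z (x - y) = ip z x - ip z y.
Proof. by move=> Sx Sy Sz; rewrite !(phC H z) phBl. Qed.

Lemma phZr a x z : S x -> S z -> ip z (a *: x) = a * ip z x.
Proof. by move=> Sx Sz; rewrite !(phC H z) (phZl H). Qed.

Lemma pnorm_ge0 x : 0 <= pnorm x. Proof. exact: sqrtr_ge0. Qed.

Lemma pnorm_sq x : S x -> pnorm x ^+ 2 = ip x x.
Proof. by move=> Sx; rewrite sqr_sqrtr//; exact: (ph_ge0 H). Qed.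

Lemma cauchy_schwarz x y : S x -> S y -> `|ip x y| <= pnorm x * pnorm y.
Proof.
move=> Sx Sy.
have Sxx := ph_ge0 H Sx; have Syy := ph_ge0 H Sy.
rewrite -sqrtrM// -sqrtr_sqr ler_sqrt ?mulr_ge0//.
have P a b : 0 <= a ^+ 2 * ip x x + 2 * a * b * ip x y + b ^+ 2 * ip y y.
  have Sab : S (a *: x + b *: y) by apply: (phD H); exact: (phZ H).
  have := ph_ge0 H Sab.
  rewrite (phDl H) ?phDr ?(phZl H) ?phZr//; try by [exact: (phZ H)|].
  rewrite (phC H y x); set A := ip x x; set B := ip x y; set C := ip y y.
  suff -> : a * (a * A) + a * (b * B) + (b * (a * B) + b * (b * C)) =
    a ^+ 2 * A + 2 * a * b * B + b ^+ 2 * C by [].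
  ring.
(* The discriminant inequality B^2 <= A C, with care for A = 0 and C = 0, which
   do not force x = 0 or y = 0. *)
move: (ip x y) (ip x x) (ip y y) Sxx Syy P => B A C A0 C0 P.
case: (ltrgt0P A) A0 => // [A0 _|A0 _].
  have := P (- B) A; nra.
case: (ltrgt0P C) C0 => // [C0 _|C0 _].
  have := P C (- B); nra.
have := P 1 (- B); have := P 1 B; nra.
Qed.

Lemma ip_le_pnorm x y : S x -> S y -> ip x y <= pnorm x * pnorm y.
Proof.
by move=> Sx Sy; rewrite (le_trans (ler_norm _))// cauchy_schwarz.
Qed.

Lemma pnormD x y : S x -> S y -> pnorm (x + y) <= pnorm x + pnorm y.
Proof.
move=> Sx Sy; have Sxy := phD H Sx Sy.
rewrite -(@ler_pXn2r _ 2) ?nnegrE ?addr_ge0 ?pnorm_ge0//.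
rewrite pnorm_sq// (phDl H)// !phDr// sqrrD !pnorm_sq// (phC H y x).
have := ip_le_pnorm Sx Sy; lra.
Qed.

Lemma pnormZ a x : S x -> pnorm (a *: x) = `|a| * pnorm x.
Proof.
move=> Sx; rewrite /pnorm (phZl H) ?phZr//; last exact: (phZ H).
by rewrite mulrA -expr2 sqrtrM ?sqr_ge0// sqrtr_sqr.
Qed.

Lemma pnormN x : S x -> pnorm (- x) = pnorm x.
Proof. by move=> Sx; rewrite -scaleN1r pnormZ// normrN1 mul1r. Qed.

Lemma pnormB x y : S x -> S y -> pnorm (x - y) <= pnorm x + pnorm y.
Proof.
by move=> Sx Sy; rewrite (le_trans (pnormD _ _)) ?pnormN//; exact: phN.
Qed.

Lemma pnorm_dist x y : S x -> S y -> `|pnorm x - pnorm y| <= pnorm (x - y).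
Proof.
move=> Sx Sy.
have := pnormD (phB Sx Sy) Sy; rewrite subrK => h1.
have := pnormD (phB Sy Sx) Sx; rewrite subrK => h2.
have := pnormN (phB Sy Sx); rewrite opprB => h3.
by rewrite ler_norml; apply/andP; split; lra.
Qed.

End PreHilbert.

Section L2basic.
Variable R : realType.
Local Notation plane := (R * R)%type.
Variable Om : set plane.
Local Notation mT := (measurableTypeR R * measurableTypeR R)%type.
Hypothesis mOm : measurable (Om : set mT).
Local Notation mu := (@lebesgue2 R).
Implicit Types f g : plane -> R.

Lemma L2_integrableM f g : L2 Om f -> L2 Om g ->
  mu.-integrable Om (EFin \o (fun p => f p * g p)).
Proof.
move=> Lf Lg.
have /Lfun1_integrable := Lfun2_mul_Lfun1 Lf Lg.
move=> h; apply/(@integrable_mkcond _ _ _ mu) => //.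
apply: eq_integrable h => //= x _; rewrite /patch /=.
by case: ifPn => //= _; rewrite mulr0.
Qed.

Let one_le2 : (1 <= 2%:E :> \bar R)%E.
Proof. by rewrite lee_fin ler1n. Qed.

Lemma L2_pre_hilbert : @pre_hilbert R (plane -> R) (L2 Om) (@L2ip R Om).
Proof.
have D x y : L2 Om x -> L2 Om y -> L2 Om (x + y).
  move=> Lx Ly; rewrite /L2 (_ : _ \_ _ = (x \_ Om) + (y \_ Om)).
    by have [_ h] := Lfun_addr_closed mu one_le2; apply: h.
  by apply/funext => p /=; rewrite /patch !fctE /=; case: ifPn => //; rewrite ?addr0.
have Z a x : L2 Om x -> L2 Om (a *: x).
  move=> Lx; rewrite /L2 (_ : _ \_ _ = a \o* (x \_ Om)).
    by apply: Lfun_scale => //; rewrite ler1n.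
  by apply/funext => p /=; rewrite /patch; case: ifPn; rewrite ?mul0r// mulrC.
split => //.
- rewrite /L2 (_ : _ \_ _ = 0); first by have [h _] := Lfun_addr_closed mu one_le2.
  by apply/funext => p; rewrite /patch; case: ifPn.
- by move=> x y; rewrite /L2ip; apply: eq_Rintegral => p _; rewrite mulrC.
- move=> x y z Lx Ly Lz; rewrite /L2ip -RintegralD//; try exact: L2_integrableM.
  by apply: eq_Rintegral => p _; rewrite mulrDl.
- move=> a x z Lx Lz; rewrite /L2ip -RintegralZl//; try exact: L2_integrableM.
  by apply: eq_Rintegral => p _; rewrite mulrA.
- by move=> x Lx; apply: Rintegral_ge0 => p _; rewrite -expr2 sqr_ge0.
Qed.

Lemma L2normE f : L2 Om f -> L2norm Om f = pnorm (@L2ip R Om) f.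
Proof.
move=> Lf; apply/esym/eqP.
rewrite /L2norm /pnorm.
have h : (fine ('N[mu]_2%:E [EFin \o f \_ Om]) ^+ 2 = L2ip Om f f)%R.
  rewrite /L2ip /Rintegral.
  have -> : (\int[mu]_(x in Om) (f x * f x)%:E = 'N[mu]_2%:E [EFin \o f \_ Om] `^ 2)%E.
    rewrite poweR_Lnorm// [LHS]integral_mkcond; apply: eq_integral => p _.
    rewrite /patch /=; case: ifPn => _; rewrite ?normr0 ?powR0//=.
    by rewrite powR_mulrn// real_normK ?num_real// expr2.
  have : ('N[mu]_2%:E [EFin \o f \_ Om] \is a fin_num)%E.
    by rewrite ge0_fin_numE ?Lnorm_ge0//; case/andP : Lf => _; rewrite inE.
  by move=> /fineK <- /=; rewrite powR_mulrn// fine_ge0// Lnorm_ge0.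
by rewrite -h sqrtr_sqr ger0_norm// fine_ge0// Lnorm_ge0.
Qed.

End L2basic.

(** * Differentiation and Taylor formulas in time *)
Section RealTime.
Variable R : realType.
Implicit Types (T : R) (phi psi : R -> R).

(** Differentiability on [0, T], one-sided at the endpoints, in a form without
   quotient, which passes to vector-valued functions by Cauchy-Schwarz. *)
Definition real_deriv T phi psi := forall t, 0 <= t <= T ->
  forall e, 0 < e -> exists2 d, 0 < d & forall s, 0 <= s <= T -> `|s - t| < d ->
    `|phi s - phi t - (s - t) * psi t| <= e * `|s - t|.

Lemma quotient_real_deriv T phi psi :
  (forall t, 0 <= t <= T ->
    (s - t)^-1 * (phi s - phi t) @[s --> within `[0, T] t^'] --> psi t) ->
  real_deriv T phi psi.
Proof.
move=> h t tT e e0; have /cvgrPdist_le /(_ e e0) := h t tT.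
rewrite near_withinE /dnbhs near_withinE => /nbhs_ballP[d /= d0 dP].
exists d => // s sT; have [->|st] := eqVneq s t.
  by rewrite !subrr mul0r subrr normr0 mulr0.
move=> std; have := dP s; rewrite /ball /= distrC => /(_ std st).
rewrite in_itv /= => /(_ sT).
have st0 : s - t != 0 by rewrite subr_eq0.
move=> h1; have -> : phi s - phi t - (s - t) * psi t =
    - (psi t - (s - t)^-1 * (phi s - phi t)) * (s - t) by field.
by rewrite normrM normrN ler_wpM2r.
Qed.

Lemma is_derive_real_deriv T phi psi :
  (forall t, 0 <= t <= T -> is_derive t 1 phi (psi t)) -> real_deriv T phi psi.
Proof.
move=> h t tT e e0.
have [dphi phiE] := h t tT.
have : h^-1 *: (phi (h *: 1 + t) - phi t) @[h --> 0^'] --> psi t.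
  by rewrite -phiE /derive; exact: dphi.
move=> /cvgrPdist_le /(_ e e0); rewrite /dnbhs near_withinE.
move=> /nbhs_ballP[d /= d0 dP]; exists d => // s _.
have [->|st] := eqVneq s t.
  by rewrite !subrr mul0r subrr normr0 mulr0.
move=> std; have := dP (s - t); rewrite /ball /= sub0r normrN => /(_ std).
have st0 : s - t != 0 by rewrite subr_eq0.
move=> /(_ st0); rewrite [_ *: 1]mulr1 subrK.
move=> h1; have -> : phi s - phi t - (s - t) * psi t =
    - (psi t - (s - t)^-1 * (phi s - phi t)) * (s - t) by field.
by rewrite normrM normrN ler_wpM2r.
Qed.

Lemma real_deriv_continuous T phi psi a b : real_deriv T phi psi ->
  0 <= a -> b <= T -> {within `[a, b], continuous phi}.
Proof.
move=> h a0 bT; apply/subspace_continuousP => x /=; rewrite in_itv /= => /andP[ax xb].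
have xT : 0 <= x <= T by rewrite (le_trans a0)// (le_trans xb).
have [d d0 dP] := h x xT 1 ltr01.
apply/cvgrPdist_le => e e0; rewrite near_withinE; apply/nbhs_ballP.
set K := `|psi x| + 1.
have K0 : 0 < K by rewrite ltr_wpDl.
exists (Num.min d (e / K)) => /=; first by rewrite lt_min d0 divr_gt0.
move=> s; rewrite /ball /= distrC lt_min => /andP[sd se].
rewrite in_itv /= => /andP[as_ sb].
have sT : 0 <= s <= T by rewrite (le_trans a0)// (le_trans sb).
have := dP s sT sd; rewrite mul1r => h1.
rewrite distrC; apply: (@le_trans _ _ (K * `|s - x|)); last first.
  by rewrite mulrC -ler_pdivlMr// ltW.
rewrite -[phi s - phi x](subrK ((s - x) * psi x)) (le_trans (ler_normD _ _))//.
by rewrite normrM /K; lra.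
Qed.

Lemma real_deriv_interior T phi psi x : real_deriv T phi psi ->
  0 < x < T -> is_derive x 1 phi (psi x).
Proof.
move=> h /andP[x0 xT].
suff H : h^-1 *: (phi (h *: 1 + x) - phi x) @[h --> 0^'] --> psi x.
  by split; [apply/cvg_ex; exists (psi x)|exact: cvg_lim H].
apply/cvgrPdist_le => e e0; rewrite /dnbhs near_withinE; apply/nbhs_ballP.
have [|d d0 dP] := h x _ e e0; first by rewrite !ltW.
exists (Num.min d (Num.min x (T - x))) => /=.
  by rewrite !lt_min d0 x0 subr_gt0 xT.
move=> k; rewrite /ball /= sub0r normrN !lt_min => /and3P[kd kx kT] k0.
have := dP (k + x); rewrite addrK => /(_ _ kd).
have -> : 0 <= k + x <= T.
  by move: kx kT; rewrite !ltr_norml => /andP[? ?] /andP[? ?]; apply/andP; split; lra.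
move=> /(_ isT); rewrite [_ *: 1]mulr1 => h1; have -> : psi x - k^-1 *: (phi (k + x) - phi x) =
    - k^-1 * (phi (k + x) - phi x - k * psi x) by rewrite /GRing.scale /=; field.
rewrite normrM normrN normfV mulrC ler_pdivrMr ?normr_gt0//.
Qed.

Lemma mean_value_ineq T phi psi a b K : real_deriv T phi psi ->
  0 <= a <= T -> 0 <= b <= T ->
  (forall s, 0 <= s <= T -> `|s - a| <= `|b - a| -> `|psi s| <= K) ->
  `|phi b - phi a| <= K * `|b - a|.
Proof.
move=> h aT bT hK.
have main u v : 0 <= u -> u < v -> v <= T ->
    (forall s, u <= s <= v -> `|psi s| <= K) -> `|phi v - phi u| <= K * (v - u).
  move=> u0 uv vT bnd.
  have [x||c] := @MVT _ phi psi u v uv.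
  - rewrite in_itv /= => /andP[ux xv]; apply: real_deriv_interior h _.
    by rewrite (le_lt_trans u0)// (lt_le_trans xv).
  - exact: real_deriv_continuous h u0 vT.
  - rewrite in_itv /= => /andP[uc cv] ->.
    rewrite normrM [`|v - u|]gtr0_norm ?subr_gt0//.
    by rewrite ler_wpM2r ?subr_ge0 ?(ltW uv)// bnd// !ltW.
move: aT bT => /andP[a0 aT] /andP[b0 bT].
case: (ltgtP a b) => [ab|ba|->]; last by rewrite !subrr normr0 mulr0.
  rewrite (gtr0_norm (_ : 0 < b - a)) ?subr_gt0//.
  apply: main => // s /andP[as_ sb].
  apply: hK; first by rewrite (le_trans a0)// (le_trans sb).
  by rewrite !ger0_norm ?subr_ge0// ?lerB// ltW.
rewrite (distrC (phi b)) (distrC b) (gtr0_norm (_ : 0 < a - b)) ?subr_gt0//.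
apply: main => // s /andP[as_ sb].
apply: hK; first by rewrite (le_trans b0)// (le_trans sb).
by rewrite (distrC s) (distrC b) !ger0_norm ?subr_ge0// ?lerB// ltW.
Qed.

Lemma continuous_bounded T phi : 0 <= T -> {within `[0, T], continuous phi} ->
  exists2 K, 0 < K & forall t, 0 <= t <= T -> `|phi t| <= K.
Proof.
move=> T0 cphi.
have [c _ hc] := EVT_max T0 cphi.
have [c' _ hc'] := EVT_min T0 cphi.
exists (`|phi c| + `|phi c'| + 1) => [|t tT].
  by rewrite ltr_wpDl// addr_ge0.
have /hc h1 : t \in `[0, T] by rewrite in_itv.
have /hc' h2 : t \in `[0, T] by rewrite in_itv.
have := ler_norm (phi c); have := lerNnormlW (lexx `|phi c'|).
have := normr_ge0 (phi c); have := normr_ge0 (phi c').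
by rewrite ler_norml => *; apply/andP; split; lra.
Qed.

Lemma continuous_pos_lower_bound T phi : 0 <= T ->
  {within `[0, T], continuous phi} -> (forall t, 0 <= t <= T -> 0 < phi t) ->
  exists2 a, 0 < a & forall t, 0 <= t <= T -> a <= phi t.
Proof.
move=> T0 cphi pos; have [c cT hc] := EVT_min T0 cphi.
exists (phi c); first by apply: pos; rewrite in_itv in cT.
by move=> t tT; apply: hc; rewrite in_itv.
Qed.

End RealTime.

Section VectorTime.
Variables (R : realType) (V : lmodType R) (S : V -> Prop) (ip : V -> V -> R).
Hypothesis H : pre_hilbert S ip.
Variable T : R.
Implicit Types F G J : R -> V.
Local Notation nm := (pnorm ip).

Record vec_deriv F G : Prop := VecDeriv {
  vdF : forall t, 0 <= t <= T -> S (F t);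
  vdG : forall t, 0 <= t <= T -> S (G t);
  vdP : forall t, 0 <= t <= T -> forall e, 0 < e -> exists2 d, 0 < d &
    forall s, 0 <= s <= T -> `|s - t| < d ->
      nm (F s - F t - (s - t) *: G t) <= e * `|s - t| }.

Definition vec_lipschitz M F := forall s t, 0 <= s <= T -> 0 <= t <= T ->
  nm (F s - F t) <= M * `|s - t|.

Lemma vec_deriv_ip F G g : vec_deriv F G -> S g ->
  real_deriv T (fun t => ip (F t) g) (fun t => ip (G t) g).
Proof.
move=> [SF SG hFG] Sg t tT e e0.
have g0 : 0 < nm g + 1 by rewrite ltr_wpDl ?pnorm_ge0.
have [d d0 dP] := hFG t tT (e / (nm g + 1)) (divr_gt0 e0 g0).
exists d => // s sT std.
have S1 := SF s sT; have S2 := SF t tT; have S3 := SG t tT.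
have S4 := phZ H (s - t) S3; have S5 := phB H S1 S2.
have -> : ip (F s) g - ip (F t) g - (s - t) * ip (G t) g =
    ip (F s - F t - (s - t) *: G t) g by rewrite !(phBl H)// (phZl H).
apply: le_trans (cauchy_schwarz H (phB H S5 S4) Sg) _.
apply: le_trans (ler_wpM2r (pnorm_ge0 _ _) (dP s sT std)) _.
rewrite mulrAC ler_wpM2r// -[leRHS]mulr1 -mulrA ler_wpM2l ?(ltW e0)//.
by rewrite mulrC ler_pdivrMr// mul1r lerDl.
Qed.

(** The real mean value inequality for the scalar product of [F] with the fixed
   vector [F b - F a]. *)
Lemma vec_mean_value F G a b K : vec_deriv F G ->
  0 <= a <= T -> 0 <= b <= T ->
  (forall s, 0 <= s <= T -> `|s - a| <= `|b - a| -> nm (G s) <= K) ->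
  nm (F b - F a) <= K * `|b - a|.
Proof.
move=> FG aT bT hK.
have [SF SG _] := FG.
have Sba := phB H (SF b bT) (SF a aT).
have K0 : 0 <= K.
  by apply: le_trans (hK a aT _); [exact: pnorm_ge0|rewrite subrr normr0].
have [->|n0] := eqVneq (nm (F b - F a)) 0; first by rewrite mulr_ge0.
have np : 0 < nm (F b - F a) by rewrite lt_def n0 pnorm_ge0.
rewrite -(ler_pM2r np) -expr2 (pnorm_sq H)// (phBl H (SF b bT) (SF a aT))//.
rewrite (le_trans (ler_norm _))// mulrAC.
apply: (mean_value_ineq (vec_deriv_ip FG Sba)) => // s sT sa.
rewrite (le_trans (cauchy_schwarz H (SG s sT) Sba))//.
by rewrite ler_wpM2r ?pnorm_ge0// hK.
Qed.

Lemma vec_derivB F G F' G' : vec_deriv F G -> vec_deriv F' G' ->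
  vec_deriv (fun t => F t - F' t) (fun t => G t - G' t).
Proof.
move=> [SF SG h] [SF' SG' h']; split=> [t tT|t tT|t tT e e0].
- by apply: (phB H); [exact: SF|exact: SF'].
- by apply: (phB H); [exact: SG|exact: SG'].
have e20 : 0 < e / 2 by rewrite divr_gt0.
have [d d0 dP] := h t tT _ e20; have [d' d'0 d'P] := h' t tT _ e20.
exists (Num.min d d'); first by rewrite lt_min d0.
move=> s sT; rewrite lt_min => /andP[sd sd'].
rewrite (_ : F s - F' s - (F t - F' t) - (s - t) *: (G t - G' t) =
  (F s - F t - (s - t) *: G t) - (F' s - F' t - (s - t) *: G' t)); last first.
  by rewrite scalerBr !opprD !opprK !addrA [LHS](ACl (1*3*5*2*4*6))%AC.
rewrite (le_trans (pnormB H _ _))//.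
- by do 2?apply: (phB H); [exact: SF|exact: SF|apply: (phZ H); exact: SG].
- by do 2?apply: (phB H); [exact: SF'|exact: SF'|apply: (phZ H); exact: SG'].
by rewrite [e in leRHS]splitr mulrDl lerD ?dP ?d'P.
Qed.

Lemma vec_derivZ phi psi v : real_deriv T phi psi -> S v ->
  vec_deriv (fun t => phi t *: v) (fun t => psi t *: v).
Proof.
move=> h Sv; split=> [t tT|t tT|t tT e e0]; try exact: (phZ H).
have v0 : 0 < nm v + 1 by rewrite ltr_wpDl ?pnorm_ge0.
have [d d0 dP] := h t tT (e / (nm v + 1)) (divr_gt0 e0 v0).
exists d => // s sT std; rewrite scalerA -!scalerBl (pnormZ H)//.
apply: le_trans (ler_wpM2r (pnorm_ge0 _ _) (dP s sT std)) _.
rewrite mulrAC ler_wpM2r// -[leRHS]mulr1 -mulrA ler_wpM2l ?(ltW e0)//.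
by rewrite mulrC ler_pdivrMr// mul1r lerDl.
Qed.

Lemma shifted_pow_deriv t (n : nat) :
  real_deriv T (fun r => (r - t) ^+ n.+1) (fun r => n.+1%:R * (r - t) ^+ n).
Proof.
apply: is_derive_real_deriv => r _.
have h : is_derive r 1 (fun x : R => x - t) 1.
  have := @is_deriveB R R R id (cst t) r 1 1 0 _ _.
  by rewrite subr0; apply.
have := @is_deriveX R R (fun x : R => x - t) n.+1 r 1 1 h.
rewrite (_ : _ ^+ n.+1 = fun x => (x - t) ^+ n.+1).
  by rewrite /GRing.scale /= mulr1.
by apply/funext => x; rewrite exprfctE.
Qed.

Lemma vec_deriv_ext F F' G G' : F =1 F' -> G =1 G' ->
  vec_deriv F G -> vec_deriv F' G'.
Proof. by move=> /funext -> /funext ->. Qed.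

(** The mean value inequality for [F - P] raises the order of contact by one;
   [P] will be a Taylor polynomial of [F] at [t]. *)
Lemma taylor_step F G P Q M n t s : vec_deriv F G -> vec_deriv P Q ->
  0 <= M -> 0 <= s <= T -> 0 <= t <= T ->
  (forall r, 0 <= r <= T -> nm (G r - Q r) <= M * `|r - t| ^+ n) ->
  nm (F s - F t - (P s - P t)) <= M * `|s - t| ^+ n.+1.
Proof.
move=> FG PQ M0 sT tT h.
have := vec_mean_value (K := M * `|s - t| ^+ n) (vec_derivB FG PQ) tT sT.
rewrite (_ : _ - _ - _ = F s - F t - (P s - P t)); last first.
  by rewrite !opprD !opprK !addrA [LHS](ACl (1*3*2*4))%AC.
rewrite exprSr mulrA; apply=> r rT rs.
rewrite (le_trans (h r rT))// ler_wpM2l// lerXn2r// ?nnegrE//.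
Qed.

Lemma vec_derivN F G : vec_deriv F G -> vec_deriv (fun t => - F t) (fun t => - G t).
Proof.
move=> [SF SG h]; split=> [t tT|t tT|t tT e e0]; try by apply: (phN H); auto.
have [d d0 dP] := h t tT e e0; exists d => // s sT std.
have := dP s sT std; rewrite -(pnormN H).
  by rewrite scalerN !opprD !opprK.
by do 2?apply: (phB H); [exact: SF|exact: SF|apply: (phZ H); exact: SG].
Qed.

Lemma vec_derivD F G F' G' : vec_deriv F G -> vec_deriv F' G' ->
  vec_deriv (fun t => F t + F' t) (fun t => G t + G' t).
Proof.
move=> h h'; have := vec_derivB h (vec_derivN h').
by apply: vec_deriv_ext => t /=; rewrite opprK.
Qed.

Lemma taylor1 M F G : 0 <= M -> vec_deriv F G -> vec_lipschitz M G ->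
  forall s t, 0 <= s <= T -> 0 <= t <= T ->
  nm (F s - F t - (s - t) *: G t) <= M * `|s - t| ^+ 2.
Proof.
move=> M0 FG lipG s t sT tT.
have SG := vdG FG tT.
have P1 := vec_derivZ (shifted_pow_deriv t 0) SG.
have := taylor_step (n := 1) FG P1 M0 sT tT.
rewrite /= !expr1 subrr scale0r subr0; apply=> r rT.
by rewrite expr0 mulr1 scale1r expr1; exact: lipG.
Qed.

Lemma taylor2 M F G J : 0 <= M -> vec_deriv F G -> vec_deriv G J ->
  vec_lipschitz M J ->
  forall s t, 0 <= s <= T -> 0 <= t <= T ->
  nm (F s - F t - ((s - t) *: G t + ((s - t) ^+ 2 / 2) *: J t))
    <= M * `|s - t| ^+ 3.
Proof.
move=> M0 FG GJ lipJ s t sT tT.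
have SG := vdG FG tT; have SJ := vdG GJ tT.
have P := vec_derivD (vec_derivZ (shifted_pow_deriv t 0) SG)
  (vec_derivZ (shifted_pow_deriv t 1) (phZ H 2^-1 SJ)).
have := taylor_step (n := 2) FG P M0 sT tT.
rewrite /= !expr1 subrr !expr0n /= !scale0r addr0 subr0 scalerA; apply=> r rT.
rewrite expr0 mulr1 expr1 scale1r scalerA mulrAC mulfV// mul1r.
by rewrite opprD addrA; exact: taylor1.
Qed.

Lemma taylor3 M F G J N : 0 <= M -> vec_deriv F G -> vec_deriv G J ->
  vec_deriv J N -> vec_lipschitz M N ->
  forall s t, 0 <= s <= T -> 0 <= t <= T ->
  nm (F s - F t - ((s - t) *: G t + ((s - t) ^+ 2 / 2) *: J t +
      ((s - t) ^+ 3 / 6) *: N t)) <= M * `|s - t| ^+ 4.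
Proof.
move=> M0 FG GJ JN lipN s t sT tT.
have SG := vdG FG tT; have SJ := vdG GJ tT; have SN := vdG JN tT.
have P := vec_derivD (vec_derivD (vec_derivZ (shifted_pow_deriv t 0) SG)
  (vec_derivZ (shifted_pow_deriv t 1) (phZ H 2^-1 SJ)))
  (vec_derivZ (shifted_pow_deriv t 2) (phZ H 6^-1 SN)).
have := taylor_step (n := 3) FG P M0 sT tT.
rewrite /= !expr1 subrr !expr0n /= !scale0r !addr0 subr0 !scalerA; apply=> r rT.
rewrite expr0 mulr1 expr1 scale1r !scalerA [2%:R * _ / _]mulrAC mulfV// mul1r.
rewrite (_ : 3%:R * _ / _ = (r - t) ^+ 2 / 2); last by field.
rewrite -[X in X - _]/(G r) -addrA opprD addrA; exact: taylor2.
Qed.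

(** The odd Taylor terms cancel in a symmetric second difference. *)
Lemma second_diff1 M F G : 0 <= M -> vec_deriv F G -> vec_lipschitz M G ->
  forall t h, 0 <= t <= T -> 0 <= t + h <= T -> 0 <= t - h <= T ->
  nm (F (t + h) + F (t - h) - 2 *: F t) <= 2 * M * h ^+ 2.
Proof.
move=> M0 FG lipG t h tT tpT tmT; have [SF SG _] := FG.
have := taylor1 M0 FG lipG tpT tT; have := taylor1 M0 FG lipG tmT tT.
rewrite (addrC t h) (addrC t (- h)) !addrK normrN -!normrX (ger0_norm (sqr_ge0 h)).
rewrite (addrC h t) (addrC (- h) t).
set A := F (t - h) - _ - _; set B := F (t + h) - _ - _ => hA hB.
have SA : S A by do 2?apply: (phB H); [exact: SF|exact: SF|apply: (phZ H); exact: SG].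
have SB : S B by do 2?apply: (phB H); [exact: SF|exact: SF|apply: (phZ H); exact: SG].
have -> : F (t + h) + F (t - h) - 2 *: F t = A + B.
  rewrite /A /B scaleNr opprK scaler_nat mulr2n opprD !addrA.
  by rewrite [RHS](ACl (4*1*2*5*3*6))%AC /= addrK.
apply: le_trans (pnormD H SA SB) _; lra.
Qed.

Lemma second_diff3 M F G J N : 0 <= M -> vec_deriv F G -> vec_deriv G J ->
  vec_deriv J N -> vec_lipschitz M N ->
  forall t h, 0 <= t <= T -> 0 <= t + h <= T -> 0 <= t - h <= T ->
  nm (F (t + h) + F (t - h) - 2 *: F t - h ^+ 2 *: J t) <= 2 * M * h ^+ 4.
Proof.
move=> M0 FG GJ JN lipN t h tT tpT tmT; have [SF SG _] := FG.
have SJ := vdG GJ tT; have SN := vdG JN tT.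
have := taylor3 M0 FG GJ JN lipN tpT tT; have := taylor3 M0 FG GJ JN lipN tmT tT.
have h4 : `|h ^+ 4| = h ^+ 4 by rewrite ger0_norm// (exprM h 2 2) sqr_ge0.
rewrite (addrC t h) (addrC t (- h)) !addrK normrN -!normrX h4.
rewrite (addrC h t) (addrC (- h) t).
set A := F (t - h) - _ - _; set B := F (t + h) - _ - _ => hA hB.
have SA : S A.
  do 2?apply: (phB H); [exact: SF|exact: SF|].
  by do 2?apply: (phD H); apply: (phZ H) => //; exact: SG.
have SB : S B.
  do 2?apply: (phB H); [exact: SF|exact: SF|].
  by do 2?apply: (phD H); apply: (phZ H) => //; exact: SG.
have -> : F (t + h) + F (t - h) - 2 *: F t - h ^+ 2 *: J t = A + B.
  rewrite /A /B (_ : (- h) ^+ 3 / 6 = - (h ^+ 3 / 6)); last by field.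
  rewrite sqrrN !scaleNr !opprD !opprK.
  have -> : h ^+ 2 *: J t = (h ^+ 2 / 2) *: J t + (h ^+ 2 / 2) *: J t.
    by rewrite -scalerDl; congr (_ *: _); field.
  rewrite scaler_nat mulr2n !opprD !addrA.
  by rewrite [RHS](ACl (6*1*2*7*4*9*3*8*5*10))%AC /= !addrK.
apply: le_trans (pnormD H SA SB) _; lra.
Qed.

Lemma vec_deriv_lipschitz M F G : vec_deriv F G ->
  (forall t, 0 <= t <= T -> nm (G t) <= M) -> vec_lipschitz M F.
Proof.
by move=> FG h s t sT tT; apply: vec_mean_value FG tT sT _ => r rT _; exact: h.
Qed.

Lemma lipschitz_bounded M F : 0 <= T -> 0 <= M ->
  (forall t, 0 <= t <= T -> S (F t)) -> vec_lipschitz M F ->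
  forall t, 0 <= t <= T -> nm (F t) <= nm (F 0) + M * T.
Proof.
move=> T0 M0 SF lipF t tT; have zT : 0 <= (0 : R) <= T by apply/andP; split.
have := pnorm_dist H (SF t tT) (SF 0 zT) => /(le_trans (ler_norm _)).
have := lipF t 0 tT zT; rewrite subr0 ger0_norm; last by case/andP: tT.
have : M * t <= M * T by rewrite ler_wpM2l//; case/andP: tT.
lra.
Qed.

End VectorTime.

(** * Boxes, open sets and square integrable functions *)
Section Geometry.
Variable R : realType.
Local Notation plane := (R * R)%type.
Local Notation mT := (measurableTypeR R * measurableTypeR R)%type.
Local Notation mu := (@lebesgue2 R).
Implicit Types (O : set plane) (f g : plane -> R).

Definition box (a b c d : R) : set plane :=
  `]a, b[%classic `*` `]c, d[%classic.
Definition cbox (a b c d : R) : set plane :=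
  `[a, b]%classic `*` `[c, d]%classic.

Lemma measurable_box a b c d : measurable (box a b c d : set mT).
Proof. by apply: measurableX; exact: measurable_itv. Qed.

Lemma measurable_cbox a b c d : measurable (cbox a b c d : set mT).
Proof. by apply: measurableX; exact: measurable_itv. Qed.

Lemma box_cbox a b c d : box a b c d `<=` cbox a b c d.
Proof.
move=> [x y] [/= /andP[? ?] /andP[? ?]]; split; rewrite /= in_itv /=;
  by apply/andP; split; exact: ltW.
Qed.

Lemma cbox_compact a b c d : compact (cbox a b c d).
Proof. by apply: compact_setX; exact: segment_compact. Qed.

Lemma mu_cbox a b c d : a <= b -> c <= d -> mu (cbox a b c d) = ((b - a) * (d - c))%:E.
Proof.
move=> ab cd.
transitivity (@lebesgue_measure R `[a, b] * @lebesgue_measure R `[c, d])%E.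
  by apply: product_measure1E; exact: measurable_itv.
rewrite !lebesgue_measure_itv /= !lte_fin.
move: ab cd; rewrite !le_eqVlt => /predU1P[->|->] /predU1P[->|->];
  by rewrite ?ltxx ?subrr ?mul0r ?mulr0 ?mule0 ?mul0e.
Qed.

Definition rat_box (q : rat * rat * (rat * rat)) :=
  box (ratr q.1.1) (ratr q.1.2) (ratr q.2.1) (ratr q.2.2).
Definition rat_cbox (q : rat * rat * (rat * rat)) :=
  cbox (ratr q.1.1) (ratr q.1.2) (ratr q.2.1) (ratr q.2.2).
(** Enumerates the vertices of all rational boxes; the default value makes some boxes
   appear several times. *)
Definition nth_quad (n : nat) : rat * rat * (rat * rat) :=
  odflt (0, 0, (0, 0)) (unpickle n).

Lemma open_rat_box O : open O -> forall p, O p ->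
  exists n, rat_box (nth_quad n) p /\ rat_cbox (nth_quad n) `<=` O.
Proof.
move=> oO [x y] Op.
have /nbhs_ballP[e /= e0 eO] : nbhs (x, y) O by exact: open_nbhs_nbhs.
have lt1 z : z - e < z by rewrite ltrBlDr ltrDl.
have lt2 z : z < z + e by rewrite ltrDl.
have [a] := rat_in_itvoo (lt1 x); rewrite in_itv /= => /andP[a1 a2].
have [b] := rat_in_itvoo (lt2 x); rewrite in_itv /= => /andP[b1 b2].
have [c] := rat_in_itvoo (lt1 y); rewrite in_itv /= => /andP[c1 c2].
have [d] := rat_in_itvoo (lt2 y); rewrite in_itv /= => /andP[d1 d2].
exists (pickle (a, b, (c, d))); rewrite /nth_quad pickleK /=; split.
  by split; rewrite /= in_itv /=; apply/andP.
move=> [u v] [/=]; rewrite !in_itv /= => /andP[u1 u2] /andP[v1 v2].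
apply: eO; split => /=; rewrite /ball /= ltr_norml; apply/andP; split; lra.
Qed.

Lemma open_measurable2 O : open O -> measurable (O : set mT).
Proof.
move=> oO.
have -> : O = \bigcup_n (if `[< rat_cbox (nth_quad n) `<=` O >]
                         then rat_box (nth_quad n) else set0).
  apply/seteqP; split => p.
    move=> /(open_rat_box oO)[n [np nO]]; exists n => //.
    by case: asboolP.
  move=> [n _]; case: asboolP => // nO np; apply: nO; exact: box_cbox.
apply: (@bigcup_measurable _ mT) => n _; case: ifPn => _ //.
exact: measurable_box.
Qed.

Lemma open_continuous_measurable2 O f : open O ->
  (forall p, O p -> {for p, continuous f}) ->
  measurable_fun (O : set mT) (f : mT -> R).
Proof.
move=> oO cf; have mO := open_measurable2 oO.
apply: (measurability _ (RGenOpens.measurableE R)).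
move=> _ [_ [a [b ->] <-]]; apply: open_measurable2.
rewrite openE => p [Op fp] /=; rewrite /interior.
apply: filterI; first exact: open_nbhs_nbhs.
by apply: cf => //; apply: open_nbhs_nbhs; split => //; exact: interval_open.
Qed.

(** The three lemmas below are the filter rules for almost everywhere statements,
   specialized because the plane carries its product measurable structure only
   through the types [measurableTypeR]. *)
Lemma ae2W (P : plane -> Prop) : (forall p, P p) -> {ae mu, forall p, P p}.
Proof. by move=> h; apply: (@aeW _ mT). Qed.

Lemma ae2S (P Q : plane -> Prop) : (forall p, P p -> Q p) ->
  {ae mu, forall p, P p} -> {ae mu, forall p, Q p}.
Proof. exact: (@filterS _ _ (@ae_filter_ringOfSetsType _ mT R mu)). Qed.

Lemma ae2S2 (P Q Q' : plane -> Prop) : (forall p, P p -> Q p -> Q' p) ->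
  {ae mu, forall p, P p} -> {ae mu, forall p, Q p} -> {ae mu, forall p, Q' p}.
Proof. exact: (@filterS2 _ _ (@ae_filter_ringOfSetsType _ mT R mu)). Qed.

(** A countable union of rational boxes covers an open set, so a property that
   holds almost everywhere in each box holds almost everywhere in the set. *)
Lemma open_ae (O : set plane) (P : plane -> Prop) : open O ->
  (forall n, rat_cbox (nth_quad n) `<=` O ->
     {ae mu, forall p, rat_box (nth_quad n) p -> P p}) ->
  {ae mu, forall p, O p -> P p}.
Proof.
move=> oO h.
suff : {ae mu, forall p, forall n, rat_cbox (nth_quad n) `<=` O ->
    rat_box (nth_quad n) p -> P p}.
  by apply: ae2S => p hp /(open_rat_box oO)[n [np nO]]; exact: hp nO np.
apply: (@ae_foralln _ mT) => n; case: (pselect (rat_cbox (nth_quad n) `<=` O)) => nO.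
  by have := h n nO; apply: ae2S.
by apply: ae2W.
Qed.

Variable Om : set plane.
Hypotheses (oOm : open Om) (bOm : bounded_set Om).
Let mOm := open_measurable2 oOm.

Lemma bounded_subset_cbox (A : set plane) : bounded_set A ->
  exists2 M, 0 < M & A `<=` cbox (- M) M (- M) M.
Proof.
move=> [M [_ hM]]; exists (`|M| + 1); first by rewrite ltr_wpDl.
have M1 : M < `|M| + 1 by rewrite (le_lt_trans (ler_norm M)) ?ltrDl.
move=> [x y] /(hM _ M1) /=.
rewrite prod_normE /= ge_max => /andP[hx hy].
by split; rewrite /= in_itv /= -ler_norml.
Qed.

Lemma bounded_mu_lty : (mu Om < +oo)%E.
Proof.
have [M M0 sub] := bounded_subset_cbox bOm.
apply: (@le_lt_trans _ _ (mu (cbox (- M) M (- M) M))).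
  apply: le_measure => //; rewrite inE; [exact: mOm|exact: measurable_cbox].
by rewrite mu_cbox ?ltry//; lra.
Qed.

Lemma L2_measurable f : L2 Om f -> measurable_fun (Om : set mT) (f : mT -> R).
Proof.
case/andP => + _; rewrite inE /= => h.
by apply/(measurable_restrictT _ _).2.
Qed.

Lemma L2_intro f : measurable_fun (Om : set mT) (f : mT -> R) ->
  mu.-integrable (Om : set mT) (EFin \o (fun p => f p * f p)) -> L2 Om f.
Proof.
move=> mf ff.
have mfO : measurable_fun [set: mT] (f \_ Om : mT -> R).
  by apply/(measurable_restrictT _ _).1.
rewrite /L2 inE; apply/andP; split; rewrite inE //=.
rewrite /finite_norm unlock poweR_lty//.
rewrite (_ : integral _ _ _ = \int[mu]_(p in Om) (f p * f p)%:E)%E.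
  exact: (@integrable_lty _ mT _ mu _ _ _ ff).
rewrite [RHS]integral_mkcond; apply: eq_integral => p _.
rewrite /patch /=; case: ifPn => _; last by rewrite normr0 powR0.
by rewrite powR_mulrn// real_normK ?num_real// expr2.
Qed.

Lemma L2_le f g (M : R) : measurable_fun (Om : set mT) (f : mT -> R) -> L2 Om g ->
  (forall p, Om p -> `|f p| <= M * `|g p|) -> L2 Om f.
Proof.
move=> mf Lg fg; apply: L2_intro => //.
have ig := L2_integrableM mOm Lg Lg.
have := @integrableZl _ mT _ mu _ mOm (M ^+ 2) _ ig.
apply: le_integrable => //.
  by apply/measurable_EFinP; exact: measurable_funM.
move=> p Op /=; rewrite lee_fin; apply: le_trans (ler_norm _).
have -> : M ^+ 2 * (g p * g p) = (M * `|g p|) * (M * `|g p|).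
  by rewrite [RHS]mulrACA -!expr2 real_normK ?num_real.
by rewrite normrM; apply: ler_pM => //; exact: fg.
Qed.

Lemma L2_cst (c : R) : L2 Om (cst c).
Proof.
apply: L2_intro; first exact: measurable_cst.
apply: (@measurable_bounded_integrable _ mT _ mu (fun=> c * c)) => //.
- exact: bounded_mu_lty.
by exists (`|c * c|); split; [exact: num_real|move=> b cb p _; exact: ltW].
Qed.

Lemma L2_bounded f M : measurable_fun (Om : set mT) (f : mT -> R) ->
  (forall p, Om p -> `|f p| <= M) -> L2 Om f.
Proof.
move=> mf fM; apply: (L2_le (M := M) mf (L2_cst 1)) => p /fM.
by rewrite /= normr1 mulr1.
Qed.

End Geometry.

(** * Integrals of derivatives of compactly supported functions *)
Section DerivativeOfIsDerive.
Variables (R : realType) (V W : normedModType R) (f : V -> W) (p v : V) (l : W).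

Lemma is_deriveE : is_derive p v f l -> 'D_v f p = l.
Proof. by case. Qed.

Lemma is_derive_ex : is_derive p v f l -> derivable f p v.
Proof. by case. Qed.

End DerivativeOfIsDerive.

Section DirectionalDerivative.
Variable R : realType.
Local Notation plane := (R * R)%type.
Implicit Types (f g : plane -> R) (p v : plane).

Lemma is_derive_line f p v l :
  is_derive p v f l <-> is_derive (0 : R) 1 (fun h : R => f (h *: v + p)) l.
Proof.
have E : (fun h : R => h^-1 *: ((f \o shift p) (h *: v) - f p)) =
  (fun h : R => h^-1 *: (((fun h => f (h *: v + p)) \o shift 0) (h *: 1) -
     f (0 *: v + p))).
  by apply/funext => h; rewrite /= scale0r add0r addr0 [h *: 1]mulr1.
by split=> -[d1 d2]; split; rewrite /derivable /derive; [rewrite -E|rewrite -E|rewrite E|rewrite E].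
Qed.

Lemma is_derive_outer (eta : R -> R) f p v e l :
  is_derive (f p) 1 eta e -> is_derive p v f l ->
  is_derive p v (eta \o f) (e * l).
Proof.
move=> deta /is_derive_line df; apply/is_derive_line.
have := @is_derive1_comp R eta (fun h => f (h *: v + p)) 0 e l.
by rewrite scale0r add0r; apply.
Qed.

(** A directional derivative along an axis is a one-variable derivative, which
   gives access to the fundamental theorem of calculus on lines. *)
Lemma is_derive_slice1 f (x y l : R) :
  is_derive (x, y) ((1, 0) : plane) f l <-> is_derive x 1 (fun s => f (s, y)) l.
Proof.
have E : (fun h : R => h^-1 *: ((f \o shift (x, y)) (h *: ((1, 0) : plane)) - f (x, y))) =
  (fun h : R => h^-1 *: (((fun s => f (s, y)) \o shift x) (h *: 1) - f (x, y))).
  apply/funext => h; congr (_ *: (f _ - _)) => /=.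
  by congr (_, _); rewrite /= [h *: 0]mulr0 add0r.
by split=> -[d1 d2]; split; rewrite /derivable /derive; [rewrite -E|rewrite -E|rewrite E|rewrite E].
Qed.

Lemma is_derive_slice2 f (x y l : R) :
  is_derive (x, y) ((0, 1) : plane) f l <-> is_derive y 1 (fun s => f (x, s)) l.
Proof.
have E : (fun h : R => h^-1 *: ((f \o shift (x, y)) (h *: ((0, 1) : plane)) - f (x, y))) =
  (fun h : R => h^-1 *: (((fun s => f (x, s)) \o shift y) (h *: 1) - f (x, y))).
  apply/funext => h; congr (_ *: (f _ - _)) => /=.
  by congr (_, _); rewrite /= [h *: 0]mulr0 add0r.
by split=> -[d1 d2]; split; rewrite /derivable /derive; [rewrite -E|rewrite -E|rewrite E|rewrite E].
Qed.

Lemma derivable_is_derive f p v : derivable f p v -> is_derive p v f ('D_v f p).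
Proof. by move=> h; split. Qed.

End DirectionalDerivative.

Section VanishingIntegral.
Variable R : realType.
Local Notation plane := (R * R)%type.
Local Notation mT := (measurableTypeR R * measurableTypeR R)%type.
Local Notation mu := (@lebesgue2 R).
Local Notation leb := (@lebesgue_measure R).

Lemma compact_support_bounded (K : set plane) (g : plane -> R) :
  compact K -> continuous g -> (forall p, ~ K p -> g p = 0) ->
  exists M, forall p, `|g p| <= M.
Proof.
move=> cK cg g0.
have /compact_bounded[M [_ hM]] : compact (g @` K).
  by apply: continuous_compact => //; exact: continuous_subspaceT.
exists (`|M| + 1) => p; case: (pselect (K p)) => [Kp|nKp].
  apply: (hM (`|M| + 1)); last by exists p.
  by rewrite (le_lt_trans (ler_norm M)) ?ltrDl.
by rewrite g0// normr0 addr_ge0.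
Qed.

Lemma compact_support_integrable (M : R) (g : plane -> R) : 0 < M ->
  continuous g -> (forall p, ~ cbox (- M) M (- M) M p -> g p = 0) ->
  mu.-integrable [set: mT] (EFin \o g).
Proof.
move=> M0 cg g0.
have mg : measurable_fun [set: mT] (g : mT -> R).
  by apply: (open_continuous_measurable2 openT) => p _; exact: cg.
set K := cbox (- M) M (- M) M.
have mK : measurable (K : set mT) := measurable_cbox _ _ _ _.
have [B hB] := compact_support_bounded (@cbox_compact R (- M) M (- M) M) cg g0.
have iK : mu.-integrable (K : set mT) (EFin \o g).
  apply: measurable_bounded_integrable => //.
  - by rewrite mu_cbox ?ltry//; lra.
  - exact: measurable_funS mg.
  - by exists B; split; [exact: num_real|move=> b Bb p _; exact: le_trans (hB p) (ltW Bb)].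
have /integrable_mkcond := iK => /(_ mK).
congr (integrable _ _ _); apply/funext => p; rewrite /patch /=.
by case: ifPn => // /negP; rewrite inE => /g0 ->.
Qed.

Lemma integral_derive_compact (M : R) (F f : R -> R) : 0 < M ->
  (forall s : R, is_derive s (1 : R) F (f s)) -> continuous f ->
  (forall s, s \notin `[- M, M] -> F s = 0 /\ f s = 0) ->
  (\int[leb]_s (f s)%:E = 0)%E.
Proof.
move=> M0 dF cf out; pose N := M + 1; have NN : - N < N by rewrite /N; lra.
have F0 : F (- N) = 0.
  by have [|-> //] := out (- N); rewrite in_itv /= /N; apply/negP => /andP[? ?]; lra.
have F1 : F N = 0.
  by have [|-> //] := out N; rewrite in_itv /= /N; apply/negP => /andP[? ?]; lra.
have f0 s : s \notin `[- N, N] -> f s = 0.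
  move=> /negP h; have [|_ -> //] := out s.
  apply/negP => h'; apply: h; move: h'; rewrite !in_itv /= /N => /andP[? ?].
  by apply/andP; split; lra.
have cF : continuous F.
  move=> s; apply: differentiable_continuous; apply/derivable1_diffP.
  exact: (is_derive_ex (dF s)).
pose I : set R := `[- N, N]%classic.
transitivity (\int[leb]_(s in I) (f s)%:E)%E.
  rewrite [RHS]integral_mkcond; apply: eq_integral => s _; rewrite /patch.
  case: ifPn => // /negP sN; rewrite f0//; apply/negP => h; apply: sN.
  by rewrite inE.
rewrite (continuous_FTC2 NN (F := F)).
- by rewrite F0 F1 subee.
- exact: continuous_subspaceT.
- split=> [s _||].
  + exact: (is_derive_ex (dF s)).
  + by apply: cvg_at_right_filter; exact: cF.
  + by apply: cvg_at_left_filter; exact: cF.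
- by move=> s _; rewrite derive1E (is_deriveE (dF s)).
Qed.

Lemma notin_support (M s t : R) : s \notin `[- M, M] ->
  ~ cbox (- M) M (- M) M (s, t) /\ ~ cbox (- M) M (- M) M (t, s).
Proof. by move=> /negP sM; split=> -[/= h1 h2]; apply: sM. Qed.

Lemma continuous_slice1 (y : R) : continuous (fun s : R => (s, y) : plane).
Proof.
move=> s A /nbhs_ballP[e e0 eA]; apply/nbhs_ballP; exists e => // t st.
by apply: eA; split => //=; exact: ballxx.
Qed.

Lemma continuous_slice2 (x : R) : continuous (fun s : R => (x, s) : plane).
Proof.
move=> s A /nbhs_ballP[e e0 eA]; apply/nbhs_ballP; exists e => // t st.
by apply: eA; split => //=; exact: ballxx.
Qed.

(** Fubini's theorem and the fundamental theorem of calculus on each horizontal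
   line. *)
Lemma integral_dx_compact (M : R) (F f : plane -> R) : 0 < M ->
  (forall p, is_derive p ((1, 0) : plane) F (f p)) -> continuous f ->
  (forall p, ~ cbox (- M) M (- M) M p -> F p = 0 /\ f p = 0) ->
  \int[mu]_p f p = 0.
Proof.
move=> M0 dF cf F0; rewrite /Rintegral.
have fi := compact_support_integrable M0 cf (fun p h => (F0 p h).2).
rewrite -(integral21_prod_meas1 fi) /= integral0_eq// => y _.
apply: (integral_derive_compact (F := fun s => F (s, y)) M0).
- by move=> s; apply/is_derive_slice1.
- move=> s; apply: (@cvg_comp _ _ _ (fun s => (s, y)) f _ _ _ _ (cf (s, y))).
  exact: continuous_slice1.
- by move=> s sM; apply: F0; exact: (notin_support y sM).1.
Qed.

Lemma integral_dy_compact (M : R) (F f : plane -> R) : 0 < M ->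
  (forall p, is_derive p ((0, 1) : plane) F (f p)) -> continuous f ->
  (forall p, ~ cbox (- M) M (- M) M p -> F p = 0 /\ f p = 0) ->
  \int[mu]_p f p = 0.
Proof.
move=> M0 dF cf F0; rewrite /Rintegral.
have fi := compact_support_integrable M0 cf (fun p h => (F0 p h).2).
rewrite -(integral12_prod_meas1 fi) /= integral0_eq// => x _.
apply: (integral_derive_compact (F := fun s => F (x, s)) M0).
- by move=> s; apply/is_derive_slice2.
- move=> s; apply: (@cvg_comp _ _ _ (fun s => (x, s)) f _ _ _ _ (cf (x, s))).
  exact: continuous_slice2.
- by move=> s sM; apply: F0; exact: (notin_support x sM).2.
Qed.

End VanishingIntegral.

(** * Integration by parts on an open set *)
Section IntegrationByParts.
Variable R : realType.
Local Notation plane := (R * R)%type.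
Local Notation mT := (measurableTypeR R * measurableTypeR R)%type.
Local Notation mu := (@lebesgue2 R).
Implicit Types (f g h : plane -> R).

(** The regularity of a function that is C1 near each point of [A], without any
   condition at the boundary. *)
Definition C1_on (A : set plane) g : Prop := forall p, A p ->
  [/\ {for p, continuous g}, derivable g p ((1, 0) : plane) /\ derivable g p ((0, 1) : plane),
      {for p, continuous (dx g)} & {for p, continuous (dy g)}].

Variable Om : set plane.
Hypotheses (oOm : open Om) (bOm : bounded_set Om).
Let mOm := open_measurable2 oOm.

Lemma near_eq_continuous f g (p : plane) : (\forall q \near p, f q = g q) ->
  {for p, continuous f} -> {for p, continuous g}.
Proof.
move=> fg cf; rewrite /prop_for /continuous_at -(nbhs_singleton fg).
exact: cvg_trans (near_eq_cvg fg) cf.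
Qed.

Lemma C0_closure_continuous f p : C0_closure Om f -> Om p -> {for p, continuous f}.
Proof.
move=> [h ch hf] Op.
have nO : \forall q \near p, Om q by exact: open_nbhs_nbhs.
apply: (@near_eq_continuous h); first by apply: filterS nO => q; exact: hf.
have /subspace_continuousP /(_ p (subset_closure Op)) := ch.
move=> hp A /hp; rewrite /nbhs /= /within /= => hA.
by apply: filterS2 nO hA => q Oq; apply; exact: subset_closure.
Qed.

Lemma Ck1_C1_on g : Ck_closure 1 Om g -> C1_on Om g.
Proof.
move=> [c0 [dg [cx _] [cy _]]] p Op.
by split; [exact: C0_closure_continuous|exact: dg|
  exact: C0_closure_continuous|exact: C0_closure_continuous].
Qed.

Lemma C1_compact_C1_on (A : set plane) phi : C1_compact Om phi -> C1_on A phi.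
Proof. by move=> [d c cx cy _] p _; split => //; [exact: c|exact: cx|exact: cy]. Qed.

Lemma C1_on_measurable (A : set plane) g : open A -> C1_on A g ->
  [/\ measurable_fun (A : set mT) (g : mT -> R),
      measurable_fun (A : set mT) (dx g : mT -> R) &
      measurable_fun (A : set mT) (dy g : mT -> R)].
Proof.
by move=> oA cg; split; apply: open_continuous_measurable2 => // p /cg[].
Qed.

Lemma compact_complement_nbhs (K : set plane) p : compact K -> ~ K p ->
  \forall q \near p, ~ K q.
Proof.
move=> cK nK; apply: (@open_nbhs_nbhs _ p (~` K)); split => //.
apply: closed_openC; apply: compact_closed => //; exact: norm_hausdorff.
Qed.

Lemma vanish_derive f v (p : plane) : (\forall q \near p, f q = 0) ->
  is_derive p v f 0.
Proof.
move=> f0; apply: (near_eq_is_derive (f := cst 0) _ (@is_derive_cst R _ _ 0 p v)).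
by apply: filterS f0 => q ->.
Qed.

Lemma support_derive (K : set plane) f : compact K -> (forall p, ~ K p -> f p = 0) ->
  forall p, ~ K p -> dx f p = 0 /\ dy f p = 0.
Proof.
move=> cK f0 p nK.
have h : \forall q \near p, f q = 0.
  by apply: filterS (compact_complement_nbhs cK nK) => q; exact: f0.
by split; [exact: (is_deriveE (vanish_derive _ h))|
           exact: (is_deriveE (vanish_derive _ h))].
Qed.

Lemma C1_compact_L2 phi : C1_compact Om phi ->
  [/\ L2 Om phi, L2 Om (dx phi) & L2 Om (dy phi)].
Proof.
move=> cphi; have [d c cx cy [K [cK KO phi0]]] := cphi.
have [m mx my] := C1_on_measurable oOm (C1_compact_C1_on (A := Om) cphi).
have d0 := support_derive cK phi0.
have [M hM] := compact_support_bounded cK c phi0.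
have [M1 hM1] := compact_support_bounded cK cx (fun p n => (d0 p n).1).
have [M2 hM2] := compact_support_bounded cK cy (fun p n => (d0 p n).2).
by split; [apply: (L2_bounded oOm bOm m)|apply: (L2_bounded oOm bOm mx)
  |apply: (L2_bounded oOm bOm my)].
Qed.

(** The product of a C1 function on [Om] by a C1 function with compact support in
   [Om], extended by zero, is C1 on the whole plane, so the integral of its
   derivative vanishes. The direction [v] is arbitrary, to treat both partial
   derivatives at once. *)
Section Product.
Variables (g phi : plane -> R) (v : plane).
Hypotheses (cg : forall p, Om p -> {for p, continuous g})
  (dg : forall p, Om p -> derivable g p v)
  (cdg : forall p, Om p -> {for p, continuous (fun p => 'D_v g p)})
  (cphi : continuous phi) (dphi : forall p, derivable phi p v)
  (cdphi : continuous (fun p => 'D_v phi p)).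
Variable K : set plane.
Hypotheses (cK : compact K) (KO : K `<=` Om) (phi0 : forall p, ~ K p -> phi p = 0).

Let w := (fun p => g p * phi p) \_ Om.
Let dw := (fun p => g p * 'D_v phi p + 'D_v g p * phi p) \_ Om.

Let Dphi0 p : ~ K p -> 'D_v phi p = 0.
Proof.
move=> nK; apply: (is_deriveE (vanish_derive v _)).
by apply: filterS (compact_complement_nbhs cK nK) => q; exact: phi0.
Qed.

Lemma product_patch_derive p : is_derive p v w (dw p).
Proof.
case: (pselect (Om p)) => Op.
  have nO : \forall q \near p, Om q by exact: open_nbhs_nbhs.
  apply: (near_eq_is_derive (f := g * phi)).
    by apply: filterS nO => q Oq; rewrite /w /patch mem_set.
  rewrite /dw /patch mem_set//.
  have := is_deriveM (derivable_is_derive (dg Op)) (derivable_is_derive (@dphi p)).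
  by rewrite /GRing.scale /= [phi p * _]mulrC.
have nK : ~ K p by move=> /KO.
rewrite /dw /patch memNset//; apply: vanish_derive.
apply: filterS (compact_complement_nbhs cK nK) => q nKq.
by rewrite /w /patch; case: ifPn => // _; rewrite phi0// mulr0.
Qed.

Lemma product_patch_continuous : continuous dw.
Proof.
move=> p; case: (pselect (Om p)) => Op.
  have nO : \forall q \near p, Om q by exact: open_nbhs_nbhs.
  apply: (near_eq_continuous (f := fun p => g p * 'D_v phi p + 'D_v g p * phi p)).
    by apply: filterS nO => q Oq; rewrite /dw /patch mem_set.
  apply: cvgD; apply: cvgM; [exact: cg|exact: cdphi|exact: cdg|exact: cphi].
have nK : ~ K p by move=> /KO.
apply: (near_eq_continuous (f := cst 0)); last exact: cvg_cst.
apply: filterS (compact_complement_nbhs cK nK) => q nKq.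
rewrite /dw /patch; case: ifPn => // _.
by rewrite phi0// Dphi0// !mulr0 addr0.
Qed.

Lemma product_patch_support : exists2 M, 0 < M &
  forall p, ~ cbox (- M) M (- M) M p -> w p = 0 /\ dw p = 0.
Proof.
have [M M0 KM] := bounded_subset_cbox (compact_bounded cK).
exists M => // p nM; have nK : ~ K p by move=> /KM.
rewrite /w /dw /patch; case: ifPn => // _.
by rewrite phi0// Dphi0// !mulr0 addr0.
Qed.

Hypothesis vanish : forall M F f, 0 < M -> (forall p, is_derive p v F (f p)) ->
  continuous f -> (forall p, ~ cbox (- M) M (- M) M p -> F p = 0 /\ f p = 0) ->
  \int[mu]_p f p = 0.
Hypotheses (Lg : L2 Om g) (Ldg : L2 Om (fun p => 'D_v g p))
  (Lphi : L2 Om phi) (Ldphi : L2 Om (fun p => 'D_v phi p)).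

Lemma integration_by_parts :
  L2ip Om g (fun p => 'D_v phi p) = - L2ip Om (fun p => 'D_v g p) phi.
Proof.
have [M M0 hM] := product_patch_support.
have := vanish M0 product_patch_derive product_patch_continuous hM.
rewrite /dw -Rintegral_mkcond RintegralD//; try exact: L2_integrableM.
by move/eqP; rewrite addr_eq0 => /eqP.
Qed.

End Product.

Lemma C1_weak_dx g : C1_on Om g -> L2 Om g -> L2 Om (dx g) -> is_weak_dx Om g (dx g).
Proof.
move=> cg Lg Lgx; split => // phi cphi.
have [Lphi Lx Ly] := C1_compact_L2 cphi; have [d c cx cy [K [cK KO phi0]]] := cphi.
have c1 p : Om p -> {for p, continuous g} by case/cg.
have c2 p : Om p -> derivable g p ((1, 0) : plane) by case/cg => _ [].
have c3 p : Om p -> {for p, continuous (fun q => 'D_(1, 0) g q)}.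
  by move=> Op; have [_ _ h _] := cg p Op; exact: h.
have c4 p : derivable phi p ((1, 0) : plane) by case: (d p).
exact: (integration_by_parts c1 c2 c3 c c4 cx cK KO phi0
  (@integral_dx_compact R) Lg Lgx Lphi Lx).
Qed.

Lemma C1_weak_dy g : C1_on Om g -> L2 Om g -> L2 Om (dy g) -> is_weak_dy Om g (dy g).
Proof.
move=> cg Lg Lgy; split => // phi cphi.
have [Lphi Lx Ly] := C1_compact_L2 cphi; have [d c cx cy [K [cK KO phi0]]] := cphi.
have c1 p : Om p -> {for p, continuous g} by case/cg.
have c2 p : Om p -> derivable g p ((0, 1) : plane) by case/cg => _ [].
have c3 p : Om p -> {for p, continuous (fun q => 'D_(0, 1) g q)}.
  by move=> Op; have [_ _ _ h] := cg p Op; exact: h.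
have c4 p : derivable phi p ((0, 1) : plane) by case: (d p).
exact: (integration_by_parts c1 c2 c3 c c4 cy cK KO phi0
  (@integral_dy_compact R) Lg Lgy Lphi Ly).
Qed.

End IntegrationByParts.

(** * Composition, products and extension by zero of C1 functions *)
Section C1Real.
Variable R : realType.
Implicit Types (f g : R -> R).

(** Carrying the derivative [f'] along lets composite C1 functions be built from
   the closure lemmas below without computing derivatives by hand. *)
Record C1_real f f' : Prop := C1Real {
  C1_real_derive : forall s : R, is_derive s (1 : R) f (f' s);
  C1_real_cont : continuous f' }.

Lemma C1_real_continuous f f' : C1_real f f' -> continuous f.
Proof.
move=> [df _] s; apply: differentiable_continuous; apply/derivable1_diffP.
exact: (is_derive_ex (df s)).
Qed.

Arguments C1_real_continuous {f f'} _ _.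

Lemma C1_real_ext f f' g g' : f =1 g -> f' =1 g' -> C1_real f f' -> C1_real g g'.
Proof. by move=> /funext -> /funext ->. Qed.

Lemma C1_real_cst (c : R) : C1_real (fun=> c) (fun=> 0).
Proof. by split=> [s|s]; [exact: is_derive_cst|exact: cvg_cst]. Qed.

Lemma C1_real_id : C1_real (fun s => s) (fun=> 1).
Proof. by split=> [s|s]; [exact: is_derive_id|exact: cvg_cst]. Qed.

Lemma C1_realD f f' g g' : C1_real f f' -> C1_real g g' ->
  C1_real (fun s => f s + g s) (fun s => f' s + g' s).
Proof.
move=> [df cf] [dg cg]; split=> s; first exact: is_deriveD.
by apply: cvgD; [exact: cf|exact: cg].
Qed.

Lemma C1_realM f f' g g' : C1_real f f' -> C1_real g g' ->
  C1_real (fun s => f s * g s) (fun s => f s * g' s + g s * f' s).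
Proof.
move=> cf cg; have [df cf'] := cf; have [dg cg'] := cg.
split=> s; first exact: (is_deriveM (df s) (dg s)).
by apply: cvgD; apply: cvgM;
  [exact: C1_real_continuous cf s|exact: cg'|exact: C1_real_continuous cg s|exact: cf'].
Qed.

Lemma C1_realV f f' : C1_real f f' -> (forall s, f s != 0) ->
  C1_real (fun s => (f s)^-1) (fun s => - (f s) ^- 2 * f' s).
Proof.
move=> cf f0; have [df cf'] := cf; split=> s; first exact: is_deriveV.
apply: cvgM; last exact: cf'; apply: cvgN; apply: cvgV.
  by rewrite expf_neq0.
by rewrite expr2; apply: cvgM; exact: C1_real_continuous cf s.
Qed.

Lemma C1_real_comp f f' g g' : C1_real f f' -> C1_real g g' ->
  C1_real (fun s => f (g s)) (fun s => f' (g s) * g' s).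
Proof.
move=> cf cg; have [df cf'] := cf; have [dg cg'] := cg.
split=> s; first exact: is_derive1_comp.
apply: cvgM; last exact: cg'.
exact: (continuous_comp (C1_real_continuous cg s) (cf' (g s))).
Qed.

(** The building block of the bumps and of the truncations: a C1 function that
   vanishes exactly on a half line. *)
Lemma C1_real_sqpos :
  C1_real (fun s => Num.max s 0 ^+ 2) (fun s => 2 * Num.max s 0).
Proof.
split=> s; last first.
  apply: cvgM; first exact: cvg_cst.
  exact: (@continuous_max _ _ id (cst 0) s (@cvg_id _ _) (cvg_cst _)).
suff H : h^-1 *: (Num.max (h *: 1 + s) 0 ^+ 2 - Num.max s 0 ^+ 2) @[h --> 0^'] --> 2 * Num.max s 0.
  by split; [apply/cvg_ex; exists (2 * Num.max s 0)|exact: cvg_lim H].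
apply/cvgrPdist_le => e e0; rewrite /dnbhs near_withinE; apply/nbhs_ballP.
exists e => // h; rewrite /ball /= sub0r normrN => /ltW he h0.
apply: le_trans he; rewrite [h *: 1]mulr1.
have hp : 0 < `|h| by rewrite normr_gt0.
rewrite -(ler_pM2r hp) -normrM /GRing.scale /=.
have -> : (2 * Num.max s 0 - h^-1 * (Num.max (h + s) 0 ^+ 2 - Num.max s 0 ^+ 2)) * h =
  2 * Num.max s 0 * h - Num.max (h + s) 0 ^+ 2 + Num.max s 0 ^+ 2 by field.
rewrite -normrM -expr2 ger0_norm ?sqr_ge0// ler_norml.
by apply/andP; split; case: (ltP s 0) => s0; case: (ltP (h + s) 0) => hs0; nra.
Qed.

End C1Real.
Arguments C1_real_continuous {R f f'} _ _.

Section C1Plane.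
Variable R : realType.
Local Notation plane := (R * R)%type.
Implicit Types (f g u w : plane -> R).
Variable Om : set plane.
Hypotheses (oOm : open Om).

Lemma C1_on_outer (eta eta' : R -> R) u : C1_real eta eta' -> C1_on Om u ->
  C1_on Om (eta \o u) /\ forall p, Om p ->
    dx (eta \o u) p = eta' (u p) * dx u p /\ dy (eta \o u) p = eta' (u p) * dy u p.
Proof.
move=> ceta cu; have [deta ceta'] := ceta.
have D p v : Om p -> derivable u p v -> is_derive p v (eta \o u) (eta' (u p) * 'D_v u p).
  by move=> Op du; apply: is_derive_outer => //; exact: derivable_is_derive.
have E p : Om p -> dx (eta \o u) p = eta' (u p) * dx u p /\
    dy (eta \o u) p = eta' (u p) * dy u p.
  move=> Op; have [_ [d1 d2] _ _] := cu p Op.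
  by split; [exact: (is_deriveE (D p _ Op d1))|
             exact: (is_deriveE (D p _ Op d2))].
split=> // p Op; have [c [d1 d2] cx cy] := cu p Op.
have nO : \forall q \near p, Om q by exact: open_nbhs_nbhs.
have ce' : {for p, continuous (eta' \o u)}.
  exact: (continuous_comp c (ceta' (u p))).
split.
- have ce := C1_real_continuous ceta (u p); exact: (continuous_comp c ce).
- by split; [exact: (is_derive_ex (D p _ Op d1))|
             exact: (is_derive_ex (D p _ Op d2))].
- apply: (near_eq_continuous (f := fun p => eta' (u p) * dx u p)).
    by apply: filterS nO => q Oq; rewrite (E q Oq).1.
  by apply: cvgM; [exact: ce'|exact: cx].
- apply: (near_eq_continuous (f := fun p => eta' (u p) * dy u p)).
    by apply: filterS nO => q Oq; rewrite (E q Oq).2.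
  by apply: cvgM; [exact: ce'|exact: cy].
Qed.

(** Being C1 is local; stated on a single point so that a function may be compared
   with different models near different points. *)
Lemma near_eq_C1_on (A B : set plane) f g p : (\forall q \near p, f q = g q) ->
  C1_on A f -> A p -> C1_on [set p] g /\ dx g p = dx f p /\ dy g p = dy f p.
Proof.
move=> fg cf Ap; have [c [d1 d2] cx cy] := cf p Ap.
have E v : \forall q \near p, 'D_v f q = 'D_v g q.
  apply: filterS (near_join fg) => q; exact: near_eq_derive.
split; last first.
  by split; apply/esym; [exact: (nbhs_singleton (E (1, 0)))|exact: (nbhs_singleton (E (0, 1)))].
move=> _ ->; split.
- exact: near_eq_continuous c.
- by split; [exact: near_eq_derivable d1|exact: near_eq_derivable d2].
- exact: near_eq_continuous (E (1, 0)) cx.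
- exact: near_eq_continuous (E (0, 1)) cy.
Qed.

(** The support being compact in [Om], the extension by zero is C1 across the
   boundary. *)
Lemma patch_C1_compact w (K : set plane) : C1_on Om w -> compact K -> K `<=` Om ->
  (forall p, Om p -> ~ K p -> w p = 0) ->
  C1_compact Om (w \_ Om) /\ forall p, Om p ->
    [/\ (w \_ Om) p = w p, dx (w \_ Om) p = dx w p & dy (w \_ Om) p = dy w p].
Proof.
move=> cw cK KO w0.
have out p : ~ K p -> (w \_ Om) p = 0.
  by rewrite /patch => nK; case: ifPn => //; rewrite inE => Op; exact: w0.
have inn p : Om p -> \forall q \near p, w q = (w \_ Om) q.
  move=> Op; have nO : \forall q \near p, Om q by exact: open_nbhs_nbhs.
  by apply: filterS nO => q Oq; rewrite /patch mem_set.
have c0 : C1_on setT (cst 0 : plane -> R).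
  have e0 v : 'D_v (cst 0 : plane -> R) = cst 0.
    by apply/funext => q; exact: (is_deriveE (@is_derive_cst R _ _ 0 q v)).
  have ex0 : dx (cst 0 : plane -> R) = cst 0 := e0 ((1, 0) : plane).
  have ey0 : dy (cst 0 : plane -> R) = cst 0 := e0 ((0, 1) : plane).
  move=> p _; rewrite ex0 ey0.
  by split; [exact: cvg_cst|split; exact: derivable_cst|exact: cvg_cst|exact: cvg_cst].
have C p : C1_on [set p] (w \_ Om).
  case: (pselect (Om p)) => Op; first exact: (near_eq_C1_on Om (inn p Op) cw Op).1.
  have nK : ~ K p by move=> /KO.
  have h : \forall q \near p, (cst 0 : plane -> R) q = (w \_ Om) q.
    by apply: filterS (compact_complement_nbhs cK nK) => q nq; rewrite out.
  exact: (near_eq_C1_on Om h c0 _).1.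
split; last first.
  move=> p Op; have [_ [h1 h2]] := near_eq_C1_on Om (inn p Op) cw Op.
  by split => //; rewrite /patch mem_set.
split.
- by move=> p; have [_ h _ _] := C p p erefl; exact: h.
- by move=> p; have [h _ _ _] := C p p erefl; exact: h.
- by move=> p; have [_ _ h _] := C p p erefl; exact: h.
- by move=> p; have [_ _ _ h] := C p p erefl; exact: h.
- by exists K; split => // p nK; exact: out.
Qed.

Lemma C1_on_product (b1 b1' b2 b2' : R -> R) : C1_real b1 b1' -> C1_real b2 b2' ->
  C1_on setT (fun p : plane => b1 p.1 * b2 p.2).
Proof.
move=> c1 c2; have [d1 e1] := c1; have [d2 e2] := c2.
have cfst (f : R -> R) : continuous f -> continuous (fun p : plane => f p.1).
  move=> cf p; apply: (@cvg_comp _ _ _ fst f _ _ _ _ (cf p.1)); exact: cvg_fst.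
have csnd (f : R -> R) : continuous f -> continuous (fun p : plane => f p.2).
  move=> cf p; apply: (@cvg_comp _ _ _ snd f _ _ _ _ (cf p.2)); exact: cvg_snd.
have D1 (p : plane) : is_derive p ((1, 0) : plane) (fun p : plane => b1 p.1 * b2 p.2)
    (b1' p.1 * b2 p.2).
  case: p => x y; apply/is_derive_slice1 => /=.
  have := (C1_real_derive (C1_realM c1 (C1_real_cst (b2 y)))) x.
  by rewrite mulr0 add0r mulrC.
have D2 (p : plane) : is_derive p ((0, 1) : plane) (fun p : plane => b1 p.1 * b2 p.2)
    (b1 p.1 * b2' p.2).
  case: p => x y; apply/is_derive_slice2 => /=.
  have := (C1_real_derive (C1_realM (C1_real_cst (b1 x)) c2)) y.
  by rewrite mulr0 addr0.
have E1 : dx (fun p : plane => b1 p.1 * b2 p.2) = fun p => b1' p.1 * b2 p.2.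
  by apply/funext => p; exact: (is_deriveE (D1 p)).
have E2 : dy (fun p : plane => b1 p.1 * b2 p.2) = fun p => b1 p.1 * b2' p.2.
  by apply/funext => p; exact: (is_deriveE (D2 p)).
move=> p _; split.
- by apply: cvgM; [apply: cfst|apply: csnd]; exact: C1_real_continuous.
- by split; [exact: (is_derive_ex (D1 p))|
             exact: (is_derive_ex (D2 p))].
- by rewrite E1; apply: cvgM; [apply: cfst|apply: csnd; exact: C1_real_continuous c2].
- by rewrite E2; apply: cvgM; [apply: cfst; exact: C1_real_continuous c1|apply: csnd].
Qed.

End C1Plane.

(** * Dominated convergence in L2 and bump functions *)
(** Scalar products are continuous for the norm, by Cauchy-Schwarz. *)
Lemma ip_cvg_gen (R : realType) (V : lmodType R) (S : V -> Prop) (ip : V -> V -> R)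
    (H : pre_hilbert S ip) (F_ : nat -> V) (F g : V) :
  (forall j, S (F_ j)) -> S F -> S g ->
  pnorm ip (F_ j - F) @[j --> \oo] --> (0 : R) ->
  ip (F_ j) g @[j --> \oo] --> ip F g.
Proof.
move=> LF_ LF Lg c.
apply/cvgrPdist_le => e e0.
have g0 : 0 < pnorm ip g + 1 by rewrite ltr_wpDl ?pnorm_ge0.
have /cvgrPdist_le /(_ (e / (pnorm ip g + 1)) (divr_gt0 e0 g0)) := c.
apply: filterS => j; rewrite sub0r normrN (ger0_norm (pnorm_ge0 _ _)) => hj.
rewrite distrC -(phBl H)//; apply: le_trans (cauchy_schwarz H (phB H (LF_ j) LF) Lg) _.
apply: le_trans (ler_wpM2r (pnorm_ge0 _ _) hj) _.
rewrite mulrAC -mulrA -[leRHS]mulr1 ler_wpM2l ?(ltW e0)//.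
by rewrite ler_pdivrMr// mul1r lerDl.
Qed.

Section Multipliers.
Variable R : realType.
Local Notation plane := (R * R)%type.
Local Notation mT := (measurableTypeR R * measurableTypeR R)%type.
Local Notation mu := (@lebesgue2 R).
Implicit Types (f g h : plane -> R).
Variable Om : set plane.
Hypotheses (oOm : open Om) (bOm : bounded_set Om).
Let mOm := open_measurable2 oOm.
Local Notation nm := (pnorm (@L2ip R Om)).

Lemma L2M_bounded (m g : plane -> R) (M : R) :
  measurable_fun (Om : set mT) (m : mT -> R) ->
  (forall p, Om p -> `|m p| <= M) -> L2 Om g -> L2 Om (fun p => m p * g p).
Proof.
move=> mm hM Lg; apply: (L2_le oOm (M := M) _ Lg).
  by apply: measurable_funM => //; exact: L2_measurable.
by move=> p Op; rewrite normrM ler_wpM2r// hM.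
Qed.

(** Dominated convergence for multipliers: pointwise convergence with a uniform
   bound on the multipliers gives L2 convergence of the products. *)
Lemma L2_dominated (m_ : nat -> plane -> R) (m g : plane -> R) (M : R) :
  (forall j, measurable_fun (Om : set mT) (m_ j : mT -> R)) ->
  (forall j p, Om p -> `|m_ j p| <= M) ->
  (forall p, Om p -> m_ j p @[j --> \oo] --> m p) ->
  L2 Om g ->
  L2 Om (fun p => m p * g p) /\
  nm ((fun p => m_ j p * g p) - (fun p => m p * g p)) @[j --> \oo] --> (0 : R).
Proof.
move=> mm hM cm Lg.
have mmL : measurable_fun (Om : set mT) (m : mT -> R).
  by apply: (@measurable_fun_cvg _ mT R Om m_) => // p Op; exact: cm.
have hmM p : Om p -> `|m p| <= M.
  move=> Op; have cn : `|m_ j p| @[j --> \oo] --> `|m p|.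
    by apply: cvg_norm; exact: cm.
  rewrite -(cvg_lim _ cn)//; apply: limr_le; first by apply/cvg_ex; eexists; exact: cn.
  by apply: nearW => j; exact: hM.
split; first exact: L2M_bounded hmM Lg.
have ig := L2_integrableM mOm Lg Lg.
pose F j : mT -> \bar R := fun p => ((m_ j p * g p - m p * g p) * (m_ j p * g p - m p * g p))%:E.
have mg := L2_measurable oOm Lg.
have Fcvg : (\int[mu]_(p in Om) F j p @[j --> \oo] --> \int[mu]_(p in Om) (cst 0 p))%E.
  apply: (@dominated_cvg _ mT R mu Om mOm F (cst 0)
    (fun p => ((2 * M) ^+ 2)%:E * (g p * g p)%:E)%E) => //.
  - move=> j; apply/measurable_EFinP; apply: measurable_funM;
      by apply: measurable_funB; apply: measurable_funM.
  - move=> p Op; rewrite /F /=; apply/cvg_EFin; first by apply: nearW.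
    have h0 : m_ j p * g p - m p * g p @[j --> \oo] --> (0 : R).
      rewrite -(subrr (m p * g p)); apply: cvgB; last exact: cvg_cst.
      by apply: cvgM; [exact: cm|exact: cvg_cst].
    rewrite -[X in _ --> X](mulr0 (0 : R)); exact: (cvgM h0 h0).
  - exact: (@integrableZl _ mT _ mu _ mOm _ _ ig).
  - move=> j p Op; rewrite /F /= lee_fin.
    have -> : (m_ j p * g p - m p * g p) * (m_ j p * g p - m p * g p) =
      (m_ j p - m p) ^+ 2 * (g p * g p) by ring.
    rewrite normrM (ger0_norm (sqr_ge0 _)) (ger0_norm (_ : 0 <= g p * g p)); last by rewrite -expr2 sqr_ge0.
    rewrite ler_wpM2r -?expr2 ?sqr_ge0//.
    rewrite -(ger0_norm (sqr_ge0 (m_ j p - m p))) normrX.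
    have := ler_normB (m_ j p) (m p); have := hM j p Op; have := hmM p Op => h1 h2 h3.
    by rewrite lerXn2r// ?nnegrE// ; [have := normr_ge0 (m p); lra|lra].
rewrite integral0 in Fcvg.
have := fine_cvg Fcvg => /= {}Fcvg.
have s0 : Num.sqrt (0 : R) = 0 by rewrite sqrtr0.
rewrite -[X in _ --> X]s0; apply: continuous_cvg; first exact: sqrt_continuous.
exact: Fcvg.
Qed.

Lemma ip_cvg (F_ : nat -> plane -> R) (F g : plane -> R) :
  (forall j, L2 Om (F_ j)) -> L2 Om F -> L2 Om g ->
  nm (F_ j - F) @[j --> \oo] --> (0 : R) ->
  L2ip Om (F_ j) g @[j --> \oo] --> L2ip Om F g.
Proof.
exact: (@ip_cvg_gen R _ (L2 Om) (@L2ip R Om) (L2_pre_hilbert mOm) F_ F g).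
Qed.

End Multipliers.

Section Bump.
Variable R : realType.
Local Notation plane := (R * R)%type.

(** For a < b, a C1 function supported in [a, b], with values in [0, 1] and tending to
   the indicator of the open interval as [e] -> 0. It is rational in the square of a
   positive part, so that it needs no exponential. *)
Definition bump (e a b s : R) : R :=
  let r := Num.max ((s - a) * (b - s)) 0 ^+ 2 in r / (r + e).

Lemma bump_C1 e a b : 0 < e -> exists b', C1_real (bump e a b) b'.
Proof.
move=> e0.
have c1 := C1_realM (C1_realD (C1_real_id R) (C1_real_cst (- a)))
  (C1_realD (C1_real_cst b) (C1_realM (C1_real_cst (-1)) (C1_real_id R))).
have c2 := C1_real_comp (C1_real_sqpos R) c1.
have c3 := C1_realD c2 (C1_real_cst e).
have n0 s : Num.max ((s + - a) * (b + -1 * s)) 0 ^+ 2 + e != 0.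
  by rewrite gt_eqF// ltr_wpDl// sqr_ge0.
eexists; apply: (C1_real_ext _ (fun=> erefl) (C1_realM c2 (C1_realV c3 n0))) => s.
by rewrite /bump mulN1r.
Qed.

Lemma bump_bound e a b s : 0 < e -> 0 <= bump e a b s <= 1.
Proof.
move=> e0; rewrite /bump; set r := _ ^+ 2.
have r0 : 0 <= r by rewrite sqr_ge0.
by rewrite divr_ge0 ?addr_ge0 ?(ltW e0)//= ler_pdivrMr ?mul1r ?lerDl ?(ltW e0)// ltr_wpDl.
Qed.

Lemma bump_out e a b s : a < b -> s \notin `]a, b[ -> bump e a b s = 0.
Proof.
move=> ab; rewrite in_itv /= negb_and -!leNgt => h.
rewrite /bump; have -> : Num.max ((s - a) * (b - s)) 0 = 0.
  by apply/max_idPr; case/orP: h => h; nra.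
by rewrite expr0n mul0r.
Qed.

Lemma bump_cvg a b s : a < b ->
  bump j.+1%:R^-1 a b s @[j --> \oo] --> (\1_(`]a, b[%classic) s : R).
Proof.
move=> ab; rewrite indicE; case: (boolP (s \in `]a, b[)) => sab; last first.
  rewrite memNset; last by move=> h; move/negP: sab; apply.
  by under eq_fun do rewrite bump_out//; exact: cvg_cst.
rewrite mem_set// /bump.
have r0 : 0 < Num.max ((s - a) * (b - s)) 0 ^+ 2.
  rewrite exprn_gt0// lt_max; apply/orP; left.
  by move: sab; rewrite in_itv /= => /andP[? ?]; rewrite mulr_gt0 ?subr_gt0.
set r := _ ^+ 2 in r0 *.
have -> : (true%:R : R) = r / (r + 0) by rewrite addr0 divff ?gt_eqF.
apply: cvgM; first exact: cvg_cst.
apply: cvgV; first by rewrite addr0 gt_eqF.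
apply: cvgD; first exact: cvg_cst.
exact: cvg_harmonic.
Qed.

End Bump.

(** * The fundamental lemma of the calculus of variations *)
Section Rays.
Variable R : realType.
Local Notation plane := (R * R)%type.
Local Notation mT := (measurableTypeR R * measurableTypeR R)%type.
Local Notation mu := (@lebesgue2 R).

(** Open half lines and the whole line: a family stable under intersection whose
   products generate the Borel sets of the plane. *)
Definition ray : set (set R) := [set A | A = setT \/ exists x, A = `]x, +oo[%classic].

Lemma rayI : setI_closed ray.
Proof.
move=> A B [->|[x ->]] [->|[y ->]]; rewrite ?setTI ?setIT.
- by left.
- by right; exists y.
- by right; exists x.
right; exists (Num.max x y); apply/seteqP; split => z /=; rewrite !in_itv /= !andbT.
  by move=> [? ?]; rewrite gt_max; apply/andP.
by rewrite gt_max => /andP.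
Qed.

(** A ray cuts an interval from the left only, so the right endpoint, and with it
   the shape of a box cut by a quadrant, is preserved. *)
Lemma ray_itv A a b : ray A -> exists2 a', a <= a' & `]a, b[%classic `&` A = `]a', b[%classic.
Proof.
move=> [->|[x ->]]; first by exists a; rewrite ?setIT.
exists (Num.max a x); first by rewrite le_max lexx.
apply/seteqP; split => z /=; rewrite !in_itv /= !andbT ?gt_max.
  by move=> [/andP[-> ->] ->].
by move=> /andP[/andP[-> ->] ->].
Qed.

Definition quadrant : set (set plane) := [set A `*` B | A in ray & B in ray].

Lemma quadrantI : setI_closed quadrant.
Proof.
move=> _ _ [A rA [B rB <-]] [A' rA' [B' rB' <-]].
exists (A `&` A'); first exact: rayI.
exists (B `&` B'); first exact: rayI.
by rewrite setXI.
Qed.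

Lemma measurable_quadrant : (@measurable _ mT) `<=` <<s quadrant >>.
Proof.
pose aT := g_sigma_algebraType quadrant.
have mfst : measurable_fun [set: aT] (fst : aT -> measurableTypeR R).
  apply: (measurability _ (RGenOInfty.measurableE R)) => _ [_ [x ->] <-].
  apply: sub_sigma_algebra; exists `]x, +oo[%classic; first by right; exists x.
  by exists setT; [left|rewrite setTI; apply/seteqP; split => p /=; [case|]].
have msnd : measurable_fun [set: aT] (snd : aT -> measurableTypeR R).
  apply: (measurability _ (RGenOInfty.measurableE R)) => _ [_ [x ->] <-].
  apply: sub_sigma_algebra; exists setT; first by left.
  exists `]x, +oo[%classic; first by right; exists x.
  by rewrite setTI; apply/seteqP; split => p /=; [case|].
rewrite /measurable /=; apply: smallest_sub; first exact: smallest_sigma_algebra.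
move=> A [[B mB <-]|[B mB <-]].
- exact: mfst.
- exact: msnd.
Qed.

End Rays.

Section Fundamental.
Variable R : realType.
Local Notation plane := (R * R)%type.
Local Notation mT := (measurableTypeR R * measurableTypeR R)%type.
Local Notation mu := (@lebesgue2 R).
Implicit Types (f g h : plane -> R).
Variable Om : set plane.
Hypotheses (oOm : open Om) (bOm : bounded_set Om).
Let mOm := open_measurable2 oOm.

Lemma L2_integrable g : L2 Om g -> mu.-integrable (Om : set mT) (EFin \o g).
Proof.
move=> Lg; have := L2_integrableM mOm (L2_cst oOm bOm 1) Lg.
by congr (integrable _ _ _); apply/funext => p /=; rewrite mul1r.
Qed.

Variable g : plane -> R.
Hypotheses (Lg : L2 Om g) (hg : forall phi, C1_compact Om phi -> L2ip Om g phi = 0).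
Let ig := L2_integrable Lg.

(** The products of bumps converge to the indicator of the box and are admissible
   test functions. *)
Lemma integral_box0 a b c d : cbox a b c d `<=` Om ->
  (\int[mu]_(p in box a b c d) (g p)%:E = 0)%E.
Proof.
move=> sub; have H := L2_pre_hilbert mOm.
have [ab|ba] := ltP a b; last first.
  rewrite (_ : box a b c d = set0) ?integral_set0//.
  apply/seteqP; split => // -[x y] [/=]; rewrite in_itv /= => /andP[? ?]; lra.
have [cd|dc] := ltP c d; last first.
  rewrite (_ : box a b c d = set0) ?integral_set0//.
  apply/seteqP; split => // -[x y] [/=] _; rewrite in_itv /= => /andP[? ?]; lra.
pose w (j : nat) (p : plane) := bump j.+1%:R^-1 a b p.1 * bump j.+1%:R^-1 c d p.2.
have e0 j : 0 < (j.+1%:R^-1 : R) by rewrite invr_gt0.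
have cw j : C1_on setT (w j).
  have [b1 h1] := bump_C1 a b (e0 j); have [b2 h2] := bump_C1 c d (e0 j).
  exact: C1_on_product h1 h2.
have w01 j p : `|w j p| <= 1.
  have /andP[? ?] := bump_bound a b p.1 (e0 j).
  have /andP[? ?] := bump_bound c d p.2 (e0 j).
  by rewrite /w ger0_norm; [exact: mulr_ile1|exact: mulr_ge0].
have wout j p : ~ cbox a b c d p -> w j p = 0.
  move=> np; rewrite /w.
  case: (boolP (p.1 \in `]a, b[)) => h1; last by rewrite bump_out// mul0r.
  case: (boolP (p.2 \in `]c, d[)) => h2; last by rewrite [X in _ * X]bump_out// mulr0.
  by exfalso; apply: np; apply: box_cbox.
have mw j : measurable_fun (Om : set mT) (w j : mT -> R).
  by have [] := C1_on_measurable oOm (fun p _ => cw j p I).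
pose m : plane -> R := fun p => \1_(`]a, b[%classic) p.1 * \1_(`]c, d[%classic) p.2.
have [L1 cv] := @L2_dominated R Om oOm w m (cst 1) 1
  mw
  (fun j p _ => w01 j p)
  (fun p _ => cvgM (bump_cvg ab) (bump_cvg cd)) (L2_cst oOm bOm 1).
have LW j : L2 Om (fun p => w j p * cst 1 p).
  by apply: (L2M_bounded oOm (M := 1)) (L2_cst oOm bOm 1).
have ipw j : L2ip Om (fun p => w j p * cst 1 p) g = 0.
  have cK : C1_on Om (w j) by move=> p _; exact: (cw j p I).
  have [cphi _] := patch_C1_compact oOm cK (@cbox_compact R a b c d) sub
    (fun p _ => @wout j p).
  rewrite -(hg cphi); apply: eq_Rintegral => p; rewrite inE => Op.
  by rewrite /= mulr1 /patch mem_set// mulrC.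
have ip0 : L2ip Om (fun p => m p * cst 1 p) g = 0.
  have cv0 := ip_cvg oOm LW L1 Lg cv.
  apply: (cvg_unique _ cv0) => //.
  rewrite (_ : (fun j => L2ip _ _ _) = cst 0); first exact: cvg_cst.
  by apply/funext => j; exact: ipw.
have mE p : m p = \1_(box a b c d) p.
  rewrite /m !indicE -natrM mulnb; congr (_%:R); congr nat_of_bool.
  apply/idP/idP => [/andP[/set_mem h1 /set_mem h2]|/set_mem[h1 h2]].
    by apply/mem_set; split.
  by apply/andP; split; apply/mem_set.
have bO : box a b c d `<=` Om by apply: subset_trans sub; exact: box_cbox.
have ib : mu.-integrable (box a b c d : set mT) (EFin \o g).
  by apply: integrableS ig => //; exact: measurable_box.
have e1 : \int[mu]_(p in box a b c d) g p = 0.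
  rewrite -ip0 /L2ip -[in LHS](setIidr bO) Rintegral_mkcondr.
  apply: eq_Rintegral => p _; rewrite mulr1 mE indicE /patch.
  by case: ifPn => _; rewrite ?mul1r ?mul0r.
have fn := integrable_fin_num (measurable_box a b c d : measurable (_ : set mT)) ib.
by rewrite -(fineK fn); congr (_%:E).
Qed.

(** The sets whose intersection with the box has integral zero form a Dynkin system;
   it contains the quadrants, hence every measurable set, and a function with zero
   integral on every measurable set vanishes almost everywhere. *)
Lemma ae0_on_box q : rat_cbox q `<=` Om ->
  {ae mu, forall p, rat_box q p -> g p = 0}.
Proof.
move=> sub; pose D : set mT := rat_box (R := R) q.
have mD : measurable D by exact: measurable_box.
have DO : D `<=` Om by apply: subset_trans sub; exact: box_cbox.
have iD : mu.-integrable D (EFin \o g) by apply: integrableS ig.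
pose H := [set X : set mT | measurable X /\ (\int[mu]_(p in X `&` D) (g p)%:E = 0)%E].
have iXD X : measurable X -> mu.-integrable (X `&` D) (EFin \o g).
  by move=> mX; apply: integrableS iD => //; exact: measurableI.
have H0 : (\int[mu]_(p in D) (g p)%:E = 0)%E by apply: integral_box0.
have dH : dynkin H.
  split.
  - by split; [exact: measurableT|rewrite setTI].
  - move=> X [mX X0]; split; first exact: measurableC.
    have mDX : measurable (D `&` X) by exact: measurableI.
    have mDnX : measurable (D `\` X) by exact: measurableD.
    have := H0; rewrite -{1}(setUIDK D X) integral_setU//.
    + by rewrite setIC X0 add0e setDE setIC.
    + by rewrite setUIDK; exact: measurable_int iD.
    + by apply/disj_setPRL => p [_ nX] [_ Xp].
  - move=> F tF FH; split; first by apply: bigcupT_measurable => i; exact: (FH i).1.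
    rewrite setI_bigcupl (@integral_bigcup _ mT R mu).
    + by rewrite eseries0// => i _ _; exact: (FH i).2.
    + exact: trivIset_setIr.
    + by move=> k; apply: measurableI => //; exact: (FH k).1.
    + rewrite -setI_bigcupl; apply: iXD; apply: bigcupT_measurable => i; exact: (FH i).1.
have QH : @quadrant R `<=` H.
  move=> _ [A rA [B rB <-]]; split.
    have mray C : ray C -> measurable (C : set (measurableTypeR R)).
      by move=> [->|[x ->]]; [exact: measurableT|exact: measurable_itv].
    by apply: measurableX; exact: mray.
  have [a' aa' Aa] := ray_itv (ratr q.1.1) (ratr q.1.2) rA.
  have [b' bb' Bb] := ray_itv (ratr q.2.1) (ratr q.2.2) rB.
  have -> : (A `*` B) `&` D = box a' (ratr q.1.2) b' (ratr q.2.2).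
    by rewrite setIC /D /rat_box /box -setXI Aa Bb.
  apply: integral_box0; apply: subset_trans sub => -[x y] [/=].
  rewrite !in_itv /= => /andP[x1 x2] /andP[y1 y2].
  by split; rewrite /= in_itv /= ?x2 ?y2 ?(le_trans aa')// (le_trans bb').
have MH : (@measurable _ mT) `<=` H.
  apply: subset_trans (@measurable_quadrant R) _.
  apply: (lambda_system_subset (@quadrantI R) _ QH) => //.
  exact/dynkin_lambda_system.
have /= := @integral_ae_eq _ mT R mu D mD (cst 0%E) (EFin \o g) iD (measurable_cst _) _.
have h E : E `<=` D -> measurable E ->
    (\int[mu]_(x in E) (EFin \o g) x = \int[mu]_(x in E) cst 0%E x)%E.
  move=> ED mE; rewrite integral0 -[in LHS](setIidl ED); exact: (MH E mE).2.
move=> /(_ h); apply: ae2S => p /= gp Dp.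
by have := gp Dp; case.
Qed.

Lemma fundamental_lemma : ae_eq_on Om g (cst 0).
Proof.
by apply: open_ae => // n; exact: ae0_on_box.
Qed.

End Fundamental.

(** * Weak gradients and the energy space *)
Section Sobolev.
Variable R : realType.
Local Notation plane := (R * R)%type.
Local Notation mT := (measurableTypeR R * measurableTypeR R)%type.
Local Notation mu := (@lebesgue2 R).
Implicit Types (f g h u v : plane -> R).
Variable Om : set plane.
Hypotheses (oOm : open Om) (bOm : bounded_set Om).
Let mOm := open_measurable2 oOm.
Let H := L2_pre_hilbert mOm.
Local Notation ip := (@L2ip R Om).

Lemma ae_eq_on_refl f : ae_eq_on Om f f.
Proof. exact: ae2W. Qed.

Lemma ae_eq_on_sym f g : ae_eq_on Om f g -> ae_eq_on Om g f.
Proof. by apply: ae2S => p h /h. Qed.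

Lemma ae_eq_on_trans f g h : ae_eq_on Om f g -> ae_eq_on Om g h -> ae_eq_on Om f h.
Proof. by apply: ae2S2 => p h1 h2 Op; rewrite h1// h2. Qed.

Lemma L2ip_ae f f' g : L2 Om f -> L2 Om f' -> L2 Om g -> ae_eq_on Om f f' ->
  ip f g = ip f' g.
Proof.
move=> Lf Lf' Lg ff'; rewrite /L2ip /Rintegral; congr fine.
have [mf mf' mg] := And3 (L2_measurable oOm Lf) (L2_measurable oOm Lf') (L2_measurable oOm Lg).
apply: (@ae_eq_integral _ mT R mu Om) => //.
- by apply/measurable_EFinP; exact: measurable_funM.
- by apply/measurable_EFinP; exact: measurable_funM.
- by apply: ae2S ff' => p h Op /=; rewrite h.
Qed.

Lemma L2ip_ae2 f f' g g' : L2 Om f -> L2 Om f' -> L2 Om g -> L2 Om g' ->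
  ae_eq_on Om f f' -> ae_eq_on Om g g' -> ip f g = ip f' g'.
Proof.
move=> Lf Lf' Lg Lg' ff' gg'; rewrite (L2ip_ae Lf Lf' Lg ff').
by rewrite (phC H f' g) (L2ip_ae Lg Lg' Lf' gg') (phC H g' f').
Qed.

Lemma pnorm_ae f f' : L2 Om f -> L2 Om f' -> ae_eq_on Om f f' ->
  pnorm ip f = pnorm ip f'.
Proof.
move=> Lf Lf' ff'; rewrite /pnorm (L2ip_ae Lf Lf' Lf ff').
by rewrite (phC H) (L2ip_ae Lf Lf' Lf' ff').
Qed.

Lemma pnorm0_ae f : L2 Om f -> pnorm ip f = 0 -> ae_eq_on Om f (cst 0).
Proof.
move=> Lf f0; apply: (fundamental_lemma oOm bOm Lf) => phi cphi.
have [Lphi _ _] := C1_compact_L2 oOm bOm cphi.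
have := cauchy_schwarz H Lf Lphi; rewrite f0 mul0r => h.
by apply/eqP; rewrite -normr_le0.
Qed.

Lemma weak_deriv_unique (D : (plane -> R) -> plane -> R) u g h : L2 Om g -> L2 Om h ->
  (forall phi, C1_compact Om phi -> ip u (D phi) = - ip g phi) ->
  (forall phi, C1_compact Om phi -> ip u (D phi) = - ip h phi) -> ae_eq_on Om g h.
Proof.
move=> Lg Lh wg wh.
have : ae_eq_on Om (g - h) (cst 0).
  apply: (fundamental_lemma oOm bOm) => [|phi cphi]; first exact: (phB H).
  have [Lphi _ _] := C1_compact_L2 oOm bOm cphi.
  have := wg _ cphi; rewrite (wh _ cphi) => /oppr_inj e.
  by rewrite (phBl H)// e subrr.
by apply: ae2S => p hp Op; apply/eqP; rewrite -subr_eq0; apply/eqP; exact: hp.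
Qed.

Lemma weak_dx_unique u g h : is_weak_dx Om u g -> is_weak_dx Om u h -> ae_eq_on Om g h.
Proof. by move=> [Lg wg] [Lh wh]; exact: (weak_deriv_unique Lg Lh wg wh). Qed.

Lemma weak_dy_unique u g h : is_weak_dy Om u g -> is_weak_dy Om u h -> ae_eq_on Om g h.
Proof. by move=> [Lg wg] [Lh wh]; exact: (weak_deriv_unique Lg Lh wg wh). Qed.

Lemma weak_dxP u g : is_weak_dx Om u g -> is_weak_dx Om u (weak_dx Om u).
Proof. by move=> h; exact: (@xgetI _ _ [set g | is_weak_dx Om u g] g). Qed.

Lemma weak_dyP u g : is_weak_dy Om u g -> is_weak_dy Om u (weak_dy Om u).
Proof. by move=> h; exact: (@xgetI _ _ [set g | is_weak_dy Om u g] g). Qed.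

(** Unlike the representatives chosen by [weak_dx] and [weak_dy], explicit weak
   derivatives can be added, scaled and compared. *)
Definition weak_grad u gx gy := [/\ L2 Om u, is_weak_dx Om u gx & is_weak_dy Om u gy].

Lemma weak_grad_H1 u gx gy : weak_grad u gx gy -> H1 Om u.
Proof. by move=> [Lu wx wy]; split => //; [exists gx|exists gy]. Qed.

Lemma H1_weak_grad u : H1 Om u -> weak_grad u (weak_dx Om u) (weak_dy Om u).
Proof. by move=> [Lu [gx wx] [gy wy]]; split; [|exact: weak_dxP wx|exact: weak_dyP wy]. Qed.

Lemma H1P u : H1 Om u -> exists ux uy, weak_grad u ux uy.
Proof. by move=> /H1_weak_grad gu; do 2!eexists; exact: gu. Qed.

(** The gradient form may be computed with any weak derivatives, by uniqueness. *)
Lemma grad_ipE u v ux uy vx vy : weak_grad u ux uy -> weak_grad v vx vy ->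
  grad_ip Om u v = ip ux vx + ip uy vy.
Proof.
move=> gu gv.
have [_ ux' uy'] := H1_weak_grad (weak_grad_H1 gu).
have [_ vx' vy'] := H1_weak_grad (weak_grad_H1 gv).
have [[_ wux wuy] [_ wvx wvy]] := (gu, gv).
have eux := weak_dx_unique ux' wux; have euy := weak_dy_unique uy' wuy.
have evx := weak_dx_unique vx' wvx; have evy := weak_dy_unique vy' wvy.
have [[L1 _] [L2 _]] := (ux', wux); have [[L3 _] [L4 _]] := (uy', wuy).
have [[L5 _] [L6 _]] := (vx', wvx); have [[L7 _] [L8 _]] := (vy', wvy).
have -> : grad_ip Om u v =
  ip (weak_dx Om u) (weak_dx Om v) + ip (weak_dy Om u) (weak_dy Om v) by [].
have ex := L2ip_ae2 L1 L2 L5 L6 eux evx.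
have ey := L2ip_ae2 L3 L4 L7 L8 euy evy.
exact: (f_equal2 +%R ex ey).
Qed.

Lemma weak_gradD u v ux uy vx vy : weak_grad u ux uy -> weak_grad v vx vy ->
  weak_grad (u + v) (ux + vx) (uy + vy).
Proof.
move=> [Lu [Lux hux] [Luy huy]] [Lv [Lvx hvx] [Lvy hvy]].
split; [exact: (phD H)|split|split]; try exact: (phD H).
- move=> phi cphi; have [L1 L2' L3] := C1_compact_L2 oOm bOm cphi.
  by rewrite !(phDl H)// hux// hvx// opprD.
- move=> phi cphi; have [L1 L2' L3] := C1_compact_L2 oOm bOm cphi.
  by rewrite !(phDl H)// huy// hvy// opprD.
Qed.

Lemma weak_gradZ a u ux uy : weak_grad u ux uy ->
  weak_grad (a *: u) (a *: ux) (a *: uy).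
Proof.
move=> [Lu [Lux hux] [Luy huy]].
split; [exact: (phZ H)|split|split]; try exact: (phZ H).
- move=> phi cphi; have [L1 L2' L3] := C1_compact_L2 oOm bOm cphi.
  by rewrite !(phZl H)// hux// mulrN.
- move=> phi cphi; have [L1 L2' L3] := C1_compact_L2 oOm bOm cphi.
  by rewrite !(phZl H)// huy// mulrN.
Qed.

Lemma weak_gradB u v ux uy vx vy : weak_grad u ux uy -> weak_grad v vx vy ->
  weak_grad (u - v) (ux - vx) (uy - vy).
Proof.
move=> gu gv; have := weak_gradD gu (weak_gradZ (-1) gv).
by rewrite (scaleN1r v) (scaleN1r vx) (scaleN1r vy).
Qed.

Lemma weak_grad0 : weak_grad 0 0 0.
Proof.
have z : L2 Om (0 : plane -> R) := ph0 H.
have z0 f : L2 Om f -> ip 0 f = 0.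
  by move=> Lf; rewrite -(scale0r (0 : plane -> R)) (phZl H)// mul0r.
by split=> //; split=> // phi cphi; have [? ? ?] := C1_compact_L2 oOm bOm cphi;
  rewrite !z0// oppr0.
Qed.

(** The gradient form on H^1 is a semi-inner product, so that the abstract lemmas
   apply to [grad_norm], which is its [pnorm]. *)
Lemma H1_pre_hilbert : @pre_hilbert R (plane -> R) (H1 Om) (@grad_ip R Om).
Proof.
split.
- exact: weak_grad_H1 weak_grad0.
- move=> u v /H1P[ux [uy gu]] /H1P[vx [vy gv]].
  exact: weak_grad_H1 (weak_gradD gu gv).
- by move=> a u /H1P[ux [uy gu]]; exact: weak_grad_H1 (weak_gradZ a gu).
- by move=> u v; rewrite /grad_ip; apply: (f_equal2 +%R); exact: (phC H).
- move=> u v w /H1P[ux [uy gu]] /H1P[vx [vy gv]] /H1P[wx [wy gw]].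
  rewrite (grad_ipE (weak_gradD gu gv) gw) (grad_ipE gu gw) (grad_ipE gv gw).
  move: gu gv gw => [_ [? _] [? _]] [_ [? _] [? _]] [_ [? _] [? _]].
  by rewrite !(phDl H)// addrACA.
- move=> a u w /H1P[ux [uy gu]] /H1P[wx [wy gw]].
  rewrite (grad_ipE (weak_gradZ a gu) gw) (grad_ipE gu gw).
  move: gu gw => [_ [? _] [? _]] [_ [? _] [? _]].
  by rewrite !(phZl H)// mulrDr.
- move=> u /H1P[ux [uy gu]]; rewrite (grad_ipE gu gu).
  by case: gu => _ [? _] [? _]; rewrite addr_ge0//; exact: (ph_ge0 H).
Qed.
Let HG := H1_pre_hilbert.

Lemma grad_pnorm_sq u ux uy : weak_grad u ux uy ->
  pnorm (@grad_ip R Om) u ^+ 2 = pnorm ip ux ^+ 2 + pnorm ip uy ^+ 2.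
Proof.
move=> gu; rewrite (pnorm_sq HG (weak_grad_H1 gu)) (grad_ipE gu gu).
by case: gu => _ [Lx _] [Ly _]; rewrite !(pnorm_sq H).
Qed.

Lemma grad_pnorm_le u ux uy : weak_grad u ux uy ->
  pnorm (@grad_ip R Om) u <= pnorm ip ux + pnorm ip uy.
Proof.
move=> gu; rewrite -(@ler_pXn2r _ 2) ?nnegrE ?addr_ge0 ?pnorm_ge0//.
rewrite (grad_pnorm_sq gu) sqrrD.
have := pnorm_ge0 ip ux; have := pnorm_ge0 ip uy; nra.
Qed.

Lemma L2norm_pnorm f : L2 Om f -> L2norm Om f = pnorm ip f.
Proof. exact: L2normE. Qed.

Lemma C1_compact_weak_grad phi : C1_compact Om phi -> weak_grad phi (dx phi) (dy phi).
Proof.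
move=> cphi; have [L Lx Ly] := C1_compact_L2 oOm bOm cphi.
have c := C1_compact_C1_on (A := Om) cphi.
by split; [|exact: C1_weak_dx|exact: C1_weak_dy].
Qed.

Lemma weak_grad_ext u v ux uy : L2 Om v -> ae_eq_on Om u v -> weak_grad u ux uy ->
  weak_grad v ux uy.
Proof.
move=> Lv uv [Lu [Lx hx] [Ly hy]]; split=> //; split=> // phi cphi;
  have [? ? ?] := C1_compact_L2 oOm bOm cphi; rewrite -(L2ip_ae Lu)//.
- exact: hx.
- exact: hy.
Qed.

Lemma pnorm_cvg0_comb (S : (plane -> R) -> Prop) (q : (plane -> R) -> (plane -> R) -> R)
    (a : R) (F G : nat -> plane -> R) : pre_hilbert S q ->
  (forall j, S (F j)) -> (forall j, S (G j)) ->
  pnorm q (F j) @[j --> \oo] --> (0 : R) -> pnorm q (G j) @[j --> \oo] --> (0 : R) ->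
  pnorm q (F j + a *: G j) @[j --> \oo] --> (0 : R).
Proof.
move=> Hq SF SG cF cG.
have c : pnorm q (F j) + `|a| * pnorm q (G j) @[j --> \oo] --> (0 : R).
  rewrite -[X in _ --> X](addr0 (0 : R)); apply: cvgD => //.
  rewrite -[X in _ --> X](mulr0 `|a|); apply: cvgM => //; exact: cvg_cst.
apply: (squeeze_cvgr _ (cvg_cst 0) c); apply: nearW => j.
rewrite pnorm_ge0 /=; apply: le_trans (pnormD Hq (SF j) (phZ Hq a (SG j))) _.
by rewrite (pnormZ Hq).
Qed.

Lemma C1_compact_comb a phi psi : C1_compact Om phi -> C1_compact Om psi ->
  C1_compact Om (phi + a *: psi).
Proof.
move=> [d c cx cy [K [cK KO K0]]] [d' c' c'x c'y [K' [cK' KO' K0']]].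
have D (e p : plane) : derivable phi p e -> derivable psi p e ->
    is_derive p e (phi + a *: psi) ('D_e phi p + a *: 'D_e psi p).
  by move=> h h'; apply: is_deriveD; [exact: derivable_is_derive|
    apply: is_deriveZ; exact: derivable_is_derive].
have Ex : dx (phi + a *: psi) = fun p => dx phi p + a * dx psi p.
  apply/funext => p; have [h _] := d p; have [h' _] := d' p.
  exact: (is_deriveE (D _ _ h h')).
have Ey : dy (phi + a *: psi) = fun p => dy phi p + a * dy psi p.
  apply/funext => p; have [_ h] := d p; have [_ h'] := d' p.
  exact: (is_deriveE (D _ _ h h')).
have cc (f g : plane -> R) : continuous f -> continuous g ->
    continuous (fun p => f p + a * g p).
  by move=> cf cg p; apply: cvgD; [exact: cf|apply: cvgM; [exact: cvg_cst|exact: cg]].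
split.
- move=> p; have [h1 h2] := d p; have [h1' h2'] := d' p.
  by split; [exact: (is_derive_ex (D _ _ h1 h1'))|
             exact: (is_derive_ex (D _ _ h2 h2'))].
- exact: cc.
- by rewrite Ex; exact: cc.
- by rewrite Ey; exact: cc.
- exists (K `|` K'); split; first exact: compactU.
    by move=> p [/KO|/KO'].
  move=> p nK; have k1 : ~ K p by move=> h; apply: nK; left.
  have k2 : ~ K' p by move=> h; apply: nK; right.
  have -> : (phi + a *: psi) p = phi p + a * psi p by [].
  by rewrite K0// K0'// mulr0 addr0.
Qed.

(** H^1_0 in terms of the two abstract norms; the representatives agree because all
   functions involved are in L2. *)
Lemma H10_approx u : H10 Om u <-> H1 Om u /\ exists phi : nat -> plane -> R,
  [/\ forall j, C1_compact Om (phi j),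
      pnorm ip (phi j - u) @[j --> \oo] --> (0 : R) &
      pnorm (@grad_ip R Om) (phi j - u) @[j --> \oo] --> (0 : R)].
Proof.
have E (phi : nat -> plane -> R) : H1 Om u -> (forall j, C1_compact Om (phi j)) ->
    (fun j => L2norm Om (phi j \- u)) = (fun j => pnorm ip (phi j - u)).
  move=> [Lu _ _] cphi; apply/funext => j; apply: L2norm_pnorm.
  by apply: (phB H) => //; have [] := C1_compact_weak_grad (cphi j).
split=> -[H1u [phi [cphi h1 h2]]]; split=> //; exists phi; split=> //.
  by rewrite -E.
by rewrite E.
Qed.

Lemma H10_comb a u v : H10 Om u -> H10 Om v -> H10 Om (u + a *: v).
Proof.
move=> /H10_approx[H1u [phi [cphi phi1 phi2]]] /H10_approx[H1v [psi [cpsi psi1 psi2]]].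
have Hphi j : H1 Om (phi j) := weak_grad_H1 (C1_compact_weak_grad (cphi j)).
have Hpsi j : H1 Om (psi j) := weak_grad_H1 (C1_compact_weak_grad (cpsi j)).
have L f : H1 Om f -> L2 Om f by case.
have E : (fun j => (phi j + a *: psi j) - (u + a *: v)) =
    (fun j => (phi j - u) + a *: (psi j - v)).
  by apply/funext => j; rewrite opprD addrACA -scalerBr.
apply/H10_approx; split; first by apply: (phD HG) => //; exact: (phZ HG).
exists (fun j => phi j + a *: psi j); split.
- by move=> j; exact: C1_compact_comb.
- have := pnorm_cvg0_comb a H (fun j => phB H (L _ (Hphi j)) (L _ H1u))
    (fun j => phB H (L _ (Hpsi j)) (L _ H1v)) phi1 psi1.
  by apply: cvg_trans; apply: near_eq_cvg; apply: nearW => j; rewrite (congr1 (@^~ j) E).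
- have := pnorm_cvg0_comb a HG (fun j => phB HG (Hphi j) H1u)
    (fun j => phB HG (Hpsi j) H1v) phi2 psi2.
  by apply: cvg_trans; apply: near_eq_cvg; apply: nearW => j; rewrite (congr1 (@^~ j) E).
Qed.

Lemma friedrichs_comb a u v g h : friedrichs Om u g -> friedrichs Om v h ->
  friedrichs Om (u + a *: v) (g + a *: h).
Proof.
move=> [H1u Lg ug] [H1v Lh vh]; split.
- exact: H10_comb.
- by apply: (phD H) => //; exact: (phZ H).
- move=> w Hw; have := Hw => -[H1w _]; have [Lw _ _] := H1w.
  have [Hu _] := H1u; have [Hv _] := H1v.
  have Hav := phZ HG a Hv; have Lah := phZ H a Lh.
  by rewrite (phDl HG)// (phZl HG)// (phDl H)// (phZl H)// ug// vh.
Qed.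

End Sobolev.

(** * Classical functions vanishing on the boundary *)
Section Truncation.
Variable R : realType.
Implicit Types (e s : R).

(** The truncation [trunc e] vanishes where s^2 <= e and tends to the identity as
   [e] -> 0, while its derivative [trunc' e] stays bounded and tends to 1 except at
   0. Both the factor trunc e s / s and the derivative are polynomials in two ratios
   with values in [0, 1]. *)
Definition cutoff e s : R := Num.max (s * s - e) 0 / (s * s + e).
Definition saturation e s : R := s * s / (s * s + e).
Definition trunc_factor e s : R := cutoff e s ^+ 2.
Definition trunc e s : R := trunc_factor e s * s.
Definition trunc' e s : R :=
  4 * cutoff e s * saturation e s + cutoff e s ^+ 2 - 4 * cutoff e s ^+ 2 * saturation e s.

Lemma trunc_den e s : 0 < e -> 0 < s * s + e.
Proof. by move=> e0; rewrite ltr_wpDl// -expr2 sqr_ge0. Qed.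

Lemma trunc_C1 e : 0 < e -> C1_real (trunc e) (trunc' e).
Proof.
move=> e0; have D0 s := trunc_den s e0.
have c0 := C1_realM (C1_real_id R) (C1_real_id R).
have c1 := C1_real_comp (C1_real_sqpos R) (C1_realD c0 (C1_real_cst (- e))).
have n0 s : s * s + e != 0 by rewrite gt_eqF.
have c2 := C1_realV (C1_realD c0 (C1_real_cst e)) n0.
have c3 := C1_realM c1 (C1_realM (C1_realM c2 c2) (C1_real_id R)).
apply: C1_real_ext c3 => s.
  by rewrite /trunc /trunc_factor /cutoff; field.
rewrite /trunc' /cutoff /saturation; move: (Num.max _ 0) => P.
have n1 := n0 s; by field.
Qed.

Lemma cutoff_bounds e s : 0 < e -> 0 <= cutoff e s <= 1.
Proof.
move=> e0; have D0 := trunc_den s e0; rewrite /cutoff.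
have s0 : 0 <= s * s by rewrite -expr2 sqr_ge0.
rewrite divr_ge0 ?(ltW D0) ?le_max ?lexx ?orbT//=.
by rewrite ler_pdivrMr// mul1r ge_max; apply/andP; split; lra.
Qed.

Lemma saturation_bounds e s : 0 < e -> 0 <= saturation e s <= 1.
Proof.
move=> e0; have D0 := trunc_den s e0; rewrite /saturation.
have s0 : 0 <= s * s by rewrite -expr2 sqr_ge0.
rewrite divr_ge0 ?(ltW D0)//=.
by rewrite ler_pdivrMr// mul1r; lra.
Qed.

(** The constant is that of [trunc'_bound], where it is the sum 4 + 1 + 4 of the
   coefficients of [trunc']. *)
Lemma trunc_factor_bound e s : 0 < e -> `|trunc_factor e s| <= 9.
Proof.
move=> e0; have /andP[? ?] := cutoff_bounds s e0; rewrite /trunc_factor.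
by rewrite ger0_norm ?sqr_ge0//; nra.
Qed.

Lemma trunc'_bound e s : 0 < e -> `|trunc' e s| <= 9.
Proof.
move=> e0; have := cutoff_bounds s e0; have := saturation_bounds s e0; rewrite /trunc'.
move: (cutoff e s) (saturation e s) => x y /andP[y0 y1] /andP[x0 x1].
have x2 : 0 <= x ^+ 2 <= 1 by rewrite sqr_ge0 /= expr_le1.
have xy : 0 <= x * y <= 1 by rewrite mulr_ge0//= mulr_ile1.
move: x2 (xy) => /andP[x20 x21] /andP[xy0 xy1].
have x2y : 0 <= x ^+ 2 * y <= 1 by rewrite mulr_ge0//= mulr_ile1.
move: x2y => /andP[? ?].
by rewrite ler_norml; apply/andP; split; lra.
Qed.

Lemma trunc_small e s : 0 < e -> s * s <= e -> trunc e s = 0.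
Proof.
move=> e0 se; rewrite /trunc /trunc_factor /cutoff.
have -> : Num.max (s * s - e) 0 = 0 by apply/max_idPr; lra.
by rewrite mul0r expr0n mul0r.
Qed.

Lemma squeeze_to_1 (x : nat -> R) (c : R) :
  (forall j, 1 - c * j.+1%:R^-1 <= x j <= 1) -> x j @[j --> \oo] --> (1 : R).
Proof.
move=> h; have c0 : 1 - c * j.+1%:R^-1 @[j --> \oo] --> (1 : R).
  rewrite -[X in _ --> X](subr0 (1 : R)) -(mulr0 c).
  by apply: cvgB; [exact: cvg_cst|apply: cvgM; [exact: cvg_cst|exact: cvg_harmonic]].
have c1 : (fun=> 1) j @[j --> \oo] --> (1 : R) by exact: cvg_cst.
by apply: (squeeze_cvgr _ c0 c1); apply: nearW => j; exact: h.
Qed.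

Lemma cutoff_cvg s : s != 0 -> cutoff j.+1%:R^-1 s @[j --> \oo] --> (1 : R).
Proof.
move=> s0; have ss : 0 < s * s by rewrite -expr2 exprn_even_gt0.
apply: (squeeze_to_1 (c := 2 / (s * s))) => j.
have e0 : 0 < (j.+1%:R^-1 : R) by rewrite invr_gt0.
have /andP[_ ->] := cutoff_bounds s e0; rewrite andbT.
move: (_^-1) e0 => e e0; have D0 := trunc_den s e0; rewrite /cutoff.
rewrite ler_pdivlMr//; apply: (@le_trans _ _ (s * s - e)); last by rewrite le_max lexx.
have -> : (1 - 2 / (s * s) * e) * (s * s + e) = s * s - e - 2 / (s * s) * e * e.
  by field.
by rewrite lerBlDr lerDl !mulr_ge0 ?invr_ge0 ?(ltW e0) ?(ltW ss).
Qed.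

Lemma saturation_cvg s : s != 0 -> saturation j.+1%:R^-1 s @[j --> \oo] --> (1 : R).
Proof.
move=> s0; have ss : 0 < s * s by rewrite -expr2 exprn_even_gt0.
apply: (squeeze_to_1 (c := 1 / (s * s))) => j.
have e0 : 0 < (j.+1%:R^-1 : R) by rewrite invr_gt0.
have /andP[_ ->] := saturation_bounds s e0; rewrite andbT.
move: (_^-1) e0 => e e0; have D0 := trunc_den s e0; rewrite /saturation.
rewrite ler_pdivlMr//.
have -> : (1 - 1 / (s * s) * e) * (s * s + e) = s * s - 1 / (s * s) * e * e.
  by field.
by rewrite lerBlDr lerDl !mulr_ge0 ?invr_ge0 ?(ltW e0) ?(ltW ss).
Qed.

Lemma cutoff0 e : 0 < e -> cutoff e 0 = 0.
Proof.
move=> e0; rewrite /cutoff mulr0 add0r (_ : Num.max (- e) 0 = 0) ?mul0r//.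
by apply/max_idPr; lra.
Qed.

Lemma trunc_factor_cvg s : trunc_factor j.+1%:R^-1 s @[j --> \oo] --> ((s != 0)%:R : R).
Proof.
rewrite /trunc_factor; have [->|s0] := eqVneq s 0.
  rewrite (_ : (fun j => _) = cst 0); first exact: cvg_cst.
  by apply/funext => j; rewrite cutoff0 ?invr_gt0// expr0n.
have h := cutoff_cvg s0.
by rewrite -[X in _ --> X](expr1n _ 2) !expr2 /=; under eq_fun do rewrite expr2; apply: cvgM.
Qed.

Lemma trunc'_cvg s : trunc' j.+1%:R^-1 s @[j --> \oo] --> ((s != 0)%:R : R).
Proof.
rewrite /trunc'; have [->|s0] := eqVneq s 0.
  rewrite (_ : (fun j => _) = cst 0); first exact: cvg_cst.
  by apply/funext => j; rewrite cutoff0 ?invr_gt0//=; ring.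
have h := cutoff_cvg s0; have h' := saturation_cvg s0.
have h2 : cutoff j.+1%:R^-1 s ^+ 2 @[j --> \oo] --> (1 : R).
  by have := @trunc_factor_cvg s; rewrite s0.
have -> : (true%:R : R) = 4 * 1 * 1 + 1 - 4 * 1 * 1.
  by rewrite mulr1n; ring.
by apply: cvgB; [apply: cvgD => //|];
  (apply: cvgM => //; apply: cvgM => //; exact: cvg_cst).
Qed.

End Truncation.

Section FriedrichsOfClassical.
Variable R : realType.
Local Notation plane := (R * R)%type.
Local Notation mT := (measurableTypeR R * measurableTypeR R)%type.
Implicit Types (f g h u v : plane -> R).
Variable Om : set plane.
Hypotheses (oOm : open Om) (bOm : bounded_set Om).
Let mOm := open_measurable2 oOm.
Let H := L2_pre_hilbert mOm.
Let HG := H1_pre_hilbert oOm bOm.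
Local Notation ip := (@L2ip R Om).

Lemma closure_compact : compact (closure Om).
Proof.
have [M M0 sub] := bounded_subset_cbox bOm.
apply: (subclosed_compact _ (@cbox_compact R (- M) M (- M) M)).
  exact: closed_closure.
rewrite closureE; apply: smallest_sub => //.
by apply: compact_closed; [exact: norm_hausdorff|exact: cbox_compact].
Qed.

Lemma C0_closure_L2 f : C0_closure Om f -> L2 Om f.
Proof.
move=> cf; have [h ch hf] := cf.
have mf : measurable_fun (Om : set mT) (f : mT -> R).
  by apply: open_continuous_measurable2 => // p Op; exact: C0_closure_continuous cf Op.
have /compact_bounded[M [_ hM]] : compact (h @` closure Om).
  by apply: continuous_compact => //; exact: closure_compact.
apply: (L2_bounded oOm bOm (M := `|M| + 1) mf) => p Op; rewrite -hf//.
apply: (hM (`|M| + 1)); last by exists p => //; exact: subset_closure.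
by rewrite (le_lt_trans (ler_norm M)) ?ltrDl.
Qed.

Lemma Ck1_weak_grad g : Ck_closure 1 Om g -> weak_grad Om g (dx g) (dy g).
Proof.
move=> cg; have c1 := Ck1_C1_on oOm cg.
have [c0 [_ [cx _] [cy _]]] := cg.
have Lg := C0_closure_L2 c0; have Lx := C0_closure_L2 cx; have Ly := C0_closure_L2 cy.
by split; [|exact: C1_weak_dx|exact: C1_weak_dy].
Qed.

Lemma Ck2_Ck1 u : Ck_closure 2 Om u ->
  [/\ Ck_closure 1 Om u, Ck_closure 1 Om (dx u) & Ck_closure 1 Om (dy u)].
Proof.
move=> [c0 [du cx cy]]; have [cx0 _] := cx; have [cy0 _] := cy.
have cu : Ck_closure 1 Om u by exact: (conj c0 (And3 du (conj cx0 I) (conj cy0 I))).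
exact: (And3 cu cx cy).
Qed.

Section ZeroBoundary.
Variable u : plane -> R.
Hypotheses (cu : Ck_closure 1 Om u) (u0 : zero_on_boundary Om u).

Let E (j : nat) : R := j.+1%:R^-1.
Let E0 j : 0 < E j. Proof. by rewrite invr_gt0. Qed.
Let w j : plane -> R := trunc (E j) \o u.
Let gu := Ck1_weak_grad cu.
Let cu1 := Ck1_C1_on oOm cu.
Let m : plane -> R := fun p => (u p != 0)%:R.

Let w_C1 j := C1_on_outer oOm (trunc_C1 (E0 j)) cu1.

(** The set where u^2 >= e is closed in the closure of [Om], and it does not meet
   the boundary, where [u] vanishes. *)
Lemma truncation_compact j : C1_compact Om (w j \_ Om) /\ forall p, Om p ->
  [/\ (w j \_ Om) p = w j p, dx (w j \_ Om) p = dx (w j) p & dy (w j \_ Om) p = dy (w j) p].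
Proof.
have [h [ch hu h0]] := u0.
have cK0 : closed [set x : R | E j <= x * x].
  have -> : [set x : R | E j <= x * x] = (fun x : R => x * x) @^-1` [set y | E j <= y] by [].
  apply: closed_comp; last exact: closed_ge.
  by move=> x _; apply: cvgM; exact: cvg_id.
pose K := closure Om `&` h @^-1` [set x : R | E j <= x * x].
have cK : compact K.
  have /closed_subspaceP[V cV VK] : closed (h @^-1` [set x : R | E j <= x * x] :
      set (subspace (closure Om))).
    by apply: closed_comp => // x _; exact: ch.
  have -> : K = V `&` closure Om by rewrite VK setIC.
  apply: subclosed_compact closure_compact _; last by move=> p [].
  by apply: closedI => //; exact: closed_closure.
apply: (patch_C1_compact oOm (w_C1 j).1 cK).
- move=> p [cp hp]; case: (pselect (Om p)) => // nO; exfalso.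
  by move: hp; rewrite /= h0// mulr0 leNgt E0.
- move=> p Op nK; apply: trunc_small => //; rewrite leNgt; apply/negP => lt.
  apply: nK; split; first exact: subset_closure.
  by rewrite /= hu// ltW.
Qed.

Let mu_ (j : nat) : plane -> R := fun p => trunc_factor (E j) (u p).
Let md_ (j : nat) : plane -> R := fun p => trunc' (E j) (u p).

Let m_meas j : measurable_fun (Om : set mT) (mu_ j : mT -> R) /\
  measurable_fun (Om : set mT) (md_ j : mT -> R).
Proof.
have mu1 := (C1_on_measurable oOm cu1).
split; apply: open_continuous_measurable2 => // p Op; have [c _ _ _] := cu1 Op.
- have D0 : {for p, continuous (fun p => (u p * u p + E j)^-1)}.
    apply: cvgV; first by rewrite gt_eqF// trunc_den.
    by apply: cvgD; [apply: cvgM|exact: cvg_cst].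
  rewrite /mu_ /trunc_factor /cutoff.
  have N0 : {for p, continuous (fun p => Num.max (u p * u p - E j) 0)}.
    apply: (@continuous_max R plane (fun p => u p * u p - E j) (cst 0) p _ (cvg_cst _)).
    by apply: cvgB; [apply: cvgM|exact: cvg_cst].
  by apply: (@continuousM _ _ (fun p => cutoff (E j) (u p)) (fun p => cutoff (E j) (u p)));
    apply: cvgM.
- have [_ ct] := trunc_C1 (E0 j); exact: (continuous_comp c (ct (u p))).
Qed.

Let dom_u : L2 Om (fun p => m p * u p) /\
  pnorm ip ((fun p => mu_ j p * u p) - (fun p => m p * u p)) @[j --> \oo] --> (0 : R).
Proof.
have [Lu _ _] := gu.
apply: (L2_dominated oOm (M := 9)) Lu => [j|j p _|p _]; first by case: (m_meas j).
  exact: trunc_factor_bound.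
exact: trunc_factor_cvg.
Qed.

Let dom_d g : L2 Om g -> L2 Om (fun p => m p * g p) /\
  pnorm ip ((fun p => md_ j p * g p) - (fun p => m p * g p)) @[j --> \oo] --> (0 : R).
Proof.
move=> Lg.
apply: (L2_dominated oOm (M := 9)) Lg => [j|j p _|p _]; first by case: (m_meas j).
  exact: trunc'_bound.
exact: trunc'_cvg.
Qed.

Let phi j := w j \_ Om.

Let phi_eq j p : Om p ->
  [/\ phi j p = mu_ j p * u p, dx (phi j) p = md_ j p * dx u p & dy (phi j) p = md_ j p * dy u p].
Proof.
move=> Op; have [_ /(_ p Op)[e1 e2 e3]] := truncation_compact j.
have [_ /(_ p Op)[f1 f2]] := w_C1 j.
by rewrite /phi; split; [exact: e1|exact: (etrans e2 f1)|exact: (etrans e3 f2)].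
Qed.

Let m_u p : m p * u p = u p.
Proof. by rewrite /m; case: eqVneq => [->|]; rewrite ?mul0r ?mul1r. Qed.

Let Lmd j g : L2 Om g -> L2 Om (fun p => md_ j p * g p).
Proof.
move=> Lg; apply: (L2M_bounded oOm (M := 9)) Lg; first by case: (m_meas j).
by move=> p _; exact: trunc'_bound.
Qed.

Let phi_weak j : weak_grad Om (phi j) (dx (phi j)) (dy (phi j)).
Proof. by apply: C1_compact_weak_grad => //; case: (truncation_compact j). Qed.

Let phi_cvg : pnorm ip (phi j - u) @[j --> \oo] --> (0 : R).
Proof.
have [Lu _ _] := gu; have [_] := dom_u.
apply: cvg_trans; apply: near_eq_cvg; apply: nearW => j.
rewrite /pnorm; congr Num.sqrt; apply: eq_Rintegral => p; rewrite inE => Op.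
have [e _ _] := phi_eq j Op.
have -> : (phi j - u) p = mu_ j p * u p - m p * u p by rewrite m_u -e.
by [].
Qed.

(* The weak gradient of [u] is also the limit of those of the truncations; hence
   the gradient of [u] vanishes almost everywhere on the zero set of [u]. *)
Let weak_lim : weak_grad Om u (fun p => m p * dx u p) (fun p => m p * dy u p).
Proof.
have [Lu [Lx _] [Ly _]] := gu.
have [Lmx cx] := dom_d Lx; have [Lmy cy] := dom_d Ly.
have Lphi j : L2 Om (phi j) by case: (phi_weak j).
have lim g q psi : L2 Om g -> L2 Om psi -> L2 Om q ->
    (forall j, ip (phi j) q = - ip (fun p => md_ j p * g p) psi) ->
    ip u q = - ip (fun p => m p * g p) psi.
  move=> Lg Lp Lq h; have [Lm c] := dom_d Lg.
  have h1 := ip_cvg oOm Lphi Lu Lq phi_cvg.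
  have h2 := ip_cvg oOm (fun j => Lmd j Lg) Lm Lp c.
  rewrite (funext h) in h1; exact: (cvg_unique _ h1 (cvgN h2)).
split=> //; split=> // psi cpsi; have [Lp Lpx Lpy] := C1_compact_L2 oOm bOm cpsi.
- apply: (lim _ _ _ Lx Lp Lpx) => j; have [_ [_ ->//] _] := phi_weak j; congr (- _).
  by apply: eq_Rintegral => p; rewrite inE => /(phi_eq j)[_ -> _].
- apply: (lim _ _ _ Ly Lp Lpy) => j; have [_ _ [_ ->//]] := phi_weak j; congr (- _).
  by apply: eq_Rintegral => p; rewrite inE => /(phi_eq j)[_ _ ->].
Qed.

(** The gradients of the truncations converge to the gradient of [u] multiplied by
   the indicator of the set where [u] is not zero. By uniqueness of weak derivatives
   this limit is the gradient of [u] itself. *)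
Lemma zero_boundary_H10 : H10 Om u.
Proof.
have [Lu [Lx wx] [Ly wy]] := gu.
have [_ [Lmx wmx] [Lmy wmy]] := weak_lim.
have ex := weak_dx_unique oOm bOm (conj Lx wx) (conj Lmx wmx).
have ey := weak_dy_unique oOm bOm (conj Ly wy) (conj Lmy wmy).
apply/(H10_approx oOm bOm); split; first exact: weak_grad_H1 gu.
exists phi; split; [by move=> j; case: (truncation_compact j)|exact: phi_cvg|].
have [_ cx] := dom_d Lx; have [_ cy] := dom_d Ly.
have c : pnorm ip ((fun p => md_ j p * dx u p) - (fun p => m p * dx u p)) +
  pnorm ip ((fun p => md_ j p * dy u p) - (fun p => m p * dy u p)) @[j --> \oo] --> (0 : R).
  rewrite -[X in _ --> X](addr0 (0 : R)); exact: (cvgD cx cy).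
have c0 : (fun=> 0) j @[j --> \oo] --> (0 : R) by exact: cvg_cst.
apply: (squeeze_cvgr _ c0 c); apply: nearW => j; rewrite pnorm_ge0 /=.
have gj := weak_gradB oOm bOm (phi_weak j) gu.
have [L1 [L2' _] [L3 _]] := phi_weak j.
have err d g : L2 Om d -> L2 Om g -> L2 Om (fun p => m p * g p) ->
    (forall p, Om p -> d p = md_ j p * g p) -> ae_eq_on Om g (fun p => m p * g p) ->
    pnorm ip (d - g) = pnorm ip ((fun p => md_ j p * g p) - (fun p => m p * g p)).
  move=> Ld Lg Lm e ae; apply: (pnorm_ae oOm (phB H Ld Lg) (phB H (Lmd j Lg) Lm)).
  apply: ae2S ae => p ep Op; have -> : (d - g) p = d p - g p by [].
  by rewrite e// {2}(ep Op).
have Ex p (Op : Om p) : dx (phi j) p = md_ j p * dx u p by case: (phi_eq j Op).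
have Ey p (Op : Om p) : dy (phi j) p = md_ j p * dy u p by case: (phi_eq j Op).
have := grad_pnorm_le oOm bOm gj.
by rewrite (err _ _ L2' Lx Lmx Ex ex) (err _ _ L3 Ly Lmy Ey ey).
Qed.

End ZeroBoundary.

(** Green's formula against test functions is the definition of the weak
   derivatives of the gradient of [u]; it extends to H^1_0 by density. *)
Lemma dom_L0_friedrichs u : dom_L0 Om u ->
  [/\ friedrichs Om u (fun p => - laplacian u p), weak_grad Om u (dx u) (dy u),
      L2 Om (dx (dx u)) & L2 Om (dy (dy u))].
Proof.
move=> [cu u0]; have [cu1 cx cy] := Ck2_Ck1 cu.
have Hu := zero_boundary_H10 cu1 u0.
have gu := Ck1_weak_grad cu1; have gx := Ck1_weak_grad cx; have gy := Ck1_weak_grad cy.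
have [Lu [Lx wx] [Ly wy]] := gu.
have [_ [Lxx wxx] _] := gx; have [_ _ [Lyy wyy]] := gy.
have Ll : L2 Om (fun p => - laplacian u p).
  have := phN H (phD H Lxx Lyy); congr L2.
split=> //; split=> // v Hv.
have [H1v [phi [cphi cv1 cv2]]] := (H10_approx oOm bOm v).1 Hv.
have [Lv _ _] := H1v.
have gphi j := C1_compact_weak_grad oOm bOm (cphi j).
have H1u := weak_grad_H1 gu; have H1phi j := weak_grad_H1 (gphi j).
have Lphi j : L2 Om (phi j) by case: (gphi j).
have e j : grad_ip Om u (phi j) = ip (fun p => - laplacian u p) (phi j).
  rewrite (grad_ipE oOm bOm gu (gphi j)) (wxx _ (cphi j)) (wyy _ (cphi j)) -opprD.
  rewrite -(phDl H Lxx Lyy (Lphi j)) -(phNl H (phD H Lxx Lyy) (Lphi j)).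
  by [].
have c1 : ip (fun p => - laplacian u p) (phi j) @[j --> \oo] --> ip (fun p => - laplacian u p) v.
  have := ip_cvg oOm Lphi Lv Ll cv1; rewrite (phC H v).
  by apply: cvg_trans; apply: near_eq_cvg; apply: nearW => j; exact: (phC H).
have c2 : grad_ip Om u (phi j) @[j --> \oo] --> grad_ip Om u v.
  have := @ip_cvg_gen R _ _ _ HG phi v u H1phi H1v H1u cv2; rewrite (phC HG v).
  by apply: cvg_trans; apply: near_eq_cvg; apply: nearW => j; exact: (phC HG).
rewrite (_ : (fun j => grad_ip Om u (phi j)) = (fun j => ip (fun p => - laplacian u p) (phi j))) in c2.
  exact: (cvg_unique _ c2 c1).
by apply/funext.
Qed.

End FriedrichsOfClassical.

(** * Stability of the scheme as an inequality between real sequences *)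
Section Bootstrap.
Variable R : realType.
Implicit Types a b c L x y e D d tau P Q : R.

Lemma square_dist_bound s t x L : 0 <= s -> 0 <= t -> t <= L -> `|s - t| <= x ->
  `|s ^+ 2 - t ^+ 2| <= x * (2 * L + x).
Proof.
move=> s0 t0 tL st; have x0 : 0 <= x := le_trans (normr_ge0 _) st.
have -> : s ^+ 2 - t ^+ 2 = (s - t) * (s + t) by ring.
rewrite normrM (ger0_norm (addr_ge0 s0 t0)).
apply: ler_pM => //; first exact: addr_ge0.
by have := ler_norm (s - t); lra.
Qed.

(** An error of size [x] forces the discrete gradient norm [s] to be at least
   [x - L], since the exact one [t] is at most [L]; so a large error makes the
   coefficient large, which is what yields a quartic term in the energy. *)
Lemma coefficient_coercive a b L : 0 < a -> 0 < b -> 1 <= L -> exists2 c, 0 < c <= 1 &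
  forall al be s t r x, a <= al -> b <= be -> 0 <= s -> 0 <= t <= L ->
    0 <= x -> x <= s + t -> c * (1 + x ^+ 2) <= al + be / 2 * (s ^+ 2 + r ^+ 2).
Proof.
move=> a0 b0 L1.
have D0 : 0 < 4 * (b * L ^+ 2 + a).
  by rewrite mulr_gt0// addr_gt0// mulr_gt0// exprn_gt0//; lra.
set c := a * b / (4 * (b * L ^+ 2 + a)).
have c0 : 0 < c by rewrite divr_gt0// mulr_gt0.
exists (Num.min 1 (Num.min (a / 2) c)).
  by rewrite !lt_min ge_min lexx ltr01 divr_gt0//= c0.
move=> al be s t r x aal bbe s0 /andP[t0 tL] x0 xst.
apply: (@le_trans _ _ (a / 2 + c * x ^+ 2)).
  rewrite mulrDr mulr1; apply: lerD.
    by rewrite !ge_min lexx orbT.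
  by rewrite ler_wpM2r ?sqr_ge0// !ge_min lexx !orbT.
have sx : x ^+ 2 <= 2 * s ^+ 2 + 2 * L ^+ 2.
  have h1 : x ^+ 2 <= (s + t) ^+ 2 by rewrite lerXn2r// nnegrE addr_ge0.
  have h2 : t ^+ 2 <= L ^+ 2 by rewrite lerXn2r// nnegrE//; lra.
  have := sqr_ge0 (s - t); nra.
have cE : c * (4 * (b * L ^+ 2 + a)) = a * b by rewrite /c divfK// gt_eqF.
have r0 := sqr_ge0 r; have s20 := sqr_ge0 s.
apply: (@le_trans _ _ (a + b / 2 * s ^+ 2)); last first.
  apply: lerD => //; apply: ler_pM => //; first by lra.
    by lra.
  by lra.
(* with w = s^2 : c x^2 <= 2 c (w + L^2), and 4 c b L^2 + 4 c a = a b *)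
have L20 := sqr_ge0 L.
have h1 : 2 * c * L ^+ 2 <= a / 2.
  rewrite -(ler_pM2l b0).
  have := mulr_gt0 c0 a0; lra.
have h2 : 2 * c <= b / 2.
  rewrite -(ler_pM2l a0).
  have := mulr_ge0 (ltW c0) (mulr_ge0 (ltW b0) L20); lra.
have h3 : c * x ^+ 2 <= c * (2 * s ^+ 2 + 2 * L ^+ 2) by rewrite ler_wpM2l// ltW.
have h4 : 2 * c * s ^+ 2 <= b / 2 * s ^+ 2 by rewrite ler_wpM2r.
lra.
Qed.

Lemma young_pair t D d : t * (D + d) <= t ^+ 2 + (D ^+ 2 + d ^+ 2) / 2.
Proof. have := sqr_ge0 (t - D); have := sqr_ge0 (t - d); nra. Qed.

(** [P] stands for the difference of the two averaged coefficients, and [x], [y],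
   [D], [d] for the new and old errors and increments. The term x^4 comes from the
   squares in the bound on [P]; Gronwall's inequality can digest it only once [x] is
   known to be bounded. *)
Lemma residual_bound L tau x y D d P : 1 <= L -> 0 <= x -> 0 <= y <= 1 ->
  0 <= D -> 0 <= d ->
  P <= L / 2 * (x * (2 * L + x) + y * (2 * L + y)) ->
  (L * tau ^+ 2 + L * P) * (D + d) <=
  3 * L ^+ 3 * (tau ^+ 4 + x ^+ 2 + x ^+ 4 + y ^+ 2 + D ^+ 2 + d ^+ 2).
Proof.
move=> L1 x0 /andP[y0 y1] D0 d0 hP.
have L0 : 0 <= L by lra.
have L2 : L <= L ^+ 2 by rewrite expr2 -{1}(mulr1 L) ler_wpM2l.
have L3 : L ^+ 2 <= L ^+ 3.
  by rewrite (exprSr L 2) -{1}(mulr1 (L ^+ 2)) ler_wpM2l ?sqr_ge0.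
set g := tau ^+ 2 + x + x ^+ 2 + y + y ^+ 2.
have x20 := sqr_ge0 x; have y20 := sqr_ge0 y; have t20 := sqr_ge0 tau.
have h1 : L * tau ^+ 2 + L * P <= L ^+ 3 * g.
  have hP' : P <= L ^+ 2 * (x + x ^+ 2 + y + y ^+ 2).
    apply: le_trans hP _; rewrite -subr_ge0.
    have -> : L ^+ 2 * (x + x ^+ 2 + y + y ^+ 2) - L / 2 * (x * (2 * L + x) + y * (2 * L + y)) =
      (L ^+ 2 - L / 2) * (x ^+ 2 + y ^+ 2) by field.
    by apply: mulr_ge0; [lra|exact: addr_ge0].
  have h2 : L * P <= L * (L ^+ 2 * (x + x ^+ 2 + y + y ^+ 2)) by rewrite ler_wpM2l.
  have h3 : L * tau ^+ 2 <= L ^+ 3 * tau ^+ 2 by rewrite ler_wpM2r//; lra.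
  have E3 : L ^+ 3 = L * L ^+ 2 by rewrite exprS.
  by rewrite /g E3 in h3 *; lra.
have Dd : 0 <= D + d by lra.
apply: le_trans (ler_wpM2r Dd h1) _.
have L30 : 0 <= L ^+ 3 by exact: exprn_ge0.
rewrite (mulrC 3) -(mulrA (L ^+ 3)) -(mulrA (L ^+ 3)).
apply: (ler_wpM2l L30).
have y4 : y ^+ 4 <= y ^+ 2.
  by rewrite -[4%N]/(2 + 2)%N exprD -{3}(mulr1 (y ^+ 2)) ler_wpM2l// expr_le1.
have := young_pair (tau ^+ 2) D d; have := young_pair x D d.
have := young_pair (x ^+ 2) D d; have := young_pair y D d; have := young_pair (y ^+ 2) D d.
rewrite -!exprM /g.
have := sqr_ge0 D; have := sqr_ge0 d; have := exprn_ge0 4 x0.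
have : 0 <= tau ^+ 4 by rewrite -[4%N]/(2 * 2)%N exprM sqr_ge0.
rewrite !mulrDl; lra.
Qed.

(** The new error [x] is at most tau: if x > y, the coercive term controls
   c (x^2 + x^4 / 2) / 2 up to multiples of y^2, and the factor tau <= c / (8 M) in
   front of the right-hand side lets it absorb every term in [x] and [D]. *)
Lemma one_step c M K tau x y D d Q S : 0 < c <= 1 -> 1 <= K -> 0 < tau ->
  tau * M <= c / 8 -> K * tau <= 1 -> tau <= 1 -> 24 * K ^+ 2 * tau ^+ 2 <= c ->
  0 <= x -> 0 <= y <= K * tau ^+ 2 -> 0 <= D -> 0 <= d <= K * tau ^+ 2 ->
  c * (1 + x ^+ 2) <= Q -> 0 <= S ->
  S = tau ^+ 4 + x ^+ 2 + x ^+ 4 + y ^+ 2 + D ^+ 2 + d ^+ 2 ->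
  D ^+ 2 + Q / 2 * x ^+ 2 <= d ^+ 2 + Q / 2 * y ^+ 2 + tau * (M * S) ->
  x <= tau.
Proof.
move=> /andP[c0 c1] K1 t0 tM Kt t1 Kc x0 /andP[y0 yK] D0 /andP[d0 dK] cQ S0 SE hE.
have t2 : K * tau ^+ 2 <= tau by rewrite expr2 mulrA -{3}(mul1r tau) ler_wpM2r// ltW.
have [xy|yx] := leP x y; first by apply: le_trans xy _; exact: le_trans yK t2.
have y1 : y <= 1 by lra.
have x20 := sqr_ge0 x; have y20 := sqr_ge0 y.
have xy2 : y ^+ 2 <= x ^+ 2 by rewrite lerXn2r// ltW.
have y21 : y ^+ 2 <= 1 by rewrite expr_le1.
have x4 : x ^+ 4 = x ^+ 2 * x ^+ 2 by rewrite -exprD.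
have h1 : c * (1 + x ^+ 2) / 2 * (x ^+ 2 - y ^+ 2) <= Q / 2 * (x ^+ 2 - y ^+ 2).
  by rewrite ler_wpM2r ?subr_ge0//; lra.
have h2 : c / 2 * (x ^+ 2 + x ^+ 4 / 2 - 2 * y ^+ 2) <=
    c * (1 + x ^+ 2) / 2 * (x ^+ 2 - y ^+ 2).
  have -> : c * (1 + x ^+ 2) / 2 * (x ^+ 2 - y ^+ 2) =
    c / 2 * ((1 + x ^+ 2) * (x ^+ 2 - y ^+ 2)) by field.
  apply: ler_wpM2l; first by lra.
  by rewrite x4; move: (x ^+ 2) (y ^+ 2) x20 y20 xy2 y21 => X Y; have := sqr_ge0 (X - Y); nra.
have h3 : tau * (M * S) <= c / 8 * S by rewrite mulrA ler_wpM2r.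
have h4 : c * x ^+ 2 <= 8 * (d ^+ 2 + y ^+ 2 + tau ^+ 4).
  have : 0 <= x ^+ 4 by rewrite x4 mulr_ge0.
  have : 0 <= tau ^+ 4 by rewrite exprn_ge0// ltW.
  move: h1 h2 h3 hE; rewrite SE; have := sqr_ge0 D; have := sqr_ge0 d.
  move: (x ^+ 4) (x ^+ 2) (y ^+ 2) (tau ^+ 4) (D ^+ 2) (d ^+ 2) x20 y20.
  move=> x4' X Y T4 D2 d2 X0 Y0 d20 D20 h1 h2 h3 hE T0 X4.
  have cD : c * D2 <= D2 by rewrite -{2}(mul1r D2) ler_wpM2r.
  have cd : c * d2 <= d2 by rewrite -{2}(mul1r d2) ler_wpM2r.
  have cY : c * Y <= Y by rewrite -{2}(mul1r Y) ler_wpM2r.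
  have cT : c * T4 <= T4 by rewrite -{2}(mul1r T4) ler_wpM2r.
  have cX4 : 0 <= c * x4' by rewrite mulr_ge0// ltW.
  have cX0 : 0 <= c * X by rewrite mulr_ge0// ltW.
  lra.
have h5 : c * x ^+ 2 <= c * tau ^+ 2.
  apply: le_trans h4 _.
  have dd : d ^+ 2 <= (K * tau ^+ 2) ^+ 2 by rewrite lerXn2r// nnegrE; lra.
  have yy : y ^+ 2 <= (K * tau ^+ 2) ^+ 2 by rewrite lerXn2r// nnegrE; lra.
  have K2 : 1 <= K ^+ 2 by rewrite exprn_ege1.
  have E1 : (K * tau ^+ 2) ^+ 2 = K ^+ 2 * tau ^+ 2 * tau ^+ 2 by ring.
  have E2 : tau ^+ 4 = 1 * tau ^+ 2 * tau ^+ 2 by ring.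
  have t20 := sqr_ge0 tau.
  have h6 : tau ^+ 4 <= K ^+ 2 * tau ^+ 2 * tau ^+ 2.
    by rewrite E2; do 2!apply: ler_wpM2r => //.
  have h7 : 24 * K ^+ 2 * tau ^+ 2 * tau ^+ 2 <= c * tau ^+ 2 by rewrite ler_wpM2r.
  lra.
by move: h5; rewrite ler_pM2l// ler_pXn2r// nnegrE// ltW.
Qed.

(** The implicit form, with the new value [q] on both sides; the bound C tau <= 1/4
   gives (1 + s) / (1 - s) <= 1 + 4 s for s = C tau. *)
Lemma gronwall_step C tau (p q : R) : 0 <= C -> 0 <= tau -> C * tau <= 4^-1 ->
  0 <= p -> q <= p + C * tau * (q + p) -> q <= (1 + 4 * C * tau) * p.
Proof.
move=> C0 t0 Ct p0 h; have s0 : 0 <= C * tau by rewrite mulr_ge0.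
rewrite -(mulrA 4 C); move: (C * tau) s0 Ct h => s s0 s4 h.
have h1 : (1 - s) * q <= (1 + s) * p by lra.
have s1 : 0 < 1 - s by lra.
have s2 : 1 + s <= (1 - s) * (1 + 4 * s) by nra.
by rewrite -(ler_pM2l s1); apply: le_trans h1 _; rewrite mulrA ler_wpM2r.
Qed.

Lemma nonneg_summands_le x y D d P Q : 0 <= x -> 0 <= y -> 0 <= D -> 0 <= d ->
  D + (x + y) <= P -> P + d <= Q -> [/\ x <= Q, y <= Q & D <= Q].
Proof. by move=> *; split; lra. Qed.

(** The quantities of one run of the scheme: [e k] and [d k] stand for the norms
   of the error gradient and of the error increment quotient, [s k] and [t k]
   for the gradient norms of the discrete and of the exact solution. *)
Record scheme_run (a b L tau : R) (n : nat) (al be e d s t : nat -> R) : Prop := SchemeRun {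
  run_par : [/\ 0 < a <= 1, 0 < b, 1 <= L & 0 < tau <= 1];
  run_al : forall k, (k <= n)%N -> a <= al k <= L;
  run_be : forall k, (k <= n)%N -> b <= be k <= L;
  run_dal : forall k, (k < n)%N -> `|al k.+1 - al k| <= L * tau;
  run_dbe : forall k, (k < n)%N -> `|be k.+1 - be k| <= L * tau;
  run_pos : forall k, (k <= n)%N -> [/\ 0 <= e k, 0 <= d k & 0 <= s k];
  run_t : forall k, (k <= n)%N -> 0 <= t k <= L;
  run_dt : forall k, (k < n)%N -> `|t k.+1 ^+ 2 - t k ^+ 2| <= L * tau;
  run_st : forall k, (k <= n)%N -> `|s k - t k| <= e k;
  run_e : forall k, (k <= n)%N -> e k <= s k + t k;
  run_e0 : e 0%N = 0;
  run_e1 : e 1%N <= L * tau ^+ 2;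
  run_d1 : d 1%N <= L * tau ^+ 2;
  run_energy : forall k, (0 < k < n)%N ->
    let Q r := al k + be k / 2 * (r k.+1 ^+ 2 + r k.-1 ^+ 2) in
    d k.+1 ^+ 2 + Q s / 2 * e k.+1 ^+ 2 <= d k ^+ 2 + Q s / 2 * e k.-1 ^+ 2 +
      tau * ((L * tau ^+ 2 + L * `|Q t - Q s|) * (d k.+1 + d k)) }.

(* [q] is the coefficient of the exact solution at one time, [Q s] and [Q t] are
  the averaged coefficients of the scheme, and [Psi] is the discrete energy. *)
Section Run.
Variables (a b L tau : R) (n : nat) (al be e d s t : nat -> R).
Hypothesis H : scheme_run a b L tau n al be e d s t.

Let q k := al k + be k * t k ^+ 2.
Let Q (r : nat -> R) k := al k + be k / 2 * (r k.+1 ^+ 2 + r k.-1 ^+ 2).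
Let Psi k := d k ^+ 2 + q k / 2 * (e k ^+ 2 + e k.-1 ^+ 2).

Lemma run_coefficient_gap k : (0 < k < n)%N ->
  `|Q t k - Q s k| <= L / 2 * (e k.+1 * (2 * L + e k.+1) + e k.-1 * (2 * L + e k.-1)).
Proof.
have [/andP[a0 a1] b0 L1 /andP[tau0 tau1]] := run_par H.
move=> /andP[k0 kn]; have kn' : (k.-1 <= n)%N by rewrite (leq_trans (leq_pred _))// ltnW.
have [_ _ s1] := run_pos H kn; have /andP[t10 t1] := run_t H kn.
have [_ _ s2] := run_pos H kn'; have /andP[t20 t2] := run_t H kn'.
have h1 := square_dist_bound s1 t10 t1 (run_st H kn).
have h2 := square_dist_bound s2 t20 t2 (run_st H kn').
have /andP[bk bL] := run_be H (ltnW kn).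
have -> : Q t k - Q s k = be k / 2 * - ((s k.+1 ^+ 2 - t k.+1 ^+ 2) + (s k.-1 ^+ 2 - t k.-1 ^+ 2)).
  by rewrite /Q; field.
have b20 : 0 <= be k / 2 by lra.
rewrite normrM normrN (ger0_norm b20).
apply: ler_pM; rewrite ?normr_ge0 //; try lra.
by apply: le_trans (ler_normD _ _) _; exact: lerD.
Qed.

Lemma run_q_lip k : (k < n)%N -> `|q k.+1 - q k| <= 3 * L ^+ 3 * tau.
Proof.
have [/andP[a0 a1] b0 L1 /andP[tau0 tau1]] := run_par H.
move=> kn; have h1 := run_dal H kn; have h2 := run_dbe H kn; have h3 := run_dt H kn.
have /andP[t10 t1] := run_t H kn; have /andP[bk bL] := run_be H (ltnW kn).
have -> : q k.+1 - q k = (al k.+1 - al k) + (be k.+1 - be k) * t k.+1 ^+ 2 +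
  be k * (t k.+1 ^+ 2 - t k ^+ 2) by rewrite /q; ring.
apply: le_trans (ler_normD _ _) _; apply: le_trans (lerD (ler_normD _ _) (lexx _)) _.
rewrite (normrM (be k.+1 - be k)) (normrM (be k)).
have L0 : 0 <= L by lra.
have t2 : `|t k.+1 ^+ 2| <= L ^+ 2.
  by rewrite ger0_norm ?sqr_ge0// lerXn2r// nnegrE.
have h4 : `|be k.+1 - be k| * `|t k.+1 ^+ 2| <= L * tau * L ^+ 2 by exact: ler_pM.
have h5 : `|be k| * `|t k.+1 ^+ 2 - t k ^+ 2| <= L * (L * tau).
  by apply: ler_pM => //; rewrite ger0_norm//; lra.
have L2 : L <= L ^+ 2 by rewrite expr2 -{1}(mulr1 L) ler_wpM2l.
have E3 : L ^+ 3 = L * L ^+ 2 by rewrite exprS.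
have L3 : L ^+ 2 <= L ^+ 3 by rewrite E3 -{1}(mul1r (L ^+ 2)) ler_wpM2r ?sqr_ge0.
have h6 : L * tau <= L ^+ 3 * tau by apply: ler_wpM2r; [exact: ltW|lra].
have h7 : L ^+ 2 * tau <= L ^+ 3 * tau by apply: ler_wpM2r; [exact: ltW|lra].
by lra.
Qed.

Lemma run_exact_average k : (0 < k < n)%N -> `|Q t k - q k| <= L ^+ 2 * tau.
Proof.
have [/andP[a0 a1] b0 L1 /andP[tau0 tau1]] := run_par H.
move=> /andP[k0 kn]; have h3 := run_dt H kn.
have kn' : (k.-1 < n)%N by rewrite (leq_ltn_trans (leq_pred _)).
have := run_dt H kn'; rewrite prednK// => h4.
have /andP[bk bL] := run_be H (ltnW kn).
have -> : Q t k - q k = be k / 2 * ((t k.+1 ^+ 2 - t k ^+ 2) - (t k ^+ 2 - t k.-1 ^+ 2)).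
  by rewrite /Q /q; field.
have b20 : 0 <= be k / 2 by lra.
rewrite normrM (ger0_norm b20).
have -> : L ^+ 2 * tau = L / 2 * (L * tau + L * tau) by field.
apply: ler_pM; rewrite ?normr_ge0 //; try lra.
by apply: le_trans (ler_normB _ _) _; exact: lerD.
Qed.

Lemma run_scheme_average k : (0 < k < n)%N -> e k.+1 <= tau -> e k.-1 <= tau ->
  `|Q s k - q k| <= 4 * L ^+ 3 * tau.
Proof.
have [/andP[a0 a1] b0 L1 /andP[tau0 tau1]] := run_par H.
move=> kn e1 e2; have h1 := run_coefficient_gap kn; have h2 := run_exact_average kn.
have /andP[k0 kn1] := kn; have kn' : (k.-1 <= n)%N by rewrite (leq_trans (leq_pred _))// ltnW.
have [e10 _ _] := run_pos H kn1; have [e20 _ _] := run_pos H kn'.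
have L0 : 0 <= L by lra.
have L2 : L <= L ^+ 2 by rewrite expr2 -{1}(mulr1 L) ler_wpM2l.
have L3 : L ^+ 2 <= L ^+ 3 by rewrite [L ^+ 3]exprS -{1}(mul1r (L ^+ 2)) ler_wpM2r ?sqr_ge0.
have g x : 0 <= x -> x <= tau -> x * (2 * L + x) <= tau * (3 * L).
  by move=> x0 xt; apply: ler_pM => //; lra.
have h3 : L / 2 * (e k.+1 * (2 * L + e k.+1) + e k.-1 * (2 * L + e k.-1)) <=
    L / 2 * (tau * (3 * L) + tau * (3 * L)).
  by apply: ler_wpM2l; [lra|apply: lerD; exact: g].
have h4 : L ^+ 2 * tau <= L ^+ 3 * tau by rewrite ler_wpM2r// ltW.
have E : L / 2 * (tau * (3 * L) + tau * (3 * L)) = 3 * (L ^+ 2 * tau) by field.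
have -> : Q s k - q k = (Q t k - q k) - (Q t k - Q s k) by ring.
apply: le_trans (ler_normB _ _) _; lra.
Qed.

Lemma run_q_pos k : (k <= n)%N -> a <= q k <= 2 * L ^+ 3.
Proof.
have [/andP[a0 a1] b0 L1 /andP[tau0 tau1]] := run_par H.
move=> kn; have /andP[aa aL] := run_al H kn; have /andP[bb bL] := run_be H kn.
have /andP[t0 tL] := run_t H kn.
have t2 : 0 <= t k ^+ 2 <= L ^+ 2 by rewrite sqr_ge0 lerXn2r// nnegrE; lra.
move: t2 => /andP[t20 t2].
have E3 : L ^+ 3 = L * L ^+ 2 by rewrite exprS.
have L2 : 1 <= L ^+ 2 by rewrite exprn_ege1.
have L3 : L <= L ^+ 3 by rewrite E3 -{1}(mulr1 L) ler_wpM2l//; lra.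
have h1 : 0 <= be k * t k ^+ 2 by rewrite mulr_ge0//; lra.
have h2 : be k * t k ^+ 2 <= L ^+ 3 by rewrite E3; apply: ler_pM => //; lra.
by rewrite /q; apply/andP; split; lra.
Qed.

Lemma Psi_bounds k : (k <= n)%N -> 0 <= Psi k /\
  d k ^+ 2 + a / 2 * (e k ^+ 2 + e k.-1 ^+ 2) <= Psi k.
Proof.
have [/andP[a0 a1] b0 L1 /andP[tau0 tau1]] := run_par H.
move=> kn; have /andP[aq qL] := run_q_pos kn; rewrite /Psi.
have := sqr_ge0 (e k); have := sqr_ge0 (e k.-1); have := sqr_ge0 (d k).
move: (e k ^+ 2) (e k.-1 ^+ 2) => X Y d20 Y0 X0.
have h : a / 2 * (X + Y) <= q k / 2 * (X + Y) by apply: ler_wpM2r; lra.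
have h0 : 0 <= a / 2 * (X + Y) by apply: mulr_ge0; lra.
by split; lra.
Qed.

Lemma energy_controls_error B K k : (0 < k <= n)%N -> 0 <= K -> B <= K ^+ 2 ->
  2 * B / a <= K ^+ 2 -> Psi k + tau ^+ 4 <= B * tau ^+ 4 ->
  [/\ e k <= K * tau ^+ 2, e k.-1 <= K * tau ^+ 2 & d k <= K * tau ^+ 2].
Proof.
have [/andP[a0 a1] b0 L1 /andP[tau0 tau1]] := run_par H.
move=> /andP[k0 kn] K0 KB1 KB2 hPhi.
have [_ hP] := Psi_bounds kn.
have kn' : (k.-1 <= n)%N by rewrite (leq_trans (leq_pred _)).
have [ek dk _] := run_pos H kn; have [ek' _ _] := run_pos H kn'.
have T40 : 0 <= tau ^+ 4 by rewrite exprn_ge0// ltW.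
have E4 : (K * tau ^+ 2) ^+ 2 = K ^+ 2 * tau ^+ 4 by ring.
have Kt0 : 0 <= K * tau ^+ 2 by rewrite mulr_ge0 ?sqr_ge0.
have a20 : 0 < a / 2 by rewrite divr_gt0.
have sq x : 0 <= x -> a / 2 * x ^+ 2 <= B * tau ^+ 4 -> x <= K * tau ^+ 2.
  move=> x0 hx; rewrite -(@ler_pXn2r _ 2) ?nnegrE// E4.
  apply: (@le_trans _ _ (2 * B / a * tau ^+ 4)); last by rewrite ler_wpM2r.
  rewrite -(ler_pM2l a20); apply: le_trans hx _.
  by rewrite le_eqVlt; apply/orP; left; apply/eqP; field; rewrite gt_eqF.
have sqd : d k ^+ 2 <= B * tau ^+ 4 -> d k <= K * tau ^+ 2.
  move=> hd; rewrite -(@ler_pXn2r _ 2) ?nnegrE// E4.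
  by apply: le_trans hd _; rewrite ler_wpM2r.
have aX := mulr_ge0 (ltW a20) (sqr_ge0 (e k)).
have aY := mulr_ge0 (ltW a20) (sqr_ge0 (e k.-1)).
have D0 := sqr_ge0 (d k); rewrite mulrDr in hP.
by have [/(sq _ ek) ? /(sq _ ek') ? /sqd ?] := nonneg_summands_le aX aY D0 T40 hP hPhi.
Qed.

(** Replacing [Q s] by [q (k+1)] on the left and by [q k] on the right makes the
   energy telescope. It costs O(tau) times the energy as soon as the errors are at
   most tau, since then [Q s] and [q] differ by O(tau). *)
Lemma energy_step k : (0 < k < n)%N -> e k.+1 <= tau -> e k.-1 <= tau ->
  Psi k.+1 <= Psi k + 20 * L ^+ 3 / a * tau * (Psi k.+1 + Psi k + tau ^+ 4).
Proof.
have [/andP[a0 a1] b0 L1 /andP[tau0 tau1]] := run_par H.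
move=> kn e1 e2; have hE := run_energy H kn; have /andP[k0 kn1] := kn.
have kn' : (k.-1 <= n)%N by rewrite (leq_trans (leq_pred _))// ltnW.
have [e10 d10 _] := run_pos H kn1; have [e20 _ _] := run_pos H kn'.
have [_ d0 _] := run_pos H (ltnW kn1).
have y1 : 0 <= e k.-1 <= 1 by rewrite e20; lra.
have hR := residual_bound tau L1 e10 y1 d10 d0 (run_coefficient_gap kn).
have hQ := run_scheme_average kn e1 e2; have hq := run_q_lip kn1.
have [P10 P1] := Psi_bounds kn1; have [P0 P] := Psi_bounds (ltnW kn1).
have x4 : e k.+1 ^+ 4 <= e k.+1 ^+ 2.
  rewrite -[4%N]/(2 + 2)%N exprD -{3}(mulr1 (e k.+1 ^+ 2)) ler_wpM2l ?sqr_ge0//.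
  by rewrite expr_le1//; lra.
move: hE hR x4; rewrite /= -/(Q s k) -/(Q t k) => hE hR x4.
have := sqr_ge0 (e k.+1); have := sqr_ge0 (e k); have := sqr_ge0 (e k.-1).
have T40 : 0 <= tau ^+ 4 by rewrite exprn_ge0// ltW.
have D0 := sqr_ge0 (d k.+1); have d20 := sqr_ge0 (d k).
have M0 : 1 <= L ^+ 3 by rewrite exprn_ege1.
move: P10 P1 P0 P; rewrite /Psi /=.
have {}hE := le_trans hE (lerD (lexx _) (ler_wpM2l (ltW tau0) hR)).
move: hE x4 hQ hq M0 T40 D0 d20.
move: (e k.+1 ^+ 4) (e k.+1 ^+ 2) (e k ^+ 2) (e k.-1 ^+ 2) (tau ^+ 4) (d k.+1 ^+ 2) (d k ^+ 2).
move: (Q s k) (q k.+1) (q k) (L ^+ 3).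
move=> Qs q1 q0 M X4 X E Y T4 D2 d2 hE x4 hQ hq M1 T40 D0 d0' P10 P1 P0 P Y0 E0 X0.
have M0 : 0 <= M by lra.
have hS : tau * (3 * M * (T4 + X + X4 + Y + D2 + d2)) <=
    tau * (3 * M * (T4 + 2 * X + Y + D2 + d2)).
  by apply: ler_wpM2l; [exact: ltW|apply: ler_wpM2l; lra].
have Q1 : q1 - Qs <= 7 * M * tau.
  by move: hQ hq; rewrite !ler_norml => /andP[? ?] /andP[? ?]; lra.
have Q0 : Qs - q0 <= 7 * M * tau.
  have : 0 <= M * tau by rewrite mulr_ge0// ltW.
  by move: hQ; rewrite !ler_norml => /andP[? ?]; lra.
have h1 : (q1 - Qs) * (X + E) <= 7 * M * tau * (X + E) by apply: ler_wpM2r; lra.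
have h2 : (Qs - q0) * (E + Y) <= 7 * M * tau * (E + Y) by apply: ler_wpM2r; lra.
set P1' := D2 + q1 / 2 * (X + E) in P1 P10 *.
set P0' := d2 + q0 / 2 * (E + Y) in P P0 *.
have main : P1' <= P0' + M * tau * (7 / 2 * (X + E) + 7 / 2 * (E + Y) +
    3 * (T4 + 2 * X + Y + D2 + d2)).
  by rewrite /P1' /P0'; lra.
clearbody P1' P0'; apply: le_trans main _; rewrite lerD2l.
have -> : 20 * M / a * tau * (P1' + P0' + T4) = M * tau * (20 / a * (P1' + P0' + T4)).
  by field; rewrite gt_eqF.
apply: ler_wpM2l; first by rewrite mulr_ge0// ltW.
rewrite -(ler_pM2l a0).
have -> : a * (20 / a * (P1' + P0' + T4)) = 20 * (P1' + P0' + T4).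
  by field; rewrite gt_eqF.
have aD : a * D2 <= D2 by rewrite -{2}(mul1r D2) ler_wpM2r.
have ad : a * d2 <= d2 by rewrite -{2}(mul1r d2) ler_wpM2r.
have aT : a * T4 <= T4 by rewrite -{2}(mul1r T4) ler_wpM2r.
have aX : 0 <= a * X by rewrite mulr_ge0// ltW.
have aY : 0 <= a * Y by rewrite mulr_ge0// ltW.
have aE : 0 <= a * E by rewrite mulr_ge0// ltW.
lra.
Qed.

End Run.

(** Induction on the Gronwall bound for [Psi k + tau^4]: it implies that the errors at
   step k are at most K tau^2, [one_step] then bounds the next error by tau, and
   [energy_step] restores the Gronwall bound. The threshold on tau collects the
   smallness conditions of [one_step] and [gronwall_step], [K] being fixed beforehand. *)
Lemma bootstrap (a b L T : R) : 0 < a -> a <= 1 -> 0 < b -> 1 <= L -> 0 < T ->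
  exists2 K, 0 < K & exists2 tau0, 0 < tau0 &
  forall (tau : R) (n : nat) (al be e d s t : nat -> R),
    tau <= tau0 -> n%:R * tau <= T ->
    scheme_run a b L tau n al be e d s t ->
    forall k, (0 < k <= n)%N -> e k <= K * tau ^+ 2 /\ d k <= K * tau ^+ 2.
Proof.
move=> a0 a1 b0 L1 T0.
have [c c01 hc] := coefficient_coercive a0 b0 L1.
have /andP[c0 c1] := c01.
have L30 : 1 <= L ^+ 3 by rewrite exprn_ege1.
pose C := 20 * L ^+ 3 / a.
have C0 : 0 < C by rewrite divr_gt0// mulr_gt0//; lra.
pose B := expR (4 * C * T) * (L ^+ 2 + L ^+ 3 * L ^+ 2 + 1).
have L20 := sqr_ge0 L.
have B0 : 0 < B.
  have := mulr_ge0 (le_trans ler01 L30) L20 => ?.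
  by apply: mulr_gt0; [exact: expR_gt0|lra].
have Ba0 : 0 <= 2 * B / a by apply: divr_ge0; [apply: mulr_ge0; lra|exact: ltW].
pose K := 1 + B + 2 * B / a.
have K1 : 1 <= K.
  by rewrite /K; lra.
have KB : B <= K ^+ 2 /\ 2 * B / a <= K ^+ 2.
  have KK : K <= K ^+ 2 by rewrite expr2 -{1}(mulr1 K) ler_wpM2l//; lra.
  by rewrite /K in KK *; split; lra.
exists K; first by lra.
pose t1 := c / (24 * K ^+ 2).
pose t2 := c / (8 * (3 * L ^+ 3)).
pose t3 := (4 * C)^-1.
have K20 : 1 <= K ^+ 2 by rewrite exprn_ege1.
have t10 : 0 < t1 by rewrite divr_gt0// mulr_gt0//; lra.
have t20 : 0 < t2 by rewrite divr_gt0// mulr_gt0//; lra.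
have t30 : 0 < t3 by rewrite invr_gt0 mulr_gt0.
have Ki0 : 0 < K^-1 by rewrite invr_gt0; lra.
exists (Num.min t1 (Num.min t2 (Num.min t3 K^-1))); first by rewrite !lt_min t10 t20 t30.
move=> tau n al be e d s t; rewrite !le_min => /and4P[h1 h2 h3 h4] nT H.
have [_ _ _ /andP[tau0 _]] := run_par H.
have tau1 : tau <= 1 by apply: le_trans h4 _; rewrite invf_le1//; lra.
have Kt : K * tau <= 1 by rewrite mulrC -ler_pdivlMr ?mul1r//; lra.
have Kc : 24 * K ^+ 2 * tau ^+ 2 <= c.
  have : 24 * K ^+ 2 * tau <= c.
    by rewrite mulrC -ler_pdivlMr// mulr_gt0//; lra.
  have : 24 * K ^+ 2 * tau ^+ 2 <= 24 * K ^+ 2 * tau.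
    by apply: ler_wpM2l; [rewrite mulr_ge0//; lra|rewrite expr2 -{3}(mul1r tau) ler_wpM2r// ltW].
  lra.
have tM : tau * (3 * L ^+ 3) <= c / 8.
  have -> : c / 8 = t2 * (3 * L ^+ 3) by rewrite /t2; field; rewrite gt_eqF//; lra.
  by apply: ler_wpM2r => //; lra.
have tC : C * tau <= 4^-1.
  have -> : 4^-1 = C * t3 by rewrite /t3; field; rewrite gt_eqF.
  by apply: ler_wpM2l => //; exact: ltW.
have Ct0 : 0 <= C * tau by apply: mulr_ge0; exact: ltW.
pose q k := al k + be k * t k ^+ 2.
pose Psi k := d k ^+ 2 + q k / 2 * (e k ^+ 2 + e k.-1 ^+ 2).
pose Phi k := Psi k + tau ^+ 4.
have T40 : 0 <= tau ^+ 4 by rewrite exprn_ge0// ltW.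
have small k (hk : (0 < k <= n)%N) : Phi k <= B * tau ^+ 4 ->
    [/\ e k <= K * tau ^+ 2, e k.-1 <= K * tau ^+ 2 & d k <= K * tau ^+ 2].
  exact (energy_controls_error H hk (le_trans ler01 K1) KB.1 KB.2).
have growth k : (k < n)%N -> Phi k.+1 <= expR (4 * C * (k%:R * tau)) *
    ((L ^+ 2 + L ^+ 3 * L ^+ 2 + 1) * tau ^+ 4) -> Phi k.+1 <= B * tau ^+ 4.
  move=> kn h; apply: le_trans h _.
  rewrite /B -(mulrA (expR _) (_ + 1)); apply: ler_wpM2r.
    by apply: mulr_ge0 => //; have := mulr_ge0 (le_trans ler01 L30) L20; lra.
  rewrite ler_expR ler_wpM2l//; first by rewrite mulr_ge0// ltW.
  by apply: le_trans nT; rewrite ler_wpM2r ?(ltW tau0)// ler_nat ltnW.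
have ind k : (k < n)%N -> Phi k.+1 <= expR (4 * C * (k%:R * tau)) *
    ((L ^+ 2 + L ^+ 3 * L ^+ 2 + 1) * tau ^+ 4).
  elim: k => [n0|k IH kn].
    rewrite mul0r mulr0 expR0 mul1r /Phi /Psi /= (run_e0 H) expr0n addr0.
    have [e10 d10 _] := run_pos H n0.
    have hd : d 1%N ^+ 2 <= (L * tau ^+ 2) ^+ 2.
      by rewrite lerXn2r ?nnegrE ?(run_d1 H)// (le_trans d10 (run_d1 H)).
    have he : e 1%N ^+ 2 <= (L * tau ^+ 2) ^+ 2.
      by rewrite lerXn2r ?nnegrE ?(run_e1 H)// (le_trans e10 (run_e1 H)).
    have E4 : (L * tau ^+ 2) ^+ 2 = L ^+ 2 * tau ^+ 4 by ring.
    have /andP[q0 qL] := run_q_pos H n0; rewrite -/(q 1%N) in q0 qL.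
    have hq : q 1%N / 2 * e 1%N ^+ 2 <= L ^+ 3 * (L ^+ 2 * tau ^+ 4).
      by rewrite -E4; apply: ler_pM; rewrite ?sqr_ge0//; lra.
    lra.
  have kn1 := ltnW kn; have hPhi := IH kn1.
  have [ek ek' dk] := small k.+1 kn1 (growth k kn1 hPhi).
  have kk : (0 < k.+1 < n)%N by [].
  have kn' : (k <= n)%N by rewrite ltnW.
  have [e2 d2 s2] := run_pos H kn; have [e1 d1 _] := run_pos H kn1.
  have [e0 _ _] := run_pos H kn'.
  have t2' : K * tau ^+ 2 <= tau.
    by rewrite expr2 mulrA -{3}(mul1r tau) ler_wpM2r// ltW.
  have y1 : 0 <= e k <= 1 by rewrite e0 /=; move: ek' => /=; lra.
  have hR := residual_bound tau L1 e2 y1 d2 d1 (run_coefficient_gap H kk).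
  have hx : e k.+2 <= tau.
    have /andP[aa aL] := run_al H kn1; have /andP[bb bL] := run_be H kn1.
    have cQ := hc _ _ _ _ (s k) _ aa bb s2 (run_t H kn) e2 (run_e H kn).
    apply: (one_step (M := 3 * L ^+ 3) (D := d k.+2) (y := e k) (d := d k.+1) c01 K1 tau0 tM Kt tau1 Kc e2 _ d2 _ cQ _ erefl).
    + by rewrite e0.
    + by rewrite d1.
    + by rewrite !addr_ge0 ?sqr_ge0 ?exprn_ge0// ltW.
    + by apply: le_trans (run_energy H kk) _; rewrite lerD2l ler_wpM2l// ltW.
  have hy : e k <= tau by apply: le_trans ek' _.
  have := energy_step H kk hx hy.
  rewrite -/(q k.+2) -/(q k.+1) -/(Psi k.+2) -/(Psi k.+1) -/C => hen.
  have [P1 _] := Psi_bounds H kn1; rewrite -/(q k.+1) -/(Psi k.+1) in P1.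
  have Phi0 : 0 <= Phi k.+1 by rewrite addr_ge0.
  have gs : Phi k.+2 <= (1 + 4 * C * tau) * Phi k.+1.
    apply: gronwall_step => //; [exact: ltW|exact: ltW|].
    have := mulr_ge0 Ct0 T40.
    rewrite /Phi; lra.
  apply: le_trans gs _.
  have -> : 4 * C * (k.+1%:R * tau) = 4 * C * tau + 4 * C * (k%:R * tau).
    by rewrite -natr1; ring.
  rewrite expRD -(mulrA (expR (4 * C * tau))); apply: ler_pM => //.
  - by rewrite addr_ge0// -mulrA mulr_ge0.
  - exact: expR_ge1Dx.
move=> [//|k] /andP[_ kn].
by have [] := small k.+1 kn (growth k kn (ind k kn)).
Qed.

End Bootstrap.

(** * The norm of the square root of the operator *)
Section Spectral.
Variable R : realType.
Local Notation plane := (R * R)%type.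
Implicit Types (f g h u v w : plane -> R).
Variable Om : set plane.
Hypotheses (oOm : open Om) (bOm : bounded_set Om).
Let mOm := open_measurable2 oOm.
Let H := L2_pre_hilbert mOm.
Let HG := H1_pre_hilbert oOm bOm.
Local Notation ip := (@L2ip R Om).

Lemma friedrichs_L2 u g : friedrichs Om u g -> [/\ H1 Om u, L2 Om u & L2 Om g].
Proof. by move=> [[Hu _] Lg _]; split=> //; case: Hu. Qed.

Lemma friedrichs_sym u g v h : friedrichs Om u g -> friedrichs Om v h ->
  ip g v = ip u h.
Proof.
move=> [Hu Lg ug] [Hv Lh vh].
by rewrite -ug// (phC HG) vh// (phC H).
Qed.

(** Expand [u] on the basis and use the continuity of the scalar product. *)
Lemma parseval lam phi u v : eigenbasis Om lam phi -> L2 Om u -> L2 Om v ->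
  \sum_(0 <= j < N) ip u (phi j) * ip (phi j) v @[N --> \oo] --> ip u v.
Proof.
move=> [_ efr _ bas] Lu Lv.
have Lphi j : L2 Om (phi j) by case: (friedrichs_L2 (efr j)).
pose P N : plane -> R := fun p => \sum_(0 <= j < N) ip u (phi j) * phi j p.
have PS N : P N.+1 = P N + ip u (phi N) *: phi N.
  by apply/funext => p; rewrite /P big_nat_recr.
have LP N : L2 Om (P N).
  elim: N => [|N IH]; last by rewrite PS; apply: (phD H) => //; exact: (phZ H).
  rewrite (_ : P 0%N = 0); first exact: (ph0 H).
  by apply/funext => p; rewrite /P big_geq.
have PE N : ip (P N) v = \sum_(0 <= j < N) ip u (phi j) * ip (phi j) v.
  elim: N => [|N IH].
    rewrite big_geq// (_ : P 0%N = 0 *: phi 0%N); first by rewrite (phZl H)// mul0r.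
    by rewrite scale0r; apply/funext => p; rewrite /P big_geq.
  by rewrite PS (phDl H)// ?(phZl H)// ?IH ?big_nat_recr//; exact: (phZ H).
have c : pnorm ip (P N - u) @[N --> \oo] --> (0 : R).
  have := bas u Lu; apply: cvg_trans; apply: near_eq_cvg; apply: nearW => N.
  have -> : L2norm Om (fun p => u p - P N p) = pnorm ip (u - P N).
    by apply: L2norm_pnorm => //; exact: (phB H).
  by rewrite -(pnormN H (phB H Lu (LP N))) opprB.
have := @ip_cvg_gen R _ _ _ H P u v LP Lu Lv c.
by apply: cvg_trans; apply: near_eq_cvg; apply: nearW => N; rewrite PE.
Qed.

(** Both sides are sums over the eigenbasis: the coefficients of [w] are those of [u]
   multiplied by the square roots of the eigenvalues, and (g, u) is the sum of the
   eigenvalues times the squared coefficients of [u]. *)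
Lemma half_power_norm u g w : friedrichs Om u g -> L_pow Om 2^-1 u w ->
  L2norm Om w = grad_norm Om u.
Proof.
move=> ug [Lu Lw [lam [phi [eb hw]]]].
have [lam0 efr _ _] := eb; have [_ _ Lg] := friedrichs_L2 ug.
have [Hu _ ugE] := ug.
rewrite (L2norm_pnorm Lw) /grad_norm (ugE u Hu) /pnorm; congr Num.sqrt.
apply: (cvg_unique _ (parseval eb Lw Lw)) => //.
have := parseval eb Lg Lu.
apply: cvg_trans; apply: near_eq_cvg; apply: nearW => N.
apply: eq_big_nat => j _; rewrite (phC H (phi j) w) (phC H (phi j) u) hw.
rewrite (friedrichs_sym ug (efr j)) powR12_sqrt ?(ltW (lam0 j))//.
have -> : ip u (fun p => lam j * phi j p) = lam j * ip u (phi j).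
  by rewrite -(phZr H (lam j)) //; case: (friedrichs_L2 (efr j)).
rewrite -[in LHS](sqr_sqrtr (ltW (lam0 j))); ring.
Qed.

End Spectral.

(** * The energy inequality and uniqueness of time derivatives *)
Section AbstractEnergy.
Variables (R : realType) (V : lmodType R) (S : V -> Prop) (ip : V -> V -> R).
Hypothesis H : pre_hilbert S ip.
Local Notation nm := (pnorm ip).

Lemma norm_sq_dist x y : S x -> S y ->
  `|nm x ^+ 2 - nm y ^+ 2| <= nm (x - y) * (nm x + nm y).
Proof.
move=> Sx Sy; have := pnorm_dist H Sx Sy.
have := pnorm_ge0 ip x; have := pnorm_ge0 ip y => y0 x0 h.
have -> : nm x ^+ 2 - nm y ^+ 2 = (nm x - nm y) * (nm x + nm y) by ring.
by rewrite normrM (ger0_norm (addr_ge0 x0 y0)) ler_wpM2r// addr_ge0.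
Qed.

Lemma norm_sq_second_diff x y z A B C : S x -> S y -> S z ->
  nm (x - z) <= A -> nm (y - z) <= A -> nm z <= B -> nm (x + y - 2 *: z) <= C ->
  `|nm x ^+ 2 + nm y ^+ 2 - 2 * nm z ^+ 2| <= 2 * A ^+ 2 + 2 * (B * C).
Proof.
move=> Sx Sy Sz h1 h2 h3 h4.
have S1 := phB H Sx Sz; have S2 := phB H Sy Sz; have Sxy := phD H Sx Sy.
have S3 : S (x + y - 2 *: z) by apply: (phB H) => //; exact: (phZ H).
have -> : nm x ^+ 2 + nm y ^+ 2 - 2 * nm z ^+ 2 =
  nm (x - z) ^+ 2 + nm (y - z) ^+ 2 + 2 * ip z (x + y - 2 *: z).
  rewrite !(pnorm_sq H)// !(phBl H, phBr H)// ?(phZr H)// ?(phDr H)//; last exact: (phZ H).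
  rewrite (phC H x z) (phC H y z); ring.
have q w : S w -> nm w <= A -> nm w ^+ 2 <= A ^+ 2.
  by move=> Sw hw; rewrite lerXn2r// nnegrE ?pnorm_ge0// (le_trans _ hw)// pnorm_ge0.
have hc : `|ip z (x + y - 2 *: z)| <= B * C.
  apply: le_trans (cauchy_schwarz H Sz S3) _.
  by apply: ler_pM => //; exact: pnorm_ge0.
apply: le_trans (ler_normD _ _) _; apply: lerD.
  rewrite ger0_norm ?addr_ge0 ?sqr_ge0//.
  have := q _ S1 h1; have := q _ S2 h2; lra.
by rewrite normrM ger0_norm// ler_wpM2l.
Qed.

(** With D and d the new and old increment quotients, zp - zm = tau (D + d) and the
   second difference quotient is (D - d) / tau, so their scalar product is
   |D|^2 - |d|^2. *)
Lemma energy_inequality (zp z zm g w : V) (tau Q G : R) : 0 < tau ->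
  S zp -> S z -> S zm -> S g -> S w ->
  ip (tau ^- 2 *: (zp - 2 *: z + zm) + (Q / 2) *: g) (zp - zm) = ip w (zp - zm) ->
  ip g (zp - zm) = G ->
  nm (tau^-1 *: (zp - z)) ^+ 2 + Q / 2 * G <= nm (tau^-1 *: (z - zm)) ^+ 2 +
    tau * (nm w * (nm (tau^-1 *: (zp - z)) + nm (tau^-1 *: (z - zm)))).
Proof.
move=> t0 Sp Sz Sm Sg Sw; have tn : tau != 0 by rewrite gt_eqF.
pose D := tau^-1 *: (zp - z); pose d := tau^-1 *: (z - zm).
have SD : S D by apply: (phZ H); exact: (phB H).
have Sd : S d by apply: (phZ H); exact: (phB H).
have SDd := phD H SD Sd; have SDB := phB H SD Sd.
have -> : zp - zm = tau *: (D + d).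
  rewrite /D /d -scalerDr scalerA mulfV// scale1r addrA subrK.
  by [].
have -> : tau ^- 2 *: (zp - 2 *: z + zm) = tau^-1 *: (D - d).
  rewrite /D /d -scalerBr scalerA -expr2 exprVn; congr (_ *: _).
  by rewrite opprB scaler_nat mulr2n opprD !addrA [LHS](ACl (1*2*4*3))%AC.
rewrite !(phZr H)//; last by apply: (phD H); exact: (phZ H).
rewrite (phDl H) ?(phZl H) ?(phDr H) ?(phBl H)//; try exact: (phZ H).
rewrite (phC H d D) => hE hG.
have hw : ip w D + ip w d <= nm w * (nm D + nm d).
  rewrite mulrDr; apply: lerD; exact: (ip_le_pnorm H).
have hw' : tau * (ip w D + ip w d) <= tau * (nm w * (nm D + nm d)).
  by rewrite ler_wpM2l// ltW.
rewrite !(pnorm_sq H)//; rewrite -/D -/d.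
have e1 : ip D D - ip d d + Q / 2 * G = tau * (ip w D + ip w d).
  rewrite -hG -hE; field.
  by [].
lra.
Qed.

Variables (T : R) (T0 : 0 < T).
Implicit Types F G : R -> V.

(** The quotient is tested at points on whichever side of [t] has room in [0, T]. *)
Lemma real_deriv_zero phi psi : real_deriv T phi psi ->
  (forall t, 0 <= t <= T -> phi t = 0) -> forall t, 0 <= t <= T -> psi t = 0.
Proof.
move=> h phi0 t tT; apply/eqP; rewrite -normr_le0; apply/ler_addgt0Pl => e e0.
rewrite addr0; have [d d0 dP] := h t tT e e0.
have [s sT [sd st]] : exists2 s, 0 <= s <= T & `|s - t| < d /\ s != t.
  move: tT => /andP[t0 tT].
  pose m := Num.min (d / 2) (T / 2).
  have m0 : 0 < m by rewrite lt_min !divr_gt0.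
  have md : m <= d / 2 by rewrite ge_min lexx.
  have mT : m <= T / 2 by rewrite ge_min lexx orbT.
  have [tm|tm] := leP t (T / 2).
    exists (t + m); first by apply/andP; split; lra.
    rewrite (addrC t m) addrK gtr0_norm//; split; first lra.
    by rewrite -subr_eq0 addrK gt_eqF.
  exists (t - m); first by apply/andP; split; lra.
  rewrite addrAC subrr sub0r normrN gtr0_norm//; split; first lra.
  by rewrite -subr_eq0 addrAC subrr sub0r oppr_eq0 gt_eqF.
have := dP s sT sd; rewrite !phi0// subrr sub0r normrN normrM mulrC.
by rewrite ler_pM2r// normr_gt0 subr_eq0.
Qed.

Lemma vec_deriv_zero F G : vec_deriv S ip T F G ->
  (forall t, 0 <= t <= T -> nm (F t) = 0) -> forall t, 0 <= t <= T -> nm (G t) = 0.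
Proof.
move=> FG F0 t tT; have SG := vdG FG tT.
have := real_deriv_zero (vec_deriv_ip H FG SG) _ tT => h.
rewrite /pnorm h ?sqrtr0// => s sT; apply/eqP; rewrite -normr_le0.
by apply: le_trans (cauchy_schwarz H (vdF FG sT) SG) _; rewrite F0// mul0r.
Qed.

Lemma vec_deriv_bounded F : (forall t, 0 <= t <= T -> S (F t)) ->
  (forall t, 0 <= t <= T -> forall e, 0 < e -> exists2 d, 0 < d &
     forall s, 0 <= s <= T -> `|s - t| < d -> nm (F s - F t) <= e) ->
  exists2 K, 0 < K & forall t, 0 <= t <= T -> nm (F t) <= K.
Proof.
move=> SF cF; have [|K K0 hK] := @continuous_bounded R T (fun t => nm (F t)) (ltW T0).
  apply/subspace_continuousP => t /=; rewrite in_itv /= => tT.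
  apply/cvgrPdist_le => e e0; rewrite near_withinE; apply/nbhs_ballP.
  have [d d0 dP] := cF t tT e e0; exists d => // s; rewrite /ball /= distrC => sd.
  rewrite in_itv /= => sT; rewrite distrC.
  by apply: le_trans (pnorm_dist H (SF s sT) (SF t tT)) _; exact: dP.
by exists K => // t tT; have := hK t tT; rewrite ger0_norm// pnorm_ge0.
Qed.

End AbstractEnergy.

Section L2Time.
Variable R : realType.
Local Notation plane := (R * R)%type.
Variable Om : set plane.
Hypotheses (oOm : open Om) (bOm : bounded_set Om).
Let mOm := open_measurable2 oOm.
Let H := L2_pre_hilbert mOm.
Local Notation ip := (@L2ip R Om).
Variables (T : R) (T0 : 0 < T).
Implicit Types F G : R -> plane -> R.

Lemma L2_C1_vec_deriv F G : L2_C1 Om T F G -> vec_deriv (L2 Om) ip T F G.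
Proof.
move=> [cF cG h].
have LF t : 0 <= t <= T -> L2 Om (F t) by move=> /cF[].
have LG t : 0 <= t <= T -> L2 Om (G t) by move=> /cG[].
split=> // t tT e e0; have /cvgrPdist_le /(_ e e0) := h t tT.
rewrite near_withinE /dnbhs near_withinE => /nbhs_ballP[d /= d0 dP].
exists d => // s sT std; have [->|st] := eqVneq s t.
  by rewrite !subrr scale0r subrr normr0 mulr0 (_ : 0 = 0 *: F t) ?scale0r//
    -(scale0r (F t)) (pnormZ H 0 (LF t tT)) normr0 mul0r.
have := dP s; rewrite /ball /= distrC => /(_ std st).
rewrite in_itv /= => /(_ sT); rewrite sub0r normrN.
have SD : L2 Om ((s - t)^-1 *: (F s - F t) - G t).
  by apply: (phB H); [apply: (phZ H); apply: (phB H); exact: LF|exact: LG].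
have -> : L2norm Om (fun p => (s - t)^-1 * (F s p - F t p) - G t p) =
    pnorm ip ((s - t)^-1 *: (F s - F t) - G t) by exact: L2norm_pnorm SD.
rewrite (ger0_norm (pnorm_ge0 _ _)) => hq.
have st0 : s - t != 0 by rewrite subr_eq0.
have -> : F s - F t - (s - t) *: G t = (s - t) *: ((s - t)^-1 *: (F s - F t) - G t).
  by rewrite scalerBr scalerA mulfV// scale1r.
by rewrite (pnormZ H _ SD) mulrC ler_wpM2r.
Qed.

Lemma L2_continuous_bounded F : L2_continuous Om T F ->
  exists2 K, 0 < K & forall t, 0 <= t <= T -> pnorm ip (F t) <= K.
Proof.
move=> cF; have LF t : 0 <= t <= T -> L2 Om (F t) by move=> /cF[].
apply: (vec_deriv_bounded H T0 LF) => t tT e e0.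
have [_ /cvgrPdist_le /(_ e e0)] := cF t tT.
rewrite near_withinE => /nbhs_ballP[d /= d0 dP]; exists d => // s sT std.
have := dP s; rewrite /ball /= distrC => /(_ std); rewrite in_itv /= => /(_ sT).
have -> : L2norm Om (F s \- F t) = pnorm ip (F s - F t).
  by apply: L2norm_pnorm; apply: (phB H); exact: LF.
by rewrite sub0r normrN ger0_norm// pnorm_ge0.
Qed.

Lemma L2_lipschitz_vec F : (forall t, 0 <= t <= T -> L2 Om (F t)) ->
  L2_lipschitz Om T F -> exists2 M, 0 <= M & vec_lipschitz ip T M F.
Proof.
move=> LF [M hM]; exists `|M| => // s t sT tT.
have <- : L2norm Om (F s \- F t) = pnorm ip (F s - F t).
  by apply: L2norm_pnorm; apply: (phB H); exact: LF.
by apply: le_trans (hM s t sT tT) _; rewrite ler_wpM2r// ler_norm.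
Qed.

Lemma C1_time_bounds (a : R -> R) : C1_time T a -> (forall t, 0 <= t <= T -> 0 < a t) ->
  exists lo hi lip, [/\ 0 < lo, 0 < hi, 0 < lip,
    forall t, 0 <= t <= T -> lo <= a t <= hi &
    forall s t, 0 <= s <= T -> 0 <= t <= T -> `|a s - a t| <= lip * `|s - t|].
Proof.
move=> [a' [ca' da]] pos; have dR := quotient_real_deriv da.
have ca := real_deriv_continuous dR (lexx 0) (lexx T).
have [lo lo0 hlo] := continuous_pos_lower_bound (ltW T0) ca pos.
have [hi hi0 hhi] := continuous_bounded (ltW T0) ca.
have [lip lip0 hlip] := continuous_bounded (ltW T0) ca'.
exists lo, hi, lip; split=> // [t tT|s t sT tT].
  by rewrite hlo//=; exact: le_trans (ler_norm _) (hhi t tT).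
by apply: (mean_value_ineq dR tT sT) => r rT _; exact: hlip.
Qed.

End L2Time.

(** * The residual of the exact solution *)
Section ExactSolution.
Variable R : realType.
Local Notation plane := (R * R)%type.
Variable Om : set plane.
Hypotheses (oOm : open Om) (bOm : bounded_set Om).
Let mOm := open_measurable2 oOm.
Let H := L2_pre_hilbert mOm.
Let HG := H1_pre_hilbert oOm bOm.
Local Notation ip := (@L2ip R Om).
Local Notation nm := (pnorm (@L2ip R Om)).
Variables (T : R) (T0 : 0 < T).
Implicit Types F G : R -> plane -> R.

Lemma eq_on_derivatives (f g : plane -> R) : (forall p, Om p -> f p = g p) ->
  forall p, Om p -> dx f p = dx g p /\ dy f p = dy g p.
Proof.
move=> fg p Op; have h : \forall q \near p, f q = g q.
  by apply: filterS (open_nbhs_nbhs (conj oOm Op)) => q; exact: fg.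
by split; apply: near_eq_derive.
Qed.

Lemma sum_sq_integral (gx gy : plane -> R) : L2 Om gx -> L2 Om gy ->
  \int[@lebesgue2 R]_(p in Om) (gx p ^+ 2 + gy p ^+ 2) = nm gx ^+ 2 + nm gy ^+ 2.
Proof.
move=> Lx Ly; rewrite (pnorm_sq H Lx) (pnorm_sq H Ly).
exact: (RintegralD mOm (L2_integrableM mOm Lx Lx) (L2_integrableM mOm Ly Ly)).
Qed.

Lemma dirichlet_integralE v : dom_L0 Om v -> dirichlet_integral Om v = grad_norm Om v ^+ 2.
Proof.
move=> dv; have [_ gv _ _] := dom_L0_friedrichs oOm bOm dv.
have [_ [Lx _] [Ly _]] := gv.
exact: etrans (sum_sq_integral Lx Ly) (esym (grad_pnorm_sq oOm bOm gv)).
Qed.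

(** Class C^(1,1) in time, with a single constant for all the bounds: only its
   existence matters for the order of convergence. *)
Definition C11_time K F G := [/\ vec_deriv (L2 Om) ip T F G,
  forall t, 0 <= t <= T -> nm (F t) <= K, vec_lipschitz ip T K F & vec_lipschitz ip T K G].

Lemma C11_timeI M F G : 0 <= M -> vec_deriv (L2 Om) ip T F G -> vec_lipschitz ip T M G ->
  exists2 K, 0 < K & C11_time K F G.
Proof.
move=> M0 FG lG; have [SF SG _] := FG.
have bG := lipschitz_bounded H (ltW T0) M0 SG lG.
set B := nm (G 0) + M * T in bG.
have B0 : 0 <= B by rewrite addr_ge0 ?pnorm_ge0// mulr_ge0// ltW.
have lF := vec_deriv_lipschitz H FG bG.
have bF := lipschitz_bounded H (ltW T0) B0 SF lF.
set C := nm (F 0) + B * T in bF.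
have C0 : 0 <= C by rewrite addr_ge0 ?pnorm_ge0// mulr_ge0// ltW.
exists (M + B + C + 1); first by lra.
split=> //.
- by move=> t tT; apply: le_trans (bF t tT) _; lra.
- by move=> s t sT tT; apply: le_trans (lF s t sT tT) _; rewrite ler_wpM2r//; lra.
- by move=> s t sT tT; apply: le_trans (lG s t sT tT) _; rewrite ler_wpM2r//; lra.
Qed.

Lemma C11_time_of_C2 F G J : L2_C1 Om T F G -> L2_C1 Om T G J ->
  exists2 K, 0 < K & C11_time K F G.
Proof.
move=> FG GJ; have [_ cJ _] := GJ; have [M M0 hM] := L2_continuous_bounded oOm T0 cJ.
have lG := vec_deriv_lipschitz H (L2_C1_vec_deriv oOm GJ) hM.
exact: (C11_timeI (ltW M0) (L2_C1_vec_deriv oOm FG) lG).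
Qed.

Lemma C11_sq_lipschitz K F G : 0 < K -> C11_time K F G ->
  forall s t, 0 <= s <= T -> 0 <= t <= T ->
  `|nm (F s) ^+ 2 - nm (F t) ^+ 2| <= 2 * K ^+ 2 * `|s - t|.
Proof.
move=> K0 [[SF _ _] bF lF _] s t sT tT.
apply: le_trans (norm_sq_dist H (SF s sT) (SF t tT)) _.
have -> : 2 * K ^+ 2 * `|s - t| = (K * `|s - t|) * (K + K) by ring.
apply: ler_pM; rewrite ?addr_ge0 ?pnorm_ge0//; first exact: lF.
by apply: lerD; exact: bF.
Qed.

(** The squared norm has a second difference O(h^2), although it need not be twice
   differentiable. This is why the average of the coefficient over the two outer
   layers is accurate to second order. *)
Lemma C11_second_diff K F G : 0 < K -> C11_time K F G ->
  forall t h, 0 <= h -> 0 <= t <= T -> 0 <= t + h <= T -> 0 <= t - h <= T ->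
  nm (F (t + h) + F (t - h) - 2 *: F t) <= 2 * K * h ^+ 2 /\
  `|nm (F (t + h)) ^+ 2 + nm (F (t - h)) ^+ 2 - 2 * nm (F t) ^+ 2| <= 6 * K ^+ 2 * h ^+ 2.
Proof.
move=> K0 [FG bF lF lG] t h h0 tT tpT tmT; have [SF _ _] := FG.
have h1 := second_diff1 H (ltW K0) FG lG tT tpT tmT; split=> //.
have h2 := lF _ _ tpT tT; have h3 := lF _ _ tmT tT.
rewrite addrAC subrr add0r in h2; rewrite addrAC subrr add0r normrN in h3.
rewrite (ger0_norm h0) in h2 h3.
have := norm_sq_second_diff H (SF _ tpT) (SF _ tmT) (SF _ tT) h2 h3 (bF _ tT) h1.
by have -> : 2 * (K * h) ^+ 2 + 2 * (K * (2 * K * h ^+ 2)) = 6 * K ^+ 2 * h ^+ 2 by ring.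
Qed.

Variables (al be : R -> R) (f u : R -> plane -> R).
Variables X Y Lu : R -> plane -> R.
Variable N : R -> R.
Hypotheses (N0 : forall t, 0 <= N t)
  (N2 : forall t, 0 <= t <= T -> N t ^+ 2 = nm (X t) ^+ 2 + nm (Y t) ^+ 2).

Variables (KX KY KL : R) (X' Y' L' : R -> plane -> R).
Hypotheses (KX0 : 0 < KX) (KY0 : 0 < KY) (KL0 : 0 < KL).
Hypotheses (hX : C11_time KX X X') (hY : C11_time KY Y Y') (hL : C11_time KL Lu L').

Lemma grad_norm_bounds : exists2 K, 0 < K &
  [/\ forall t, 0 <= t <= T -> N t <= K,
      forall s t, 0 <= s <= T -> 0 <= t <= T -> `|N s ^+ 2 - N t ^+ 2| <= K * `|s - t| &
      forall t h, 0 <= h -> 0 <= t <= T -> 0 <= t + h <= T -> 0 <= t - h <= T ->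
        `|N (t + h) ^+ 2 + N (t - h) ^+ 2 - 2 * N t ^+ 2| <= K * h ^+ 2].
Proof.
have KX2 := sqr_ge0 KX; have KY2 := sqr_ge0 KY; have kx := KX0; have ky := KY0.
exists (KX + KY + 6 * KX ^+ 2 + 6 * KY ^+ 2); first by lra.
split=> [t tT|s t sT tT|t h h0 tT tpT tmT].
- have [_ b1 _ _] := hX; have [_ b2 _ _] := hY.
  have := b1 t tT; have := b2 t tT; have := N2 tT.
  have := pnorm_ge0 ip (X t); have := pnorm_ge0 ip (Y t).
  move: (nm (X t)) (nm (Y t)) => x y y0 x0 NE yK xK.
  have h : N t <= x + y by rewrite -(@ler_pXn2r _ 2) ?nnegrE ?addr_ge0// NE sqrrD; nra.
  lra.
- have h1 := C11_sq_lipschitz KX0 hX sT tT; have h2 := C11_sq_lipschitz KY0 hY sT tT.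
  rewrite (N2 sT) (N2 tT); move: h1 h2.
  move: (nm (X s) ^+ 2) (nm (X t) ^+ 2) (nm (Y s) ^+ 2) (nm (Y t) ^+ 2) => x x' y y' h1 h2.
  have -> : x + y - (x' + y') = (x - x') + (y - y') by ring.
  apply: le_trans (ler_normD _ _) _; apply: le_trans (lerD h1 h2) _.
  by rewrite -mulrDl ler_wpM2r//; lra.
- have [_ h1] := C11_second_diff KX0 hX h0 tT tpT tmT.
  have [_ h2] := C11_second_diff KY0 hY h0 tT tpT tmT.
  rewrite (N2 tpT) (N2 tmT) (N2 tT); move: h1 h2.
  move: (nm (X (t + h)) ^+ 2) (nm (X (t - h)) ^+ 2) (nm (X t) ^+ 2) => x x' x''.
  move: (nm (Y (t + h)) ^+ 2) (nm (Y (t - h)) ^+ 2) (nm (Y t) ^+ 2) => y y' y'' h1 h2.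
  have -> : x + y + (x' + y') - 2 * (x'' + y'') = (x + x' - 2 * x'') + (y + y' - 2 * y'') by ring.
  apply: le_trans (ler_normD _ _) _; apply: le_trans (lerD h1 h2) _.
  by rewrite -mulrDl ler_wpM2r ?sqr_ge0//; lra.
Qed.

Variables (ut utt uttt : R -> plane -> R) (M3 : R).
Hypotheses (M30 : 0 <= M3) (d1 : vec_deriv (L2 Om) ip T u ut)
  (d2 : vec_deriv (L2 Om) ip T ut utt) (d3 : vec_deriv (L2 Om) ip T utt uttt)
  (l3 : vec_lipschitz ip T M3 uttt).
Variables (hiA hiB : R).
Hypotheses (hA : forall t, 0 <= t <= T -> 0 <= al t <= hiA)
  (hB : forall t, 0 <= t <= T -> 0 <= be t <= hiB).
Hypothesis Lf : forall t, 0 <= t <= T -> L2 Om (f t).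
Hypothesis pde : forall t, 0 <= t <= T ->
  ae_eq_on Om (f t) (utt t + (al t + be t * N t ^+ 2) *: Lu t).

Definition averaged_coeff t h := al t + be t / 2 * (N (t + h) ^+ 2 + N (t - h) ^+ 2).

Definition residual t h : plane -> R := h ^- 2 *: (u (t + h) - 2 *: u t + u (t - h)) +
  (averaged_coeff t h / 2) *: (Lu (t + h) + Lu (t - h)) - f t.

Lemma residual_L2 t h : 0 <= t <= T -> 0 <= t + h <= T -> 0 <= t - h <= T ->
  L2 Om (residual t h).
Proof.
move=> tT tpT tmT; have [Su _ _] := d1; have [[SL _ _] _ _ _] := hL.
apply: (phB H); last exact: Lf.
apply: (phD H); apply: (phZ H); apply: (phD H).
- by apply: (phB H); [exact: Su|apply: (phZ H); exact: Su].
- exact: Su.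
- exact: SL.
- exact: SL.
Qed.

(** By the equation, the residual splits into the Taylor remainders of the second
   difference quotient, of the average of [Lu] and of the average of the coefficient. *)
Lemma residual_bound_exists : exists2 K, 0 < K & forall t h, 0 < h ->
  0 <= t <= T -> 0 <= t + h <= T -> 0 <= t - h <= T -> nm (residual t h) <= K * h ^+ 2.
Proof.
have [KN KN0 [bN _ sN]] := grad_norm_bounds.
have kl := KL0; have m3 := M30.
have A0 : 0 <= hiA by have := hA (t := 0); rewrite lexx (ltW T0) => /(_ isT); lra.
have B0 : 0 <= hiB by have := hB (t := 0); rewrite lexx (ltW T0) => /(_ isT); lra.
pose Qm := hiA + hiB * KN ^+ 2.
have KN2 := sqr_ge0 KN.
have BK : 0 <= hiB * KN ^+ 2 by rewrite mulr_ge0.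
have Qm0 : 0 <= Qm by rewrite addr_ge0.
have BKL : 0 <= hiB / 2 * KN * KL by apply: mulr_ge0; [apply: mulr_ge0|]; lra.
have QK : 0 <= Qm * KL by apply: mulr_ge0; lra.
exists (2 * M3 + Qm * KL + hiB / 2 * KN * KL + 1); first by lra.
move=> t h h0 tT tpT tmT.
have [Su _ _] := d1; have [_ Sutt _] := d2; have [[SL _ _] bL _ _] := hL.
have hn : h != 0 by rewrite gt_eqF.
pose q := al t + be t * N t ^+ 2; pose qa := averaged_coeff t h.
pose w : plane -> R := h ^- 2 *: (u (t + h) + u (t - h) - 2 *: u t - h ^+ 2 *: utt t) +
  (qa / 2) *: (Lu (t + h) + Lu (t - h) - 2 *: Lu t) + (qa - q) *: Lu t.
have S1 : L2 Om (u (t + h) + u (t - h) - 2 *: u t - h ^+ 2 *: utt t).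
  apply: (phB H); last by apply: (phZ H); exact: Sutt.
  by apply: (phB H); [apply: (phD H); exact: Su|apply: (phZ H); exact: Su].
have S2 : L2 Om (Lu (t + h) + Lu (t - h) - 2 *: Lu t).
  by apply: (phB H); [apply: (phD H); exact: SL|apply: (phZ H); exact: SL].
have S3 := SL t tT.
have Lw : L2 Om w.
  by apply: (phD H); [apply: (phD H)|]; apply: (phZ H).
have rw : ae_eq_on Om (residual t h) w.
  apply: ae2S (pde tT) => p hp Op; have {}hp := hp Op.
  have -> : residual t h p = h ^- 2 * (u (t + h) p - 2 * u t p + u (t - h) p) +
    qa / 2 * (Lu (t + h) p + Lu (t - h) p) - f t p by [].
  have -> : w p = h ^- 2 * (u (t + h) p + u (t - h) p - 2 * u t p - h ^+ 2 * utt t p) +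
    qa / 2 * (Lu (t + h) p + Lu (t - h) p - 2 * Lu t p) + (qa - q) * Lu t p by [].
  have -> : f t p = utt t p + q * Lu t p by rewrite hp.
  by field.
rewrite (pnorm_ae oOm (residual_L2 tT tpT tmT) Lw rw).
have n1 := second_diff3 H M30 d1 d2 d3 l3 tT tpT tmT.
have [n2 _] := C11_second_diff KL0 hL (ltW h0) tT tpT tmT.
have sq r : 0 <= r <= T -> N r ^+ 2 <= KN ^+ 2.
  by move=> rT; rewrite lerXn2r ?nnegrE ?(ltW KN0) ?bN.
have /andP[a0 aA] := hA tT; have /andP[b0 bB] := hB tT.
have qa0 : 0 <= qa <= Qm.
  have := sq _ tpT; have := sq _ tmT; have := sqr_ge0 (N (t + h)); have := sqr_ge0 (N (t - h)).
  rewrite /qa /averaged_coeff /Qm; move: (N (t + h) ^+ 2) (N (t - h) ^+ 2) => x y y0 x0 yK xK.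
  have h1 : 0 <= be t / 2 * (x + y) by apply: mulr_ge0; lra.
  have h2 : be t / 2 * (x + y) <= hiB / 2 * (KN ^+ 2 + KN ^+ 2) by apply: ler_pM; lra.
  by apply/andP; split; lra.
move: qa0 => /andP[qa0 qaQ].
have qd : `|qa - q| <= hiB / 2 * (KN * h ^+ 2).
  have -> : qa - q = be t / 2 * (N (t + h) ^+ 2 + N (t - h) ^+ 2 - 2 * N t ^+ 2).
    by rewrite /qa /q /averaged_coeff; field.
  rewrite normrM ger0_norm; last by lra.
  apply: ler_pM; rewrite ?normr_ge0//; try lra.
  exact: sN (ltW h0) tT tpT tmT.
have hh := sqr_ge0 h.
have e1 : nm (h ^- 2 *: (u (t + h) + u (t - h) - 2 *: u t - h ^+ 2 *: utt t)) <= 2 * M3 * h ^+ 2.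
  rewrite (pnormZ H _ S1) ger0_norm; last by rewrite invr_ge0.
  have -> : 2 * M3 * h ^+ 2 = h ^- 2 * (2 * M3 * h ^+ 4) by field.
  by rewrite ler_wpM2l ?invr_ge0.
have e2 : nm ((qa / 2) *: (Lu (t + h) + Lu (t - h) - 2 *: Lu t)) <= Qm * KL * h ^+ 2.
  rewrite (pnormZ H _ S2) ger0_norm; last by lra.
  have -> : Qm * KL * h ^+ 2 = Qm / 2 * (2 * KL * h ^+ 2) by field.
  by apply: ler_pM; rewrite ?pnorm_ge0//; lra.
have e3 : nm ((qa - q) *: Lu t) <= hiB / 2 * KN * KL * h ^+ 2.
  rewrite (pnormZ H _ S3).
  have -> : hiB / 2 * KN * KL * h ^+ 2 = hiB / 2 * (KN * h ^+ 2) * KL by ring.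
  by apply: ler_pM; rewrite ?pnorm_ge0 ?normr_ge0//; exact: bL.
have Z1 := phZ H (h ^- 2) S1; have Z2 := phZ H (qa / 2) S2; have Z3 := phZ H (qa - q) S3.
apply: le_trans (pnormD H (phD H Z1 Z2) Z3) _.
apply: le_trans (lerD (pnormD H Z1 Z2) (lexx _)) _.
lra.
Qed.

End ExactSolution.

(** * The starting error and one step of the error equation *)
Lemma real_derivD (R : realType) (T : R) (p p' q q' : R -> R) :
  real_deriv T p p' -> real_deriv T q q' ->
  real_deriv T (fun t => p t + q t) (fun t => p' t + q' t).
Proof.
move=> hp hq t tT e e0; have e20 : 0 < e / 2 by rewrite divr_gt0.
have [d d0 dP] := hp t tT _ e20; have [d' d'0 d'P] := hq t tT _ e20.
exists (Num.min d d'); first by rewrite lt_min d0.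
move=> s sT; rewrite lt_min => /andP[/(dP s sT) h1 /(d'P s sT) h2].
have -> : p s + q s - (p t + q t) - (s - t) * (p' t + q' t) =
  (p s - p t - (s - t) * p' t) + (q s - q t - (s - t) * q' t) by ring.
apply: le_trans (ler_normD _ _) _; apply: le_trans (lerD h1 h2) _; lra.
Qed.

Section ErrorEquation.
Variable R : realType.
Local Notation plane := (R * R)%type.
Variable Om : set plane.
Hypotheses (oOm : open Om) (bOm : bounded_set Om).
Let mOm := open_measurable2 oOm.
Let H := L2_pre_hilbert mOm.
Let HG := H1_pre_hilbert oOm bOm.
Local Notation ip := (@L2ip R Om).
Local Notation nm := (pnorm (@L2ip R Om)).

Lemma friedrichsB (x y g h : plane -> R) : friedrichs Om x g -> friedrichs Om y h ->
  friedrichs Om (x - y) (g - h).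
Proof.
move=> fx fy; have := friedrichs_comb oOm bOm (-1) fx fy.
by rewrite (scaleN1r y) (scaleN1r h).
Qed.

(** Symmetry of the operator turns the stiffness term into a difference of squares. *)
Lemma friedrichs_diff_sq (x y g h : plane -> R) : friedrichs Om x g -> friedrichs Om y h ->
  ip (g + h) (x - y) = grad_norm Om x ^+ 2 - grad_norm Om y ^+ 2.
Proof.
move=> fx fy; have [_ _ hs] := friedrichs_comb oOm bOm 1 fx fy.
have [[Hx _] _ _] := fx; have [[Hy _] _ _] := fy.
have [Hd _ _] := friedrichsB fx fy.
have := hs _ Hd; rewrite (scale1r y) (scale1r h) => <-.
have e : grad_ip Om (x + y) (x - y) = grad_ip Om x x - grad_ip Om y y.
  rewrite (phDl HG Hx Hy (phB HG Hx Hy)) (phBr HG Hx Hy Hx) (phBr HG Hx Hy Hy).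
  by rewrite (phC HG y x) addrA subrK.
by rewrite e -(pnorm_sq HG Hx) -(pnorm_sq HG Hy).
Qed.

Lemma energy_split (A B C C' q g h : R) : A + q * (g - h) <= B + C -> C <= C' ->
  A + q * g <= B + q * h + C'.
Proof. by move=> *; lra. Qed.

(** Small letters are exact values, with residual [r] and coefficient [qa]; capitals
   are discrete values, with coefficient [Q]. The discrete coefficient multiplies the
   error, so that the difference of the coefficients only meets the exact solution,
   whose second derivatives are bounded. *)
Lemma scheme_energy (up u um Up U Um Lp Lm LUp LUm f r : plane -> R) (tau qa Q : R) :
  0 < tau -> friedrichs Om up Lp -> friedrichs Om um Lm -> L2 Om u ->
  friedrichs Om Up LUp -> friedrichs Om Um LUm -> L2 Om U -> L2 Om r ->
  r = tau ^- 2 *: (up - 2 *: u + um) + (qa / 2) *: (Lp + Lm) - f ->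
  ae_eq_on Om (fun p => (Up p - 2 * U p + Um p) / tau ^+ 2 + 2^-1 * Q * (LUp p + LUm p)) f ->
  let z := u - U in let zp := up - Up in let zm := um - Um in
  let D := nm (tau^-1 *: (zp - z)) in let d := nm (tau^-1 *: (z - zm)) in
  D ^+ 2 + Q / 2 * grad_norm Om zp ^+ 2 <= d ^+ 2 + Q / 2 * grad_norm Om zm ^+ 2 +
    tau * ((nm r + `|qa - Q| * (nm (Lp + Lm) / 2)) * (D + d)).
Proof.
move=> t0 fup fum Lu fUp fUm LU Lr rE sch; cbv zeta.
set zp := up - Up; set zm := um - Um; set z := u - U.
set D := nm (_ *: (zp - z)); set d := nm (_ *: (z - zm)).
have fzp := friedrichsB fup fUp; have fzm := friedrichsB fum fUm.
have [_ Lzp Lgp] := friedrichs_L2 fzp; have [_ Lzm Lgm] := friedrichs_L2 fzm.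
have [_ _ LLp] := friedrichs_L2 fup; have [_ _ LLm] := friedrichs_L2 fum.
have LL := phD H LLp LLm; have Lz : L2 Om z := phB H Lu LU.
pose w := r - ((qa - Q) / 2) *: (Lp + Lm).
have Lw : L2 Om w := phB H Lr (phZ H _ LL).
have Lg := phD H Lgp Lgm; have Lv := phB H Lzp Lzm.
have Llhs : L2 Om (tau ^- 2 *: (zp - 2 *: z + zm) + (Q / 2) *: ((Lp - LUp) + (Lm - LUm))).
  apply: (phD H); last exact: (phZ H).
  by apply: (phZ H); apply: (phD H) => //; apply: (phB H) => //; exact: (phZ H).
have tn : tau != 0 by rewrite gt_eqF.
have eqv : ae_eq_on Om
    (tau ^- 2 *: (zp - 2 *: z + zm) + (Q / 2) *: ((Lp - LUp) + (Lm - LUm))) w.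
  apply: ae2S sch => p hp Op; have {}hp := hp Op.
  have -> : (tau ^- 2 *: (zp - 2 *: z + zm) + (Q / 2) *: ((Lp - LUp) + (Lm - LUm))) p =
    tau ^- 2 * (up p - Up p - 2 * (u p - U p) + (um p - Um p)) +
    Q / 2 * ((Lp p - LUp p) + (Lm p - LUm p)) by [].
  have -> : w p = r p - (qa - Q) / 2 * (Lp p + Lm p) by [].
  have -> : r p = tau ^- 2 * (up p - 2 * u p + um p) + qa / 2 * (Lp p + Lm p) - f p.
    by rewrite rE.
  by rewrite -hp; field.
have hE := energy_inequality H t0 Lzp Lz Lzm Lg Lw (L2ip_ae oOm Llhs Lw Lv eqv)
  (friedrichs_diff_sq fzp fzm).
have nw : nm w <= nm r + `|qa - Q| * (nm (Lp + Lm) / 2).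
  apply: le_trans (pnormB H Lr (phZ H _ LL)) _; rewrite lerD2l (pnormZ H _ LL).
  by rewrite normrM (ger0_norm (_ : 0 <= 2^-1)) ?invr_ge0// -mulrA (mulrC 2^-1).
have Dd : 0 <= D + d by rewrite addr_ge0 ?pnorm_ge0.
have hw : tau * (nm w * (D + d)) <=
    tau * ((nm r + `|qa - Q| * (nm (Lp + Lm) / 2)) * (D + d)).
  by rewrite ler_wpM2l ?(ltW t0)// ler_wpM2r.
exact: energy_split hE hw.
Qed.

Variables (T : R) (T0 : 0 < T).

(** The identity defining weak derivatives may be differentiated in time, both of its
   sides being scalar products with fixed functions. *)
Lemma weak_time_deriv (D : (plane -> R) -> plane -> R) (u ut X X' : R -> plane -> R) :
  (forall phi, C1_compact Om phi -> L2 Om (D phi)) ->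
  vec_deriv (L2 Om) ip T u ut -> vec_deriv (L2 Om) ip T X X' ->
  (forall t, 0 <= t <= T ->
    forall phi, C1_compact Om phi -> ip (u t) (D phi) = - ip (X t) phi) ->
  forall t, 0 <= t <= T ->
    forall phi, C1_compact Om phi -> ip (ut t) (D phi) = - ip (X' t) phi.
Proof.
move=> LD du dX wX t tT phi cphi; have [Lphi _ _] := C1_compact_L2 oOm bOm cphi.
have h := real_derivD (vec_deriv_ip H du (LD _ cphi)) (vec_deriv_ip H dX Lphi).
apply/eqP; rewrite -addr_eq0; apply/eqP.
by apply: (real_deriv_zero T0 h _ tT) => s sT; rewrite (wX s sT _ cphi) addrC subrr.
Qed.

Variables (u ut utt X X' Y Y' : R -> plane -> R) (M KX KY : R).
Hypotheses (M0 : 0 <= M) (KX0 : 0 < KX) (KY0 : 0 < KY)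
  (d1 : vec_deriv (L2 Om) ip T u ut) (d2 : vec_deriv (L2 Om) ip T ut utt)
  (l2 : vec_lipschitz ip T M utt)
  (hX : C11_time Om T KX X X') (hY : C11_time Om T KY Y Y')
  (gXY : forall t, 0 <= t <= T -> weak_grad Om (u t) (X t) (Y t)).
Variables (v w vx vy wx wy : plane -> R).
Hypotheses (gv : weak_grad Om v vx vy) (gw : weak_grad Om w wx wy)
  (uv : ae_eq_on Om (ut 0) v) (uw : ae_eq_on Om (utt 0) w).

Let zT : 0 <= (0 : R) <= T. Proof. by rewrite lexx ltW. Qed.

Let initial_velocity_grad : ae_eq_on Om (X' 0) vx /\ ae_eq_on Om (Y' 0) vy.
Proof.
have [FX _ _ _] := hX; have [FY _ _ _] := hY.
have gt : weak_grad Om (ut 0) (X' 0) (Y' 0).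
  split; first exact: (vdF d2 zT).
  - split; first exact: (vdG FX zT).
    apply: (weak_time_deriv _ d1 FX _ zT) => [phi /(C1_compact_L2 oOm bOm)[]//|t tT].
    by have [_ []] := gXY tT.
  - split; first exact: (vdG FY zT).
    apply: (weak_time_deriv _ d1 FY _ zT) => [phi /(C1_compact_L2 oOm bOm)[]//|t tT].
    by have [_ _ []] := gXY tT.
have [Lv wvx wvy] := gv.
have [_ hx hy] := weak_grad_ext oOm bOm Lv uv gt.
by split; [exact: weak_dx_unique oOm bOm _ _ _ hx wvx|exact: weak_dy_unique oOm bOm _ _ _ hy wvy].
Qed.

Let increment K F F' (g q : plane -> R) h : C11_time Om T K F F' -> 0 < K ->
  ae_eq_on Om (F' 0) g -> L2 Om g -> L2 Om q -> 0 < h <= T ->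
  nm (F h - (F 0 + h *: g + (h ^+ 2 / 2) *: q)) <= (K + nm q) * h ^+ 2.
Proof.
move=> [dF _ _ lF] K0 Fg Lg Lq /andP[h0 hT]; have [SF SF' _] := dF.
have hT' : 0 <= h <= T by rewrite ltW.
have := taylor1 H (ltW K0) dF lF hT' zT; rewrite subr0 (ger0_norm (ltW h0)) => t1.
have L1 := phB H (phB H (SF h hT') (SF 0 zT)) (phZ H h (SF' 0 zT)).
have L2' := phZ H (h ^+ 2 / 2) Lq.
have Lx : L2 Om (F h - (F 0 + h *: g + (h ^+ 2 / 2) *: q)).
  apply: (phB H (SF h hT')); apply: (phD H) => //.
  by apply: (phD H); [exact: SF|exact: (phZ H)].
have e : ae_eq_on Om (F h - (F 0 + h *: g + (h ^+ 2 / 2) *: q))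
    (F h - F 0 - h *: F' 0 - (h ^+ 2 / 2) *: q).
  apply: ae2S Fg => p hp Op.
  have -> : (F h - (F 0 + h *: g + (h ^+ 2 / 2) *: q)) p =
    F h p - (F 0 p + h * g p + h ^+ 2 / 2 * q p) by [].
  have -> : (F h - F 0 - h *: F' 0 - (h ^+ 2 / 2) *: q) p =
    F h p - F 0 p - h * F' 0 p - h ^+ 2 / 2 * q p by [].
  by rewrite (hp Op); ring.
rewrite (pnorm_ae oOm Lx (phB H L1 L2') e).
apply: le_trans (pnormB H L1 L2') _; rewrite (pnormZ H _ Lq).
have hh := sqr_ge0 h; rewrite ger0_norm; last by lra.
have := pnorm_ge0 ip q => q0.
have : h ^+ 2 / 2 * nm q <= h ^+ 2 * nm q by apply: ler_wpM2r => //; lra.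
lra.
Qed.

(** The first step of the scheme is Taylor's formula of order two at time 0, so the
   increment is accurate to order h^3 / h. For the gradient, order one suffices, the
   term in [w] being itself O(h^2). *)
Lemma initial_error : exists2 K, 0 < K & forall h (U0 U1 : plane -> R), 0 < h <= T ->
  L2 Om U0 -> L2 Om U1 -> ae_eq_on Om U0 (u 0) ->
  ae_eq_on Om U1 (fun p => u 0 p + h * v p + h ^+ 2 / 2 * w p) ->
  [/\ grad_norm Om (u 0 - U0) = 0, grad_norm Om (u h - U1) <= K * h ^+ 2 &
      nm (h^-1 *: ((u h - U1) - (u 0 - U0))) <= K * h ^+ 2].
Proof.
have [Lv [Lvx _] [Lvy _]] := gv; have [Lw [Lwx _] [Lwy _]] := gw.
have [evx evy] := initial_velocity_grad.
have wx0 := pnorm_ge0 ip wx; have wy0 := pnorm_ge0 ip wy.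
have m0 := M0; have kx0 := KX0; have ky0 := KY0.
exists (KX + nm wx + (KY + nm wy) + M); first by lra.
move=> h U0 U1 hh LU0 LU1 e0 e1.
have /andP[h0 hT] := hh; have hT' : 0 <= h <= T by rewrite ltW.
have [Su _ _] := d1; have Sutt := vdG d2 zT; have Sut := vdF d2 zT.
have Lz0 : L2 Om (u 0 - U0) := phB H (Su 0 zT) LU0.
have Lz1 : L2 Om (u h - U1) := phB H (Su h hT') LU1.
have z0 : ae_eq_on Om 0 (u 0 - U0).
  apply: ae2S e0 => p hp Op.
  by have -> : (u 0 - U0) p = u 0 p - U0 p by []; rewrite hp// subrr.
have h2 := sqr_ge0 h.
split.
- have g0 := weak_grad_ext oOm bOm Lz0 z0 (weak_grad0 oOm bOm).
  rewrite /grad_norm (grad_ipE oOm bOm g0 g0).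
  have -> : ip 0 0 = 0.
    by have := phZl H 0 (ph0 H) (ph0 H); rewrite scale0r mul0r.
  by rewrite addr0 sqrtr0.
- have gV := weak_gradD oOm bOm (weak_gradD oOm bOm (gXY zT) (weak_gradZ oOm bOm h gv))
    (weak_gradZ oOm bOm (h ^+ 2 / 2) gw).
  have gU := weak_grad_ext oOm bOm LU1 (ae_eq_on_sym e1) gV.
  have gz := weak_gradB oOm bOm (gXY hT') gU.
  apply: le_trans (grad_pnorm_le oOm bOm gz) _.
  apply: le_trans (lerD (increment hX KX0 evx Lvx Lwx hh) (increment hY KY0 evy Lvy Lwy hh)) _.
  by rewrite -mulrDl ler_wpM2r//; lra.
- have := taylor2 H M0 d1 d2 l2 hT' zT; rewrite subr0 (ger0_norm (ltW h0)).
  set r := u h - u 0 - _ => hr.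
  have Lr : L2 Om r.
    apply: (phB H); first by apply: (phB H); exact: Su.
    by apply: (phD H); apply: (phZ H).
  have Lzz := phB H Lz1 Lz0.
  have e : ae_eq_on Om ((u h - U1) - (u 0 - U0)) r.
    apply: ae2S2 (ae2S2 (fun p h1 h2 => conj h1 h2) e0 e1) (ae2S2 (fun p h1 h2 => conj h1 h2) uv uw).
    move=> p [q0 q1] [q2 q3] Op.
    have -> : ((u h - U1) - (u 0 - U0)) p = u h p - U1 p - (u 0 p - U0 p) by [].
    have -> : r p = u h p - u 0 p - (h * ut 0 p + h ^+ 2 / 2 * utt 0 p) by [].
    by rewrite q0// q1// q2// q3//; ring.
  rewrite (pnormZ H _ Lzz) (pnorm_ae oOm Lzz Lr e) gtr0_norm ?invr_gt0//.
  rewrite mulrC ler_pdivrMr//.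
  apply: le_trans hr _; rewrite -mulrA -exprSr ler_wpM2r ?exprn_ge0 ?(ltW h0)//; lra.
Qed.

End ErrorEquation.

(** * The error of the scheme satisfies the stability inequalities *)
Section Convergence.
Variable R : realType.
Local Notation plane := (R * R)%type.
Variable Om : set plane.
Hypotheses (oOm : open Om) (bOm : bounded_set Om).
Let mOm := open_measurable2 oOm.
Let H := L2_pre_hilbert mOm.
Let HG := H1_pre_hilbert oOm bOm.
Local Notation ip := (@L2ip R Om).
Local Notation nm := (pnorm (@L2ip R Om)).
Variables (T : R) (T0 : 0 < T).

(** The constants depend on the exact solution only, not on the scheme: [L] is 1 plus
   the sum of all the bounds, so that it can replace each of them. *)
Lemma scheme_run_of_solution (al be : R -> R) (f u ut utt uttt X X' Y Y' Lu L' : R -> plane -> R)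
    (loA hiA lipA loB hiB lipB KX KY KL M2 M3 : R) (v w vx vy wx wy : plane -> R) :
  0 < loA -> 0 < hiA -> 0 < lipA -> 0 < loB -> 0 < hiB -> 0 < lipB ->
  (forall t, 0 <= t <= T -> loA <= al t <= hiA) ->
  (forall t, 0 <= t <= T -> loB <= be t <= hiB) ->
  (forall s t, 0 <= s <= T -> 0 <= t <= T -> `|al s - al t| <= lipA * `|s - t|) ->
  (forall s t, 0 <= s <= T -> 0 <= t <= T -> `|be s - be t| <= lipB * `|s - t|) ->
  0 < KX -> 0 < KY -> 0 < KL ->
  C11_time Om T KX X X' -> C11_time Om T KY Y Y' -> C11_time Om T KL Lu L' ->
  0 <= M2 -> 0 <= M3 ->
  vec_deriv (L2 Om) ip T u ut -> vec_deriv (L2 Om) ip T ut utt ->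
  vec_deriv (L2 Om) ip T utt uttt ->
  vec_lipschitz ip T M2 utt -> vec_lipschitz ip T M3 uttt ->
  (forall t, 0 <= t <= T -> L2 Om (f t)) ->
  (forall t, 0 <= t <= T -> weak_grad Om (u t) (X t) (Y t)) ->
  (forall t, 0 <= t <= T -> friedrichs Om (u t) (Lu t)) ->
  (forall t, 0 <= t <= T ->
    ae_eq_on Om (f t) (utt t + (al t + be t * grad_norm Om (u t) ^+ 2) *: Lu t)) ->
  weak_grad Om v vx vy -> weak_grad Om w wx wy ->
  ae_eq_on Om (ut 0) v -> ae_eq_on Om (utt 0) w ->
  exists a b L, [/\ 0 < a <= 1, 0 < b, 1 <= L &
    forall (tau : R) (n : nat) (U LU : nat -> plane -> R),
    0 < tau <= 1 -> n%:R * tau <= T -> (0 < n)%N ->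
    (forall k, (k <= n)%N -> friedrichs Om (U k) (LU k)) ->
    ae_eq_on Om (U 0%N) (u 0) ->
    ae_eq_on Om (U 1%N) (fun p => u 0 p + tau * v p + tau ^+ 2 / 2 * w p) ->
    (forall k, (0 < k < n)%N -> ae_eq_on Om
      (fun p => (U k.+1 p - 2 * U k p + U k.-1 p) / tau ^+ 2 +
         2^-1 * (al (k%:R * tau) + be (k%:R * tau) / 2 *
           (grad_norm Om (U k.+1) ^+ 2 + grad_norm Om (U k.-1) ^+ 2)) *
         (LU k.+1 p + LU k.-1 p)) (f (k%:R * tau))) ->
    scheme_run a b L tau n (fun k => al (k%:R * tau)) (fun k => be (k%:R * tau))
      (fun k => grad_norm Om (u (k%:R * tau) - U k))
      (fun k => nm (tau^-1 *: ((u (k%:R * tau) - U k) - (u (k.-1%:R * tau) - U k.-1))))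
      (fun k => grad_norm Om (U k)) (fun k => grad_norm Om (u (k%:R * tau)))].
Proof.
move=> loA0 hiA0 lipA0 loB0 hiB0 lipB0 bA bB lA lB KX0 KY0 KL0 hX hY hL M20 M30 d1 d2 d3 l2 l3
  Lf gXY fr pde gv gw uv uw.
have N2 t : 0 <= t <= T -> grad_norm Om (u t) ^+ 2 = nm (X t) ^+ 2 + nm (Y t) ^+ 2.
  by move=> tT; exact: (grad_pnorm_sq oOm bOm (gXY t tT)).
have [KN KN0 [bN lN _]] := grad_norm_bounds oOm (fun t => pnorm_ge0 (@grad_ip R Om) (u t))
  N2 KX0 KY0 hX hY.
have A0 t : 0 <= t <= T -> 0 <= al t <= hiA.
  by move=> /bA /andP[h1 ->]; rewrite (le_trans (ltW loA0) h1).
have B0 t : 0 <= t <= T -> 0 <= be t <= hiB.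
  by move=> /bB /andP[h1 ->]; rewrite (le_trans (ltW loB0) h1).
have [KR KR0 hR] := residual_bound_exists oOm T0 (fun t => pnorm_ge0 (@grad_ip R Om) (u t))
  N2 KX0 KY0 KL0 hX hY hL M30 d1 d2 d3 l3 A0 B0 Lf pde.
have [KI KI0 hI] := initial_error oOm bOm T0 M20 KX0 KY0 d1 d2 l2 hX hY gXY gv gw uv uw.
pose L := 1 + hiA + hiB + lipA + lipB + KN + KR + KI + KL.
have [La Lb Lla Llb] : [/\ hiA <= L, hiB <= L, lipA <= L & lipB <= L].
  by rewrite /L; split; lra.
have [LN LR LI LKL L1] : [/\ KN <= L, KR <= L, KI <= L, KL <= L & 1 <= L].
  by rewrite /L; split; lra.
exists (Num.min loA 1), loB, L; split=> //; first by rewrite lt_min loA0 ltr01 ge_min lexx orbT.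
move=> tau n U LU /andP[tau0 tau1] nT n0 frU U0 U1 sch.
have Tk k : (k <= n)%N -> 0 <= k%:R * tau <= T.
  move=> kn; rewrite mulr_ge0 ?ler0n ?(ltW tau0)//=; apply: le_trans nT.
  by rewrite ler_wpM2r ?(ltW tau0)// ler_nat.
have step k : (k < n)%N -> `|k.+1%:R * tau - k%:R * tau| = tau.
  by move=> _; rewrite -mulrBl -natr1 addrAC subrr add0r mul1r gtr0_norm.
have Hu k : (k <= n)%N -> H1 Om (u (k%:R * tau)).
  by move=> /Tk /fr /friedrichs_L2[].
have HU k : (k <= n)%N -> H1 Om (U k) by move=> /frU /friedrichs_L2[].
have LLU k : (k <= n)%N -> L2 Om (U k) by move=> /frU /friedrichs_L2[].
have Lu' k : (k <= n)%N -> L2 Om (u (k%:R * tau)) by move=> /Tk /fr /friedrichs_L2[].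
have hh : 0 < tau <= T.
  by rewrite tau0 /=; have /andP[_] := Tk _ n0; rewrite mul1r.
have [i0 i1 i2] := hI tau (U 0%N) (U 1%N) hh (LLU 0%N (leq0n _)) (LLU _ n0) U0 U1.
have u0E : u (0%:R * tau) = u 0 by rewrite mul0r.
have u1E : u (1%:R * tau) = u tau by rewrite mul1r.
split.
- by rewrite lt_min loA0 ltr01 ge_min lexx orbT tau0 tau1.
- move=> k kn; have /andP[h1 h2] := bA _ (Tk k kn).
  by rewrite ge_min h1 (le_trans h2 La).
- move=> k kn; have /andP[h1 h2] := bB _ (Tk k kn).
  by rewrite h1 (le_trans h2 Lb).
- move=> k kn; apply: le_trans (lA _ _ (Tk _ kn) (Tk _ (ltnW kn))) _.
  by rewrite step// ler_wpM2r// ltW.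
- move=> k kn; apply: le_trans (lB _ _ (Tk _ kn) (Tk _ (ltnW kn))) _.
  by rewrite step// ler_wpM2r// ltW.
- by move=> k kn; split; exact: pnorm_ge0.
- move=> k kn; apply/andP; split; first exact: (pnorm_ge0 (@grad_ip R Om)).
  exact: le_trans (bN _ (Tk k kn)) LN.
- move=> k kn; apply: le_trans (lN _ _ (Tk _ kn) (Tk _ (ltnW kn))) _.
  by rewrite step// ler_wpM2r// ltW.
- move=> k kn; rewrite distrC; exact: (pnorm_dist HG (Hu k kn) (HU k kn)).
- move=> k kn; rewrite [leRHS]addrC; exact: (pnormB HG (Hu k kn) (HU k kn)).
- by rewrite u0E; exact: i0.
- rewrite u1E; apply: le_trans i1 _.
  by rewrite ler_wpM2r// sqr_ge0.
- rewrite u1E u0E; apply: le_trans i2 _.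
  by rewrite ler_wpM2r// sqr_ge0.
move=> k kn; have /andP[k0 kn1] := kn; cbv zeta.
have kn' : (k.-1 <= n)%N by rewrite (leq_trans (leq_pred _))// ltnW.
have tp : k.+1%:R * tau = k%:R * tau + tau by rewrite -natr1 mulrDl mul1r.
have tm : k.-1%:R * tau = k%:R * tau - tau.
  by rewrite -[in RHS](prednK k0) -natr1 mulrDl mul1r addrK.
have TT := Tk _ (ltnW kn1); have Tp := Tk _ kn1; have Tm := Tk _ kn'.
have Tp' := Tp; have Tm' := Tm; rewrite tp in Tp'; rewrite tm in Tm'.
have Lr := residual_L2 oOm al be (fun t => grad_norm Om (u t)) hL d1 Lf TT Tp' Tm'.
have hr := hR _ _ tau0 TT Tp' Tm'.
have rE : residual al be f u Lu (fun t => grad_norm Om (u t)) (k%:R * tau) tau =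
  tau ^- 2 *: (u (k.+1%:R * tau) - 2 *: u (k%:R * tau) + u (k.-1%:R * tau)) +
  ((al (k%:R * tau) + be (k%:R * tau) / 2 * (grad_norm Om (u (k.+1%:R * tau)) ^+ 2 +
     grad_norm Om (u (k.-1%:R * tau)) ^+ 2)) / 2) *:
  (Lu (k.+1%:R * tau) + Lu (k.-1%:R * tau)) - f (k%:R * tau).
  by rewrite tp tm.
have hE := scheme_energy oOm bOm tau0 (fr _ Tp) (fr _ Tm) (Lu' _ (ltnW kn1))
  (frU _ kn1) (frU _ kn') (LLU _ (ltnW kn1)) Lr rE (sch k kn).
apply: le_trans hE _; rewrite lerD2l ler_wpM2l ?(ltW tau0)// ler_wpM2r//.
  by rewrite addr_ge0// pnorm_ge0.
have [[SL _ _] bL _ _] := hL.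
apply: lerD.
  by apply: le_trans hr _; rewrite ler_wpM2r// sqr_ge0.
rewrite mulrC ler_wpM2r//.
rewrite ler_pdivrMr//; apply: le_trans (pnormD H (SL _ Tp) (SL _ Tm)) _.
apply: le_trans (lerD (bL _ Tp) (bL _ Tm)) _.
by rewrite mulr_natr mulr2n; exact: (lerD LKL LKL).
Qed.

(** * The Kirchhoff equation in operator form *)
Implicit Types F G : R -> plane -> R.

Lemma pnorm_diff_ae (g h : plane -> R) : L2 Om g -> L2 Om h ->
  ae_eq_on Om g h <-> nm (g - h) = 0.
Proof.
move=> Lg Lh; have Ld := phB H Lg Lh; split=> [gh|/(pnorm0_ae oOm bOm Ld)]; last first.
  by apply: ae2S => p hp Op; apply/eqP; rewrite -subr_eq0; apply/eqP; exact: hp.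
have L0 := ph0 H; have Z := pnormZ H 0 L0; rewrite scale0r normr0 mul0r in Z.
rewrite -[RHS]Z; apply: (pnorm_ae oOm Ld L0).
apply: ae2S gh => p hp Op.
by have -> : (g - h) p = g p - h p by []; rewrite hp// subrr.
Qed.

(** Two descriptions of the same function of time have almost everywhere equal
   derivatives, because a derivative of zero has norm zero. *)
Lemma vec_deriv_ae F F' G G' : vec_deriv (L2 Om) ip T F G -> vec_deriv (L2 Om) ip T F' G' ->
  (forall t, 0 <= t <= T -> ae_eq_on Om (F t) (F' t)) ->
  forall t, 0 <= t <= T -> ae_eq_on Om (G t) (G' t).
Proof.
move=> FG FG' FF' t tT; apply/(pnorm_diff_ae (vdG FG tT) (vdG FG' tT)).
apply: (vec_deriv_zero H T0 (vec_derivB H FG FG') _ tT) => s sT.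
exact/(pnorm_diff_ae (vdF FG sT) (vdF FG' sT))/FF'.
Qed.

Lemma eq_on_laplacian (g h : plane -> R) : (forall p, Om p -> g p = h p) ->
  forall p, Om p -> laplacian g p = laplacian h p.
Proof.
move=> gh p Op; have e1 := eq_on_derivatives oOm gh.
have [ex _] := eq_on_derivatives oOm (fun q Oq => (e1 q Oq).1) Op.
have [_ ey] := eq_on_derivatives oOm (fun q Oq => (e1 q Oq).2) Op.
exact: (f_equal2 +%R ex ey).
Qed.

Lemma eq_on_dirichlet (g h : plane -> R) : (forall p, Om p -> g p = h p) ->
  dirichlet_integral Om g = dirichlet_integral Om h.
Proof.
move=> gh; rewrite /dirichlet_integral; apply: eq_Rintegral => p /set_mem Op.
have [ex ey] := eq_on_derivatives oOm gh Op.
exact: (f_equal2 (fun x y : R => x ^+ 2 + y ^+ 2) ex ey).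
Qed.

(** The time derivatives witnessing the equation and those of the regularity
   hypotheses are chosen independently; they agree almost everywhere. At time 0 they
   are the data [v0] and [w_init]. *)
Lemma kirchhoff_time_derivatives (al be : R -> R) (f u ut utt : R -> plane -> R) u0 v0 :
  kirchhoff_solution Om T al be f u0 v0 u ->
  vec_deriv (L2 Om) ip T u ut -> vec_deriv (L2 Om) ip T ut utt ->
  [/\ forall t, 0 <= t <= T -> ae_eq_on Om (f t)
        (utt t + (al t + be t * grad_norm Om (u t) ^+ 2) *: (fun p => - laplacian (u t) p)),
      ae_eq_on Om (ut 0) v0 & ae_eq_on Om (utt 0) (w_init Om al be f u0)].
Proof.
move=> [dom [u1 [u2 [C1 C2 pde uu0 u10]]]] d1 d2.
have zT : 0 <= (0 : R) <= T by rewrite lexx ltW.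
have e1 := vec_deriv_ae d1 (L2_C1_vec_deriv oOm C1) (fun t _ => ae_eq_on_refl Om (u t)).
have e2 := vec_deriv_ae d2 (L2_C1_vec_deriv oOm C2) e1.
split.
- move=> t tT; have := pde t tT; rewrite (dirichlet_integralE oOm bOm (dom t tT)) => pt.
  apply: ae2S2 pt (e2 t tT) => p h1 h2 Op; rewrite -(h1 Op) -(h2 Op).
  have -> : (utt t + (al t + be t * grad_norm Om (u t) ^+ 2) *:
      (fun p => - laplacian (u t) p)) p =
    utt t p + (al t + be t * grad_norm Om (u t) ^+ 2) * - laplacian (u t) p by [].
  by rewrite mulrN.
- exact: ae_eq_on_trans (e1 0 zT) u10.
- have := pde 0 zT; rewrite (eq_on_dirichlet uu0) => p0.
  apply: ae2S2 p0 (e2 0 zT) => p h1 h2 Op.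
  by rewrite (h2 Op) /w_init -(eq_on_laplacian uu0 Op) -(h1 Op) subrK.
Qed.

Lemma C11_time_opp_sum F G F' G' : L2_C1 Om T F G -> L2_lipschitz Om T G ->
  L2_C1 Om T F' G' -> L2_lipschitz Om T G' ->
  exists2 K, 0 < K & C11_time Om T K (fun t => - (F t + F' t)) (fun t => - (G t + G' t)).
Proof.
move=> /(L2_C1_vec_deriv oOm) FG lG /(L2_C1_vec_deriv oOm) FG' lG'.
have [M M0 hM] := L2_lipschitz_vec oOm (@vdG _ _ _ _ _ _ _ FG) lG.
have [M' M'0 hM'] := L2_lipschitz_vec oOm (@vdG _ _ _ _ _ _ _ FG') lG'.
apply: (C11_timeI oOm T0 (addr_ge0 M0 M'0)).
  exact: (vec_derivN H (vec_derivD H FG FG')).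
move=> s t sT tT.
have -> : - (G s + G' s) - - (G t + G' t) = - ((G s - G t) + (G' s - G' t)).
  by rewrite [RHS]opprD !opprB opprK [LHS]addrC opprD addrACA.
have S1 := phB H (vdG FG sT) (vdG FG tT); have S2 := phB H (vdG FG' sT) (vdG FG' tT).
rewrite (pnormN H (phD H S1 S2)); apply: le_trans (pnormD H S1 S2) _.
by rewrite mulrDl; apply: lerD; [exact: hM|exact: hM'].
Qed.

End Convergence.

(** * Second-order convergence of the scheme *)
Theorem theorem4p4 (R : realType) (Om : set (R * R)) (T : R)
  (al be : R -> R) (f u : R -> R * R -> R) (u0 v0 : R * R -> R)
  (hOm : bounded_convex_domain Om) (hT : 0 < T)
  (hal : C1_time T al) (hbe : C1_time T be)
  (hal_pos : forall t, 0 <= t <= T -> 0 < al t)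
  (hbe_pos : forall t, 0 <= t <= T -> 0 < be t)
  (hf : L2_continuous Om T f)
  (hu : well_posed_with_solution Om T al be f u0 v0 u)
  (* (i) *)
  (hu0 : dom_L0 Om u0)
  (hv0 : Ck_closure 1 Om v0)
  (hw0 : Ck_closure 1 Om (w_init Om al be f u0))
  (hux : exists uxt uxtt, L2_C1 Om T (fun t => dx (u t)) uxt /\
                          L2_C1 Om T uxt uxtt)
  (huy : exists uyt uytt, L2_C1 Om T (fun t => dy (u t)) uyt /\
                          L2_C1 Om T uyt uytt)
  (hf1 : forall t, 0 <= t <= T -> Ck_closure 1 Om (f t) /\
                                  zero_on_boundary Om (f t))
  (hf1_bounded : exists M : R, forall t p, 0 <= t <= T -> Om p ->
     `|dx (f t) p| <= M /\ `|dy (f t) p| <= M)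
  (hu0L : dom_L_pow Om 2 u0)
  (hv0L : dom_L Om v0)
  (hfL : dom_L_pow_continuous Om T 2^-1 f)
  (hf0L : dom_L Om (f 0))
  (* (ii) *)
  (hu3 : exists ut utt uttt,
     [/\ L2_C1 Om T u ut, L2_C1 Om T ut utt, L2_C1 Om T utt uttt &
         L2_lipschitz Om T uttt])
  (* (iii) *)
  (huxx : exists uxxt, L2_C1 Om T (fun t => dx (dx (u t))) uxxt /\
                       L2_lipschitz Om T uxxt)
  (huyy : exists uyyt, L2_C1 Om T (fun t => dy (dy (u t))) uyyt /\
                       L2_lipschitz Om T uyyt) :
  exists Tbar C1 C2 : R,
    [/\ 0 < Tbar <= T, 0 < C1, 0 < C2 &
    forall (n : nat) (U : nat -> R * R -> R), (1 < n)%N ->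
      scheme_solution Om T al be f u0 v0 n U ->
      let tau := T / n%:R in
      let z := fun k : nat => u (k%:R * tau) \- U k in
      let m := Num.truncn (Tbar / tau) in
      \big[Num.max/0]_(1 <= k < m.+1) grad_norm Om (z k) <= C1 * tau ^+ 2 /\
      \big[Num.max/0]_(1 <= k < m.+1)
         L2norm Om (fun p => (z k p - z k.-1 p) / tau) <= C2 * tau ^+ 2].
Proof.
have [oOm _ bOm _] := hOm; have zT : 0 <= (0 : R) <= T by rewrite lexx ltW.
have H := L2_pre_hilbert (open_measurable2 oOm).
have [[dom ksol] _] := hu.
have fr t : 0 <= t <= T -> friedrichs Om (u t) (fun p => - laplacian (u t) p).
  by move=> /dom /(dom_L0_friedrichs oOm bOm)[].
have gXY t : 0 <= t <= T -> weak_grad Om (u t) (dx (u t)) (dy (u t)).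
  by move=> /dom /(dom_L0_friedrichs oOm bOm)[].
have [ut [utt [uttt [C1u C1ut C1utt lip3]]]] := hu3.
have d1 := L2_C1_vec_deriv oOm C1u; have d2 := L2_C1_vec_deriv oOm C1ut.
have d3 := L2_C1_vec_deriv oOm C1utt.
have [M3 M30 l3] := L2_lipschitz_vec oOm (@vdG _ _ _ _ _ _ _ d3) lip3.
have [M2 M20 bM2] : exists2 M2, 0 < M2 &
    forall t, 0 <= t <= T -> pnorm (@L2ip R Om) (uttt t) <= M2.
  by have [_ c3 _] := C1utt; exact (L2_continuous_bounded oOm hT c3).
have l2 := vec_deriv_lipschitz H d3 bM2.
have [pde uv uw] := kirchhoff_time_derivatives oOm bOm hT (conj dom ksol) d1 d2.
have [X' [X'' [CX CX']]] := hux; have [Y' [Y'' [CY CY']]] := huy.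
have [KX KX0 hX] := C11_time_of_C2 oOm hT CX CX'.
have [KY KY0 hY] := C11_time_of_C2 oOm hT CY CY'.
have [xx [Cxx lxx]] := huxx; have [yy [Cyy lyy]] := huyy.
have [KL KL0 hL] := C11_time_opp_sum oOm hT Cxx lxx Cyy lyy.
have [loA [hiA [lipA [loA0 hiA0 lipA0 bA lA]]]] := C1_time_bounds hT hal hal_pos.
have [loB [hiB [lipB [loB0 hiB0 lipB0 bB lB]]]] := C1_time_bounds hT hbe hbe_pos.
have Lf t : 0 <= t <= T -> L2 Om (f t) by move=> /hf[].
have gv := Ck1_weak_grad oOm bOm hv0; have gw := Ck1_weak_grad oOm bOm hw0.
have [a [b [L [/andP[a0 a1] b0 L1 run]]]] := scheme_run_of_solution oOm bOm hT loA0 hiA0 lipA0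
  loB0 hiB0 lipB0 bA bB lA lB KX0 KY0 KL0 hX hY hL (ltW M20) M30 d1 d2 d3 l2 l3 Lf gXY fr pde
  gv gw uv uw.
(* For tau > Tbar no index is tested, so the smallness conditions may go to Tbar. *)
have [K K0 [tau0 tau00 boot]] := bootstrap a0 a1 b0 L1 hT.
pose Tbar := Num.min T (Num.min tau0 1).
have Tbar0 : 0 < Tbar by rewrite !lt_min hT tau00 ltr01.
exists Tbar, K, K; split=> //; first by rewrite Tbar0 /= ge_min lexx.
move=> n U n1 sol tau z m.
have n0 : (0 < n)%N := ltnW n1.
have nR : 0 < n%:R :> R by rewrite ltr0n.
have tau_gt0 : 0 < tau by rewrite divr_gt0.
have nT : n%:R * tau = T by rewrite /tau mulrCA mulfV ?mulr1// gt_eqF.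
have [U0 U1 [LU [SU [frSU sch]]]] := sol.
have frU k : (k <= n)%N -> friedrichs Om (U k) (LU k) by move=> /frSU[].
have SUE k : (k <= n)%N -> L2norm Om (SU k) = grad_norm Om (U k).
  by move=> /frSU[fk pk]; exact (half_power_norm oOm bOm fk pk).
have [_ [_ [_ _ _ u0E _]]] := ksol.
suff main k : (1 <= k < m.+1)%N -> grad_norm Om (z k) <= K * tau ^+ 2 /\
    L2norm Om (fun p => (z k p - z k.-1 p) / tau) <= K * tau ^+ 2.
  have Kt0 : 0 <= K * tau ^+ 2 by rewrite mulr_ge0 ?sqr_ge0// ltW.
  have mx (x y : R) : x <= K * tau ^+ 2 -> y <= K * tau ^+ 2 -> Num.max x y <= K * tau ^+ 2.
    by move=> hx hy; rewrite ge_max hx.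
  by split; rewrite big_nat; apply: (big_ind (fun x => x <= K * tau ^+ 2) Kt0 mx) => k /main[].
move=> /andP[k0 km]; rewrite ltnS in km.
have Tt0 : 0 <= Tbar / tau by rewrite divr_ge0// ltW.
have mT : m%:R * tau <= Tbar.
  by have /andP[h _] := truncn_itv Tt0; rewrite -ler_pdivlMr.
have kT : k%:R * tau <= Tbar.
  by apply: le_trans mT; rewrite ler_wpM2r ?(ltW tau_gt0)// ler_nat.
have tauT : tau <= Tbar.
  by apply: le_trans kT; rewrite ler_peMl ?(ltW tau_gt0)// ler1n.
have kn : (k <= n)%N.
  rewrite -(ler_nat R) -(ler_pM2r tau_gt0) nT; apply: le_trans kT _.
  by rewrite ge_min lexx.
have [t1 t2] : tau <= tau0 /\ tau <= 1.
  by move: tauT; rewrite !le_min => /and3P[].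
have tau01 : 0 < tau <= 1 by rewrite tau_gt0.
have nTle : n%:R * tau <= T by rewrite nT.
have U0' : ae_eq_on Om (U 0%N) (u 0) by apply: ae2S U0 => p hp Op; rewrite u0E//; exact: hp.
have U1' : ae_eq_on Om (U 1%N) (fun p => u 0 p + tau * v0 p +
    tau ^+ 2 / 2 * w_init Om al be f u0 p).
  by apply: ae2S U1 => p hp Op; rewrite u0E//; exact: hp.
have sch' j : (0 < j < n)%N -> ae_eq_on Om
    (fun p => (U j.+1 p - 2 * U j p + U j.-1 p) / tau ^+ 2 +
       2^-1 * (al (j%:R * tau) + be (j%:R * tau) / 2 *
         (grad_norm Om (U j.+1) ^+ 2 + grad_norm Om (U j.-1) ^+ 2)) *
       (LU j.+1 p + LU j.-1 p)) (f (j%:R * tau)).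
  move=> hj; have /andP[j0 jn] := hj; rewrite -(SUE _ jn) -SUE; first exact: sch.
  by rewrite (leq_trans (leq_pred _))// ltnW.
have hrun := run tau n U LU tau01 nTle n0 frU U0' U1' sch'.
have kk : (0 < k <= n)%N by rewrite k0.
have [e1 e2] := boot tau n _ _ _ _ _ _ t1 nTle hrun k kk.
split; first exact: e1.
have Lz j : (j <= n)%N -> L2 Om (z j).
  move=> jn; have [_ LUj _] := friedrichs_L2 (frU j jn).
  apply: (phB H) => //; apply: (vdF d1); rewrite mulr_ge0 ?ler0n ?(ltW tau_gt0)//=.
  by rewrite -nT ler_wpM2r ?(ltW tau_gt0)// ler_nat.
have kn' : (k.-1 <= n)%N := leq_trans (leq_pred _) kn.
have Ld : L2 Om (tau^-1 *: (z k - z k.-1)) by apply: (phZ H); apply: (phB H); exact: Lz.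
have -> : (fun p => (z k p - z k.-1 p) / tau) = tau^-1 *: (z k - z k.-1).
  by apply/funext => p; rewrite mulrC.
by rewrite (L2norm_pnorm Ld); exact: e2.
Qed.
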